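(* Let $(X_i,Y_i)$, $i=1,\dots,n$, be i.i.d. replications of a random pair $(X,Y)$, $X\in\mathbb R^{m_1\times m_2}$, $Y\in\mathbb R$, with $X$ uniformly distributed on $\mathcal X$. Assume that $|Y|\le\eta$ almost surely for some constant $\eta$. For $t>0$ let the regularization parameter $\lambda>0$ satisfy $$\lambda\ge4\eta\max\left\{\sqrt{\frac{t+\log m}{(m_1\wedge m_2)n}},\ \frac{2(t+\log m)}{n}\right\}.$$ Then with probability at least $1-e^{-t}$, $$R(\hat A^\lambda)\le R(A)+\min\left\{2\lambda\|A\|_1,\ \Big(\tfrac{1+\sqrt2}{2}\Big)^2m_1m_2\lambda^2\,\mathrm{rank}(A)\right\}$$ for all $A\in\mathbb R^{m_1\times m_2}$. In particular, if $n>4(m_1\wedge m_2)\log m$ and $\lambda=4\eta\sqrt{\frac{\log m}{(m_1\wedge m_2)n}}$, then with probability at least $1-3/(m_1+m_2)$, $$R(\hat A^\lambda)\le\min_{A\in\mathbb R^{m_1\times m_2}}\left(R(A)+4(1+\sqrt2)^2\eta^2\log(m)\,\frac{M\,\mathrm{rank}(A)}{n}\right).$$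
   Context: No model $\mathbb E(Y\mid X)=\langle A_0,X\rangle$ is assumed. $\mathcal X=\{e_j(m_1)e_k(m_2)^\top:1\le j\le m_1,\,1\le k\le m_2\}$, where $e_k(d)$ are the canonical basis vectors of $\mathbb R^d$; $m=m_1+m_2$, $M=\max(m_1,m_2)$, $m_1\wedge m_2=\min(m_1,m_2)$; $\langle A,B\rangle=\mathrm{tr}(A^\top B)$; $\|\cdot\|_1,\|\cdot\|_2$ are the nuclear and Frobenius norms. The prediction risk is $R(A)=\mathbb E[(Y-\langle A,X\rangle)^2]$; $R(\hat A^\lambda)$ means the function $R$ evaluated at the random matrix $\hat A^\lambda$ (expectation over an independent copy of $(X,Y)$). The estimator is the (unique) minimizer $$\hat A^\lambda=\mathop{\mathrm{argmin}}_{A\in\mathbb R^{m_1\times m_2}}\left(\frac1{m_1m_2}\|A\|_2^2-\Big\langle\frac2n\sum_{i=1}^nY_iX_i,A\Big\rangle+\lambda\|A\|_1\right).$$ *)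

(* Defs.v *)
From HB Require Import structures.
From mathcomp Require Import all_boot all_order all_algebra.
From mathcomp Require Import all_classical all_reals all_analysis.
Set Implicit Arguments.
Unset Strict Implicit.
Unset Printing Implicit Defensive.
Import Order.TTheory GRing.Theory Num.Theory.
Import numFieldNormedType.Exports.
Local Open Scope classical_set_scope.
Local Open Scope ring_scope.

(* MathComp and MathComp-Analysis; the real numbers are an arbitrary
   [R : realType]. *)

Definition mx_inner (R : realType) (m1 m2 : nat) (A B : 'M[R]_(m1, m2)) : R :=
  \tr (A^T *m B).

Definition frobenius_norm (R : realType) (m1 m2 : nat)
    (A : 'M[R]_(m1, m2)) : R :=
  Num.sqrt (mx_inner A A).

(* The nonzero singular values of A are the s > 0 such that s ^+ 2 is an
   eigenvalue of A^T A; the multiplicity of s is the dimension of the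
   corresponding eigenspace. *)
Definition singular_values (R : realType) (m1 m2 : nat)
    (A : 'M[R]_(m1, m2)) : set R :=
  [set s | 0 < s /\ eigenvalue (A^T *m A) (s ^+ 2)].

Definition singular_mult (R : realType) (m1 m2 : nat)
    (A : 'M[R]_(m1, m2)) (s : R) : nat :=
  \rank (eigenspace (A^T *m A) (s ^+ 2)).

Definition nuclear_norm (R : realType) (m1 m2 : nat)
    (A : 'M[R]_(m1, m2)) : R :=
  \sum_(s \in singular_values A) s *+ singular_mult A s.

Definition is_argmin (d : Order.disp_t) (V : porderType d) (U : Type)
    (f : U -> V) (x : U) : Prop :=
  forall y, (f x <= f y)%O.

(* Matrices with the Borel sigma-algebra of the usual topology. *)
Definition borelMx (R : realType) (m1 m2 : nat) :=
  g_sigma_algebraType (@open 'M[R]_(m1, m2)).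

(* Some of the [B i] may be [setT], so the product rule for every subfamily is
   included. *)
Definition mutually_independent (d : measure_display) (T : measurableType d)
    (R : realType) (P : probability T R) (d' : measure_display)
    (T' : measurableType d') (n : nat) (Z : 'I_n -> T -> T') : Prop :=
  forall B : 'I_n -> set T', (forall i, measurable (B i)) ->
    P (\bigcap_i (Z i @^-1` B i)) = (\prod_(i < n) P (Z i @^-1` B i))%E.

Definition same_law (d : measure_display) (T : measurableType d)
    (R : realType) (P : probability T R) (d' : measure_display)
    (T' : measurableType d') (Z Z' : T -> T') : Prop :=
  forall B : set T', measurable B -> P (Z @^-1` B) = P (Z' @^-1` B).

Definition iid_replications (d : measure_display) (T : measurableType d)
    (R : realType) (P : probability T R) (d' : measure_display)
    (T' : measurableType d') (n : nat) (Z : 'I_n -> T -> T')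
    (Z0 : T -> T') : Prop :=
  mutually_independent P Z /\ forall i, same_law P (Z i) Z0.

Definition with_prob_ge (d : measure_display) (T : measurableType d)
    (R : realType) (P : probability T R) (E : set T) (p : R) : Prop :=
  measurable E /\ (p%:E <= P E)%E.

(* [delta_mx j k] is e_j(m1) e_k(m2)^T; the m1 * m2 atoms have total mass 1. *)
Definition uniform_basis (d : measure_display) (T : measurableType d)
    (R : realType) (P : probability T R) (m1 m2 : nat)
    (X : T -> 'M[R]_(m1, m2)) : Prop :=
  forall (j : 'I_m1) (k : 'I_m2),
    P [set w | X w = delta_mx j k] = ((m1 * m2)%:R^-1)%:E.

(* Extended-real valued, as expectations are; it is a deterministic function
   of A, so [risk P X Y (Ahat w)] is the risk on an independent copy. *)
Definition risk (d : measure_display) (T : measurableType d)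
    (R : realType) (P : probability T R) (m1 m2 : nat)
    (X : T -> 'M[R]_(m1, m2)) (Y : T -> R) (A : 'M[R]_(m1, m2)) : \bar R :=
  'E_P[fun w => (Y w - mx_inner A (X w)) ^+ 2].

Definition penalized_criterion (R : realType) (m1 m2 n : nat) (lambda : R)
    (x : 'I_n -> 'M[R]_(m1, m2)) (y : 'I_n -> R) (A : 'M[R]_(m1, m2)) : R :=
  (m1 * m2)%:R^-1 * frobenius_norm A ^+ 2
  - mx_inner ((2 / n%:R) *: \sum_(i < n) y i *: x i) A
  + lambda * nuclear_norm A.

(* A minimizer is unique by strict convexity of the Frobenius term. *)
Definition is_nuclear_estimator (T : Type) (R : realType) (m1 m2 n : nat)
    (lambda : R) (Xs : 'I_n -> T -> 'M[R]_(m1, m2)) (Ys : 'I_n -> T -> R)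
    (Ahat : T -> 'M[R]_(m1, m2)) : Prop :=
  forall w, is_argmin
    (penalized_criterion lambda (fun i => Xs i w) (fun i => Ys i w)) (Ahat w).

(* Main.v *)
(* Up to a constant, the risk of A is |A - A0|_2^2 / (m1 m2) with
   A0 = m1 m2 E(Y X), and the estimator is the proximal point of
   Z = (m1 m2 / n) sum_i Y_i X_i for 2 tau |.|_1, tau = m1 m2 lambda / 2.  When
   the operator norm of Z - A0 is at most tau, both oracle inequalities hold
   deterministically.  The proximal map is 1-Lipschitz, so the event in question
   is measurable although the estimator is only given pointwise.

   The operator norm is controlled after discretizing Y, by running a potential
   that dominates the indicator of the bad event and does not increase in mean.
   The potential tr exp(theta D(W) + k G), D the Hermitian dilation, with the
   Golden-Thompson inequality, gives the first claim.  The factor 3 of the second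
   claim is beyond the reach of that Bernstein-type bound when log m is large:
   there the potential is tr exp(theta_k W W^T + mu_k |W|_2^2 + nu_k), whose
   parameters follow an explicitly solvable Riccati recursion. *)

(* Let a <= b be the two dimensions, L = log m, de = n/a; the second claim needs the threshold s = 2
   sqrt(de L). When only de >= 4 L is known, the best Bernstein exponent can exceed the Gaussian
   value -2 L by a fixed fraction of L: a power of m is lost. The second potential escapes this
   because an observation falls on a uniformly random entry: the mean square of the change of W W^T
   is about W W^T / b plus |W|^2 / (ab) times the identity, which has the form of the potential
   again. The final coefficient 1/(2 de) of W W^T gives exactly 2 L at the threshold, and the whole
   recursion costs a bounded factor e^nu <= 6; as a <= m/2, this becomes 3. Expanding exp to second
   order is legitimate only while |W| < s, which suffices since at larger W the potential is already
   at least 1. Golden-Thompson alone would not iterate, because it separates the factors; the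
   convexity bound tr(e^A (1 + G)) <= tr e^(A + G) restores a single exponent after each step. *)
Require Import Defs.
From mathcomp Require Import all_boot all_order all_algebra.
From mathcomp Require Import all_classical all_reals all_analysis measurable_realfun.
From mathcomp Require Import ring lra.
From mathcomp Require complex.
Set Implicit Arguments.
Unset Strict Implicit.
Unset Printing Implicit Defensive.
Import Order.TTheory GRing.Theory Num.Theory.
Import numFieldNormedType.Exports.
Local Open Scope classical_set_scope.
Local Open Scope ring_scope.

(** * Squared length, quadratic forms and the real spectral theorem *)

Definition sqn {R : realType} {n : nat} (x : 'rV[R]_n) : R := (x *m x^T) 0 0.
Definition qf {R : realType} {n : nat} (A : 'M[R]_n) (x : 'rV[R]_n) : R :=
  (x *m A *m x^T) 0 0.

Lemma sqnE (R : realType) n (x : 'rV[R]_n) : sqn x = \sum_i x 0 i ^+ 2.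
Proof. by rewrite /sqn mxE; apply: eq_bigr => i _; rewrite mxE expr2. Qed.

Lemma sqn_ge0 (R : realType) n (x : 'rV[R]_n) : 0 <= sqn x.
Proof. by rewrite sqnE; apply: sumr_ge0 => i _; rewrite sqr_ge0. Qed.

Lemma sqn_eq0 (R : realType) n (x : 'rV[R]_n) : (sqn x == 0) = (x == 0).
Proof.
apply/idP/idP => [|/eqP ->]; last by rewrite /sqn mul0mx mxE.
rewrite sqnE psumr_eq0 => [/allP H|i _]; last by rewrite sqr_ge0.
apply/eqP/rowP => i; rewrite [RHS]mxE.
by have := H i (mem_index_enum i); rewrite /= sqrf_eq0 => /eqP.
Qed.

Lemma sqnZ (R : realType) n (a : R) (x : 'rV[R]_n) : sqn (a *: x) = a ^+ 2 * sqn x.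
Proof. by rewrite /sqn linearZ /= -scalemxAl -scalemxAr scalerA mxE expr2. Qed.

Section Real_eigenvector.
Import complex.

(** Over the algebraically closed R[i] there is an eigenvector x + iy with eigenvalue al + i be.
    Symmetry gives <xA, y> = <yA, x>, which forces be (|x|^2 + |y|^2) = 0; so al is an eigenvalue
    and x or y a real eigenvector. *)
Lemma sym_eigenvector (R : realType) n (A : 'M[R]_n.+1) : A^T = A ->
  exists (a : R) (v : 'rV[R]_n.+1), v *m A = a *: v /\ sqn v = 1.
Proof.
move=> symA.
pose f : {rmorphism R -> R[i]} := real_complex R.
suff [a [v [va v0]]] : exists (a : R) (v : 'rV[R]_n.+1), v *m A = a *: v /\ v != 0.
  exists a, ((Num.sqrt (sqn v))^-1 *: v); rewrite -scalemxAl va; split.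
    by rewrite !scalerA mulrC.
  rewrite sqnZ exprVn sqr_sqrtr ?sqn_ge0// mulVf// sqn_eq0//.
have [z] := @spectral.eigenvalue_closed R[i] n.+1 (map_mx f A) isT.
case/eigenvalueP => w wA w0.
pose x := map_mx (@Re R) w; pose y := map_mx (@Im R) w.
have wE i : w 0 i = (x 0 i +i* y 0 i)%C by rewrite !mxE; case: (w 0 i).
have HA i : \sum_j w 0 j * f (A j i) = z * w 0 i.
  by have := congr1 (fun M : 'rV_n.+1 => M 0 i) wA; rewrite !mxE => <-; apply: eq_bigr => j _; rewrite mxE.
case: z => al be in wA HA *.
have Resum (F : 'I_n.+1 -> R[i]) : Re (\sum_j F j) = \sum_j Re (F j).
  by apply: (big_morph (@Re R)) => // -[a b] [c d].
have Imsum (F : 'I_n.+1 -> R[i]) : Im (\sum_j F j) = \sum_j Im (F j).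
  by apply: (big_morph (@Im R)) => // -[a b] [c d].
have xA : x *m A = al *: x - be *: y.
  apply/rowP => i; have := congr1 (@Re R) (HA i); rewrite Resum wE /= => H.
  rewrite !mxE in H *; rewrite -H; apply: eq_bigr => j _.
  by rewrite wE /= mulr0 subr0 !mxE.
have yA : y *m A = al *: y + be *: x.
  apply/rowP => i; have := congr1 (@Im R) (HA i); rewrite Imsum wE /= => H.
  rewrite !mxE in H *; rewrite -H; apply: eq_bigr => j _.
  by rewrite wE /= mulr0 add0r !mxE.
have xy0 : sqn x + sqn y != 0.
  apply: contra w0; rewrite paddr_eq0 ?sqn_ge0// !sqn_eq0 => /andP[/eqP x0 /eqP y0].
  by apply/eqP/rowP => i; rewrite wE x0 y0 !mxE.
have be0 : be = 0.
  have lin (c d : R) (u v w' : 'rV[R]_n.+1) :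
      ((c *: u + d *: v) *m w'^T) 0 0 = c * (u *m w'^T) 0 0 + d * (v *m w'^T) 0 0.
    by rewrite mulmxDl -!scalemxAl !mxE.
  have E : (x *m A *m y^T) 0 0 = (y *m A *m x^T) 0 0.
    have <- : (x *m A *m y^T)^T = y *m A *m x^T by rewrite !trmx_mul trmxK symA mulmxA.
    by rewrite [RHS]mxE.
  have C : (x *m y^T) 0 0 = (y *m x^T) 0 0.
    have <- : (x *m y^T)^T = y *m x^T by rewrite trmx_mul trmxK.
    by rewrite [RHS]mxE.
  move: E; rewrite xA yA -scaleNr !lin -!/(sqn _) C => E.
  have /eqP : be * (sqn x + sqn y) = 0 by move: E; rewrite mulrDr /sqn; lra.
  by rewrite mulf_eq0 (negPf xy0) orbF => /eqP.
exists al; rewrite be0 !scale0r ?subr0 ?addr0 in xA yA.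
have [x0|x0] := eqVneq x 0; last by exists x.
exists y; split=> //; apply: contra xy0 => /eqP ->.
by rewrite x0 /sqn !mul0mx mxE addr0.
Qed.
End Real_eigenvector.


(** [Q] is the Householder reflection along [e - v], which exchanges [e] and [v]; when these
    coincide the identity serves. *)
Lemma orthogonal_first_row (R : realType) n (v : 'rV[R]_n.+1) : sqn v = 1 ->
  exists Q : 'M[R]_n.+1, Q *m Q^T = 1%:M /\ delta_mx 0 0 *m Q = v.
Proof.
move=> v1; pose e : 'rV[R]_n.+1 := delta_mx 0 0; pose u := e - v.
have ee : e *m e^T = 1%:M by rewrite [LHS]mx11_scalar /e trmx_delta mul_delta_mx mxE !eqxx.
have vv : v *m v^T = 1%:M by rewrite [LHS]mx11_scalar -/(sqn v) v1.
have [u0|u0] := eqVneq u 0.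
  exists 1%:M; rewrite trmx1 !mulmx1; split=> //.
  by apply/eqP; rewrite -subr_eq0 -/e -/u u0.
pose t := sqn u; have t0 : t != 0 by rewrite sqn_eq0.
have uu : u *m u^T = t%:M by rewrite [LHS]mx11_scalar.
have ve : v *m e^T = e *m v^T.
  rewrite [LHS]mx11_scalar [RHS]mx11_scalar; congr (_%:M); rewrite !mxE.
  by apply: eq_bigr => i _; rewrite !mxE mulrC.
have eu : e *m u^T = (t / 2)%:M.
  have : u *m u^T = 2 *: (e *m u^T).
    rewrite /u linearB /= mulmxBl !mulmxBr ee vv ve scalerBr.
    by rewrite !scaler_nat !mulr2n; apply/matrixP => i j; rewrite !mxE; ring.
  rewrite uu => E; apply: (scalerI (a := 2)); first by rewrite pnatr_eq0.
  by rewrite -E scale_scalar_mx mulrC divfK// pnatr_eq0.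
have uE : e - u = v by rewrite /u opprB addrCA subrr addr0.
clearbody u.
pose Q := 1%:M - (2 / t) *: (u^T *m u).
have QT : Q^T = Q by rewrite /Q linearB /= trmx1 linearZ /= trmx_mul trmxK.
exists Q; rewrite QT; split.
  rewrite /Q mulmxBl mul1mx mulmxBr mulmx1 -scalemxAl -scalemxAr.
  rewrite -!mulmxA (mulmxA u) uu mul_scalar_mx -scalemxAr !scalerA.
  have -> : 2 / t * (2 / t * t) = 2 / t + 2 / t by field.
  by rewrite scalerDl opprB addrK subrK.
rewrite -/e /Q mulmxBr mulmx1 -scalemxAr mulmxA eu mul_scalar_mx scalerA.
have -> : 2 / t * (t / 2) = 1 by field.
by rewrite scale1r uE.
Qed.

(** Deflation: in a basis whose first vector is an eigenvector, the first row of the conjugate [B]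
    is a multiple of the first basis vector; symmetry then clears the first column too and leaves a
    smaller symmetric block. *)
Theorem sym_spectral (R : realType) n (A : 'M[R]_n) : A^T = A ->
  exists (O : 'M[R]_n) (d : 'rV[R]_n), O *m O^T = 1%:M /\ A = O^T *m diag_mx d *m O.
Proof.
elim: n A => [|n IH] A symA.
  by exists 1%:M, 0; split; apply/matrixP => -[].
have [a [v [vA v1]]] := sym_eigenvector symA.
have [Q [QQ eQ]] := orthogonal_first_row v1.
have QQ' : Q^T *m Q = 1%:M by apply: mulmx1C.
pose B : 'M[R]_(1 + n) := Q *m A *m Q^T.
have symB : B^T = B by rewrite /B !trmx_mul trmxK symA mulmxA.
have eB : (delta_mx 0 0 : 'rV_(1 + n)) *m B = a *: (delta_mx 0 0 : 'rV_(1 + n)).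
  by rewrite /B !mulmxA eQ vA -scalemxAl -eQ -mulmxA QQ mulmx1.
have rB : row 0 B = a *: delta_mx 0 0 by rewrite rowE.
have Bu : usubmx B = row_mx a%:M 0.
  apply/matrixP => i j; rewrite !ord1 mxE.
  have := congr1 (fun M : 'rV_(1 + n) => M 0 j) rB; rewrite /= mxE.
  have -> : lshift n (0 : 'I_1) = 0 :> 'I_(1 + n) by apply/val_inj.
  move=> ->; rewrite !mxE; case: splitP => k; rewrite ?ord1 /= => jk.
    by rewrite (_ : j = 0 :> 'I_(1 + n)) ?eqxx ?mxE ?mulr1 ?mulr1n//; apply/val_inj.
  by rewrite -val_eqE /= jk mulr0 mxE.
have symD : (drsubmx B)^T = drsubmx B by rewrite trmx_drsub symB.
have [U [d' [UU BE]]] := IH _ symD.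
have BB : B = block_mx a%:M 0 0 (drsubmx B).
  rewrite -[LHS]submxK; congr block_mx.
  - by rewrite /ulsubmx Bu row_mxKl.
  - by rewrite /ursubmx Bu row_mxKr.
  - by rewrite -[LHS]trmxK trmx_dlsub symB /ursubmx Bu row_mxKr trmx0.
pose P : 'M[R]_(1 + n) := block_mx 1%:M 0 0 U.
have PP : P *m P^T = 1%:M.
  by rewrite tr_block_mx !trmx0 trmx1 mulmx_block !(mulmx0, mul0mx, mulmx1) !addr0 add0r UU -scalar_mx_block.
exists (P *m Q), (row_mx a%:M d'); split.
  by rewrite trmx_mul mulmxA -(mulmxA P) QQ mulmx1.
have BP : B = P^T *m diag_mx (row_mx a%:M d') *m P.
  rewrite BB diag_mx_row tr_block_mx !trmx0 trmx1 !mulmx_block !(mulmx0, mul0mx, mulmx1, mul1mx) !addr0 !add0r -BE mul0mx.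
  by congr block_mx; apply/matrixP => i j; rewrite !ord1 !mxE.
by rewrite trmx_mul !mulmxA -(mulmxA Q^T) -(mulmxA Q^T) -BP /B !mulmxA QQ' mul1mx -mulmxA QQ' mulmx1.
Qed.

(** * Functional calculus, Loewner order and trace inequalities for the exponential *)

Definition sdec {R : realType} {n : nat} (A U : 'M[R]_n) (d : 'rV[R]_n) : Prop :=
  U *m U^T = 1%:M /\ A = U^T *m diag_mx d *m U.

(** The decomposition is picked by [xget]; [sdec_uniq] shows that the value does not depend on it.
    The default 0 is reached only by non-symmetric matrices. *)
Definition fc {R : realType} {n : nat} (f : R -> R) (A : 'M[R]_n) : 'M[R]_n :=
  xget 0 [set M | exists U d, sdec A U d /\ M = U^T *m diag_mx (map_mx f d) *m U].

Definition mexp {R : realType} {n : nat} (A : 'M[R]_n) : 'M[R]_n := fc expR A.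

Definition lef {R : realType} {n : nat} (A B : 'M[R]_n) : Prop :=
  forall x, qf A x <= qf B x.

Section Spectral_calculus.
Context {R : realType} {n : nat}.
Implicit Types (A B U : 'M[R]_n) (d x : 'rV[R]_n) (f g : R -> R).

Lemma sym_sdec A : A^T = A -> exists U d, sdec A U d.
Proof. exact: sym_spectral. Qed.

Lemma sdec_tr A U d : sdec A U d -> A^T = A.
Proof. by move=> [_ ->]; rewrite !trmx_mul tr_diag_mx trmxK mulmxA. Qed.

Lemma sdecK A U d : sdec A U d -> U^T *m U = 1%:M.
Proof. by case=> /mulmx1C. Qed.

(** The change of basis [M] intertwines the two diagonals, so its entries are nonzero only between
    equal eigenvalues; hence it also intertwines their images under [f]. *)
Lemma sdec_uniq f A U1 d1 U2 d2 : sdec A U1 d1 -> sdec A U2 d2 ->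
  U1^T *m diag_mx (map_mx f d1) *m U1 = U2^T *m diag_mx (map_mx f d2) *m U2.
Proof.
move=> s1 s2; pose M := U1 *m U2^T.
have E : diag_mx d1 *m M = M *m diag_mx d2.
  have : U1 *m A *m U2^T = U1 *m A *m U2^T by [].
  rewrite {1}s1.2 s2.2 !mulmxA s1.1 mul1mx -!mulmxA s2.1 mulmx1.
  by rewrite /M !mulmxA.
have F : diag_mx (map_mx f d1) *m M = M *m diag_mx (map_mx f d2).
  apply/matrixP => i j; have := congr1 (fun Z : 'M[R]_n => Z i j) E.
  rewrite !mul_diag_mx !mul_mx_diag [X in X = _ -> _]mxE [X in _ = X -> _]mxE.
  move=> H; rewrite [LHS]mxE [RHS]mxE [map_mx f d1 _ _]mxE [map_mx f d2 _ _]mxE.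
  move: H; rewrite mulrC.
  have [->|M0 /(mulfI M0) ->] := eqVneq (M i j) 0; first by rewrite !(mulr0, mul0r).
  by rewrite mulrC.
have : U1^T *m (diag_mx (map_mx f d1) *m M) *m U2 = U1^T *m (M *m diag_mx (map_mx f d2)) *m U2 by rewrite F.
rewrite /M !mulmxA (sdecK s1) mul1mx => <-.
by rewrite -!mulmxA (sdecK s2) mulmx1.
Qed.

Lemma fcE f A U d : sdec A U d -> fc f A = U^T *m diag_mx (map_mx f d) *m U.
Proof.
move=> s; rewrite /fc; case: xgetP => [M _ [U1 [d1 [s1 ->]]]|].
  exact: sdec_uniq s1 s.
by move=> /(_ (U^T *m diag_mx (map_mx f d) *m U)) []; exists U, d.
Qed.

Lemma sdec_fc f A U d : sdec A U d -> sdec (fc f A) U (map_mx f d).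
Proof. by move=> s; split; [exact: s.1|rewrite (fcE f s)]. Qed.

Lemma sdecM A B U d e : sdec A U d -> sdec B U e ->
  sdec (A *m B) U (\row_i (d 0 i * e 0 i)).
Proof.
move=> s t; split; first exact: s.1.
rewrite s.2 t.2 !mulmxA -(mulmxA _ U) s.1 mulmx1 -(mulmxA _ (diag_mx d)) mulmx_diag.
by [].
Qed.

Lemma sdecD A B U d e : sdec A U d -> sdec B U e -> sdec (A + B) U (d + e).
Proof.
move=> s t; split; first exact: s.1.
by rewrite s.2 t.2 linearD /= mulmxDr mulmxDl.
Qed.

Lemma sdecZ a A U d : sdec A U d -> sdec (a *: A) U (a *: d).
Proof.
move=> s; split; first exact: s.1.
by rewrite s.2 linearZ /= -scalemxAr -scalemxAl.
Qed.

Lemma sdec_scalar a U A d : sdec A U d -> sdec a%:M U (const_mx a).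
Proof.
move=> s; split; first exact: s.1.
by rewrite diag_const_mx -mulmxA mul_scalar_mx -scalemxAr (sdecK s) scale_scalar_mx mulr1.
Qed.

Lemma sdec_trace A U d : sdec A U d -> \tr A = \sum_i d 0 i.
Proof.
move=> s; rewrite s.2 mxtrace_mulC mulmxA s.1 mul1mx mxtrace_diag.
by [].
Qed.

Lemma sdec_qf A U d x : sdec A U d -> qf A x = \sum_i d 0 i * (x *m U^T) 0 i ^+ 2.
Proof.
move=> s; rewrite /qf s.2 !mulmxA -mulmxA -[U *m x^T]trmxK trmx_mul trmxK.
rewrite mul_mx_diag mxE; apply: eq_bigr => i _.
by rewrite [X in X * _]mxE [X in _ * X]mxE; ring.
Qed.

Lemma sdec_sqn A U d x : sdec A U d -> sqn x = \sum_i (x *m U^T) 0 i ^+ 2.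
Proof.
by move=> s; rewrite -sqnE /sqn trmx_mul trmxK mulmxA -(mulmxA x) (sdecK s) mulmx1.
Qed.

Lemma sdec_row_sqn A U d i : sdec A U d -> sqn (row i U) = 1.
Proof.
move=> s; rewrite /sqn tr_row.
by have := congr1 (fun M : 'M[R]_n => M i i) s.1; rewrite !mxE eqxx mulr1n => <-; apply: eq_bigr => j _; rewrite !mxE.
Qed.

Lemma sdec_trM A U d B : sdec A U d -> \tr (A *m B) = \sum_i d 0 i * qf B (row i U).
Proof.
move=> s; rewrite s.2 -!mulmxA mxtrace_mulC -!mulmxA mul_diag_mx /mxtrace.
apply: eq_bigr => i _; rewrite mxE /qf; congr (_ * _).
by rewrite -row_mul tr_row mulmxA -!row_mul !mxE; apply: eq_bigr => j _; rewrite !mxE.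
Qed.

Lemma sdec_row_qf A U d i : sdec A U d -> qf A (row i U) = d 0 i.
Proof.
move=> s; rewrite (sdec_qf _ s) -row_mul s.1 (bigD1 i)//= big1 => [|j ji].
  by rewrite !mxE eqxx expr1n mulr1 addr0.
by rewrite !mxE eq_sym (negPf ji) expr0n mulr0.
Qed.

Lemma qfD A B x : qf (A + B) x = qf A x + qf B x.
Proof. by rewrite /qf mulmxDr mulmxDl mxE. Qed.

Lemma qfZ a A x : qf (a *: A) x = a * qf A x.
Proof. by rewrite /qf -scalemxAr -scalemxAl mxE. Qed.

Lemma qfN A x : qf (- A) x = - qf A x.
Proof. by rewrite -scaleN1r qfZ mulN1r. Qed.

Lemma qfB A B x : qf (A - B) x = qf A x - qf B x.
Proof. by rewrite qfD qfN. Qed.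

Lemma qf_scalar a x : qf a%:M x = a * sqn x.
Proof. by rewrite /qf mul_mx_scalar -scalemxAl mxE. Qed.

Lemma qf_sum (I : finType) (F : I -> 'M[R]_n) x : qf (\sum_i F i) x = \sum_i qf (F i) x.
Proof. by rewrite /qf mulmx_sumr mulmx_suml summxE. Qed.

Lemma qf0 x : qf 0 x = 0.
Proof. by rewrite /qf mulmx0 mul0mx mxE. Qed.

Lemma tr_fc f A : A^T = A -> (fc f A)^T = fc f A.
Proof. by move=> /sym_sdec[U [d s]]; exact: sdec_tr (sdec_fc f s). Qed.

Lemma tr_mexp A : A^T = A -> (mexp A)^T = mexp A.
Proof. exact: tr_fc. Qed.

Lemma mexp_shift A c : A^T = A -> mexp (A + c%:M) = expR c *: mexp A.
Proof.
move=> /sym_sdec[U [d s]].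
rewrite /mexp (fcE _ (sdecD s (sdec_scalar c s))) (fcE _ s) scalemxAl scalemxAr -linearZ /=.
by congr (_ *m diag_mx _ *m _); apply/rowP => i; rewrite !mxE expRD mulrC.
Qed.

Lemma lef_trM A B C : C^T = C -> lef 0 C -> lef A B -> \tr (C *m A) <= \tr (C *m B).
Proof.
move=> /sym_sdec[U [d s]] C0 AB; rewrite !(sdec_trM _ s); apply: ler_sum => i _.
by rewrite ler_wpM2l// -(sdec_row_qf i s) -(qf0 (row i U)).
Qed.

Lemma mexp_ge0 A : A^T = A -> lef 0 (mexp A).
Proof.
move=> /sym_sdec[U [d s]] x; rewrite qf0 (sdec_qf _ (sdec_fc _ s)).
by apply: sumr_ge0 => i _; rewrite mulr_ge0 ?sqr_ge0// mxE expR_ge0.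
Qed.

Lemma expR_tangent (a b : R) : expR a * (1 + b - a) <= expR b.
Proof.
have -> : expR b = expR a * expR (b - a) by rewrite -expRD addrC subrK.
by rewrite ler_wpM2l ?expR_ge0// -addrA expR_ge1Dx.
Qed.

(** Jensen's inequality: for unit [x] the squared coordinates in an eigenbasis are weights under
    which the eigenvalues have mean [qf A x], and the tangent to exp is taken at that mean. *)
Lemma qf_mexp_ge A x : A^T = A -> sqn x = 1 -> expR (qf A x) <= qf (mexp A) x.
Proof.
move=> /sym_sdec[U [d s]] x1; rewrite (sdec_qf _ (sdec_fc _ s)).
set b := qf A x; apply: (@le_trans _ _ (\sum_i expR b * (1 + d 0 i - b) * (x *m U^T) 0 i ^+ 2)).
  have E : \sum_i (1 + d 0 i - b) * (x *m U^T) 0 i ^+ 2 = 1.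
    rewrite (eq_bigr (fun i => (1 - b) * (x *m U^T) 0 i ^+ 2 + d 0 i * (x *m U^T) 0 i ^+ 2)); last by move=> i _; ring.
    by rewrite big_split /= -mulr_sumr -(sdec_sqn x s) x1 mulr1 -(sdec_qf x s) subrK.
  by under eq_bigr do rewrite -mulrA; rewrite -mulr_sumr E mulr1.
by apply: ler_sum => i _; rewrite ler_wpM2r ?sqr_ge0// mxE expR_tangent.
Qed.

(** Klein's inequality, that is convexity of tr exp. In the eigenbasis of [A] the trace of [mexp B]
    dominates the sum of the exponentials of the diagonal entries of [B]; the scalar tangent at each
    eigenvalue of [A] finishes. *)
Lemma mexp_klein A B : A^T = A -> B^T = B ->
  \tr (mexp A *m (1%:M + B - A)) <= \tr (mexp B).
Proof.
move=> /sym_sdec[U [d s]] sB; rewrite (sdec_trM _ (sdec_fc _ s)).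
have -> : \tr (mexp B) = \sum_i qf (mexp B) (row i U).
  have := sdec_trM (mexp B) (sdec_scalar 1 s); rewrite mul1mx => ->.
  by apply: eq_bigr => i _; rewrite mxE mul1r.
apply: ler_sum => i _; have x1 := sdec_row_sqn i s.
apply: le_trans (qf_mexp_ge sB x1).
by rewrite qfB qfD qf_scalar x1 mulr1 (sdec_row_qf i s) mxE expR_tangent.
Qed.

(** The exponential is not monotone for the Loewner order, but its trace is: by Klein's inequality
    the traces differ by at least the trace of the product of the nonnegative matrices [mexp A] and
    [B - A]. *)
Lemma tr_mexp_le A B : A^T = A -> B^T = B -> lef A B -> \tr (mexp A) <= \tr (mexp B).
Proof.
move=> sA sB AB; apply: le_trans (mexp_klein sA sB).
rewrite -[X in \tr X <= _]mulmx1; apply: lef_trM; [exact: tr_mexp|exact: mexp_ge0|].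
by move=> x; rewrite qfB qfD -addrA lerDl subr_ge0.
Qed.

Lemma tr_mexp_ge A x : A^T = A -> sqn x = 1 -> expR (qf A x) <= \tr (mexp A).
Proof.
move=> sA x1; apply: (le_trans (qf_mexp_ge sA x1)).
have [U [d s]] := sym_sdec sA; have sm := sdec_fc expR s.
rewrite (sdec_qf _ sm) (sdec_trace sm); apply: ler_sum => i _.
rewrite mxE ler_piMr ?expR_ge0// -x1 (sdec_sqn x s) (bigD1 i)//= lerDl.
by apply: sumr_ge0 => j _; rewrite sqr_ge0.
Qed.

(** A one-sided spectral bound suffices because the scalar inequality is assumed on a whole
    half-line, where [expR_quad_le] provides it. *)
Lemma mexp_quad A (x0 g : R) : A^T = A -> (forall x, qf A x <= x0 * sqn x) ->
  (forall t, t <= x0 -> expR t <= 1 + t + g * t ^+ 2) ->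
  lef (mexp A) (1%:M + A + g *: (A *m A)).
Proof.
move=> /sym_sdec[U [d s]] A0 H x.
rewrite (sdec_qf _ (sdec_fc _ s)) (sdec_qf _ (sdecD (sdecD (sdec_scalar 1 s) s) (sdecZ g (sdecM s s)))).
apply: ler_sum => i _; rewrite ler_wpM2r ?sqr_ge0// !mxE -expr2 H//.
by have := A0 (row i U); rewrite (sdec_row_qf i s) (sdec_row_sqn i s) mulr1.
Qed.

End Spectral_calculus.

(** * The Golden-Thompson inequality by a quantitative product formula *)

Section Golden_Thompson.
Context {R : realType} {n : nat}.
Implicit Types (A B X Y Z P Q : 'M[R]_n).

Lemma trM_ge0 Z : 0 <= \tr (Z * Z^T).
Proof.
rewrite /mxtrace; apply: sumr_ge0 => i _; rewrite -mulmxE mxE.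
by apply: sumr_ge0 => j _; rewrite mxE -expr2 sqr_ge0.
Qed.

Lemma trmxB A B : (A - B)^T = A^T - B^T.
Proof. by apply/matrixP => i j; rewrite !mxE. Qed.

Lemma trB A B : \tr (A - B) = \tr A - \tr B.
Proof. by rewrite /mxtrace -sumrB; apply: eq_bigr => i _; rewrite !mxE. Qed.

Lemma tr_mulC A B : \tr (A * B) = \tr (B * A).
Proof. by rewrite -!mulmxE mxtrace_mulC. Qed.

Lemma trmxM A B : (A * B)^T = B^T * A^T.
Proof. by rewrite -!mulmxE trmx_mul. Qed.

Lemma tr_exprM_cyc A B k : \tr ((A * B) ^+ k) = \tr ((B * A) ^+ k).
Proof.
case: k => [|k]; first by rewrite !expr0.
have E j : (A * B) ^+ j * A = A * (B * A) ^+ j.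
  elim: j => [|j IH]; first by rewrite !expr0 mul1r mulr1.
  by rewrite exprS -mulrA IH exprS !mulrA.
by rewrite exprSr mulrA E tr_mulC mulrA exprS.
Qed.

Lemma trX2_le X Y : X^T = X -> Y^T = Y -> \tr (X * Y) <= (\tr (X ^+ 2) + \tr (Y ^+ 2)) / 2.
Proof.
move=> sX sY; have := trM_ge0 (X - Y).
rewrite trmxB sX sY mulrBl !mulrBr !trB -!expr2 (tr_mulC Y X).
lra.
Qed.

Lemma trZ2_le Z : \tr (Z ^+ 2) <= \tr (Z * Z^T).
Proof.
have := trM_ge0 (Z - Z^T).
rewrite trmxB trmxK mulrBl !mulrBr !trB (tr_mulC Z^T Z).
have -> : \tr (Z^T * Z^T) = \tr (Z * Z) by rewrite -trmxM mxtrace_tr.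
rewrite expr2; lra.
Qed.

Lemma sym_exprX X k : X^T = X -> (X ^+ k)^T = X ^+ k.
Proof.
move=> sX; elim: k => [|k IH]; first by rewrite expr0 trmx1.
by rewrite exprS trmxM IH sX -exprSr exprS.
Qed.

(* Both families of trace inequalities are proved together: each instance of
   one rests on earlier instances of the other. *)
Lemma lieb_thirring_pow2 j :
  (forall X Y, X^T = X -> Y^T = Y ->
     \tr ((X * Y) ^+ (2 ^ j)) <= \tr (X ^+ (2 ^ j) * Y ^+ (2 ^ j))) /\
  (forall Z, \tr (Z ^+ (2 ^ j.+1)) <= \tr ((Z * Z^T) ^+ (2 ^ j))).
Proof.
elim: j => [|j [T H]].
  by split=> [X Y _ _|Z]; rewrite ?expn0 ?expn1 ?expr1//; exact: trZ2_le.
have T' X Y : X^T = X -> Y^T = Y ->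
    \tr ((X * Y) ^+ (2 ^ j.+1)) <= \tr (X ^+ (2 ^ j.+1) * Y ^+ (2 ^ j.+1)).
  move=> sX sY; apply: (le_trans (H _)).
  have -> : X * Y * (X * Y)^T = X * (Y ^+ 2 * X).
    by rewrite trmxM sX sY expr2 !mulrA.
  rewrite tr_exprM_cyc -mulrA -expr2 tr_exprM_cyc.
  apply: le_trans (T _ _ _ _) _; rewrite ?sym_exprX//.
  by rewrite -!exprM -!expnS.
split=> // Z; rewrite expnS exprM.
apply: (le_trans (H _)).
have -> : \tr ((Z ^+ 2 * (Z ^+ 2)^T) ^+ (2 ^ j)) = \tr ((Z^T * Z * (Z * Z^T)) ^+ (2 ^ j)).
  have -> : Z ^+ 2 * (Z ^+ 2)^T = Z * Z * Z^T * Z^T by rewrite !expr2 trmxM !mulrA.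
  by rewrite tr_exprM_cyc !mulrA.
have s1 : (Z^T * Z)^T = Z^T * Z by rewrite trmxM trmxK.
have s2 : (Z * Z^T)^T = Z * Z^T by rewrite trmxM trmxK.
apply: (le_trans (T _ _ s1 s2)).
apply: (le_trans (trX2_le (sym_exprX _ s1) (sym_exprX _ s2))).
rewrite -!exprM -!expnSr (tr_exprM_cyc Z^T); lra.
Qed.

(** The maximal row sum norm, elementary and submultiplicative; it measures the distance between the
    N-th powers of (1 + A/N)(1 + B/N) and of 1 + (A + B)/N. *)
Definition rowsum_le A (a : R) := forall i, \sum_j `|A i j| <= a.

Lemma rowsum_leM A B a b : 0 <= b -> rowsum_le A a -> rowsum_le B b -> rowsum_le (A * B) (a * b).
Proof.
move=> b0 Aa Bb i; apply: (@le_trans _ _ (\sum_k `|A i k| * b)); last by rewrite -mulr_suml ler_wpM2r.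
apply: (@le_trans _ _ (\sum_j \sum_k `|A i k| * `|B k j|)).
  apply: ler_sum => j _; rewrite -mulmxE mxE.
  by apply: (le_trans (ler_norm_sum _ _ _)); apply: ler_sum => k _; rewrite normrM.
rewrite exchange_big /=; apply: ler_sum => k _; rewrite -mulr_sumr.
by rewrite ler_wpM2l.
Qed.

Lemma rowsum_leD A B a b : rowsum_le A a -> rowsum_le B b -> rowsum_le (A + B) (a + b).
Proof.
move=> Aa Bb i; apply: (@le_trans _ _ (\sum_j (`|A i j| + `|B i j|))).
  by apply: ler_sum => j _; rewrite mxE ler_normD.
by rewrite big_split /= lerD.
Qed.

Lemma rowsum_leZ A a c : 0 <= c -> rowsum_le A a -> rowsum_le (c *: A) (c * a).
Proof.
move=> c0 Aa i; under eq_bigr do rewrite mxE normrM (ger0_norm c0).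
by rewrite -mulr_sumr ler_wpM2l.
Qed.

Lemma rowsum_le1 : rowsum_le 1%:M 1.
Proof.
move=> i; rewrite (bigD1 i)//= big1 => [|j ji]; rewrite mxE ?eqxx ?normr1 ?addr0//.
by rewrite eq_sym (negPf ji) normr0.
Qed.

Lemma rowsum_le_exists A : exists2 a, 0 <= a & rowsum_le A a.
Proof.
exists (\sum_i \sum_j `|A i j|).
  by apply: sumr_ge0 => i _; apply: sumr_ge0.
move=> i; rewrite [leRHS](bigD1 i)//= lerDl.
by apply: sumr_ge0 => k _; apply: sumr_ge0.
Qed.

Lemma rowsum_le_mon A a b : a <= b -> rowsum_le A a -> rowsum_le A b.
Proof. by move=> ab Aa i; apply: le_trans ab. Qed.

(** Telescoping: P^(k+1) - Q^(k+1) = P^k (P - Q) + (P^k - Q^k) Q. The natural power k - 1 of [p] is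
    relaxed to k, as 1 <= p. *)
Lemma rowsum_leX_sub P Q p e k : 1 <= p -> 0 <= e -> rowsum_le P p -> rowsum_le Q p ->
  rowsum_le (P - Q) e -> rowsum_le (P ^+ k) (p ^+ k) /\ rowsum_le (P ^+ k - Q ^+ k) (k%:R * e * p ^+ k).
Proof.
move=> p1 e0 Pp Qp PQ; have p0 : 0 <= p by lra.
elim: k => [|k [IHP IH]].
  rewrite !expr0 subrr; split; first exact: rowsum_le1.
  by move=> i; rewrite big1 ?mul0r// => j _; rewrite mxE normr0.
split; first by rewrite !exprS; apply: rowsum_leM => //; rewrite exprn_ge0.
have -> : P ^+ k.+1 - Q ^+ k.+1 = P ^+ k * (P - Q) + (P ^+ k - Q ^+ k) * Q.
  by rewrite mulrBr mulrBl -!exprSr addrA subrK.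
apply: (rowsum_le_mon _ (rowsum_leD (rowsum_leM e0 IHP PQ) (rowsum_leM p0 IH Qp))).
have : 0 <= p ^+ k * e * (p - 1) by rewrite !mulr_ge0 ?exprn_ge0// subr_ge0.
rewrite exprS -natr1; set q := p ^+ k; nra.
Qed.

Lemma rowsum_le_tr A a : rowsum_le A a -> \tr A <= n%:R * a.
Proof.
move=> Aa; rewrite /mxtrace.
have -> : n%:R * a = \sum_(i < n) a by rewrite sumr_const card_ord mulr_natl.
apply: ler_sum => i _; apply: le_trans (ler_norm _) _; apply: le_trans (Aa i).
by rewrite (bigD1 i)//= lerDl sumr_ge0.
Qed.

Lemma expr_le_expR (x : R) N : 0 <= 1 + x -> (1 + x) ^+ N <= expR (N%:R * x).
Proof.
move=> x0; rewrite mulrC expRM_natr.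
by apply: lerXn2r; rewrite ?nnegrE ?expR_ge0 ?expR_ge1Dx.
Qed.

Lemma bernoulli (x : R) N : 0 <= x <= 1 -> 1 - N%:R * x <= (1 - x) ^+ N.
Proof.
move=> /andP[x0 x1]; elim: N => [|N IH]; first by rewrite mul0r subr0 expr0.
rewrite exprS; apply: (@le_trans _ _ ((1 - x) * (1 - N%:R * x))).
  by rewrite -natr1; have : 0 <= N%:R :> R by []; nra.
by rewrite ler_wpM2l// subr_ge0.
Qed.

(** Since (1 - x) e^x <= 1, one has (1 - x^2) e^x <= 1 + x; this is raised to the power N, and
    Bernoulli bounds (1 - x^2)^N from below. *)
Lemma expR_le_expr (x : R) N : `|x| <= 1 -> expR (N%:R * x) * (1 - N%:R * x ^+ 2) <= (1 + x) ^+ N.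
Proof.
rewrite ler_norml => /andP[xm x1].
have x21 : x ^+ 2 <= 1 by rewrite expr2; nra.
apply: (@le_trans _ _ (expR (N%:R * x) * (1 - x ^+ 2) ^+ N)).
  by rewrite ler_wpM2l ?expR_ge0// bernoulli// sqr_ge0.
rewrite mulrC (mulrC N%:R) expRM_natr -exprMn; apply: lerXn2r.
- by rewrite nnegrE mulr_ge0 ?expR_ge0// subr_ge0.
- by rewrite nnegrE; lra.
have -> : 1 - x ^+ 2 = (1 + x) * (1 - x) by ring.
rewrite -mulrA -[leRHS]mulr1 ler_wpM2l//; first lra.
rewrite -[leRHS](expRxMexpNx_1 x) [leRHS]mulrC.
by rewrite ler_wpM2r ?expR_ge0// expR_ge1Dx.
Qed.

Lemma sdecX A U (d : 'rV[R]_n) k : sdec A U d -> sdec (A ^+ k) U (map_mx (fun t => t ^+ k) d).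
Proof.
move=> s; elim: k => [|k IH].
  have -> : map_mx (fun t : R => t ^+ 0) d = const_mx 1 by apply/rowP => i; rewrite !mxE expr0.
  exact: sdec_scalar s.
rewrite exprS; have -> : map_mx (fun t : R => t ^+ k.+1) d = \row_i (d 0 i * (map_mx (fun t => t ^+ k) d) 0 i).
  by apply/rowP => i; rewrite !mxE exprS.
exact: sdecM.
Qed.

Lemma lef_sdec A B U (d e : 'rV[R]_n) : sdec A U d -> sdec B U e ->
  (forall i, d 0 i <= e 0 i) -> lef A B.
Proof.
move=> s t de x; rewrite (sdec_qf x s) (sdec_qf x t).
by apply: ler_sum => i _; rewrite ler_wpM2r ?sqr_ge0.
Qed.

Lemma sdec_expr_le A U (d : 'rV[R]_n) N : sdec A U d -> (0 < N)%N -> (forall i, `|d 0 i| <= N%:R) ->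
  lef 0 ((1%:M + N%:R^-1 *: A) ^+ N) /\ lef ((1%:M + N%:R^-1 *: A) ^+ N) (mexp A).
Proof.
move=> s N0 dN; have t := sdecX N (sdecD (sdec_scalar 1 s) (sdecZ N%:R^-1 s)).
have N0' : 0 < N%:R :> R by rewrite ltr0n.
have P i : 0 <= 1 + N%:R^-1 * d 0 i.
  have : `|N%:R^-1 * d 0 i| <= 1.
    by rewrite normrM normfV (ger0_norm (ltW N0')) ler_pdivrMl// mulr1.
  rewrite ler_norml; lra.
split.
  move=> x; rewrite qf0 (sdec_qf x t); apply: sumr_ge0 => i _.
  by rewrite mulr_ge0 ?sqr_ge0// !mxE exprn_ge0.
apply: (lef_sdec t (sdec_fc _ s)) => i; rewrite !mxE.
by have := expr_le_expR N (P i); rewrite mulrA mulfV ?gt_eqF// mul1r.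
Qed.

Lemma ler_sum_finType (I : finType) (F : I -> R) i : (forall j, 0 <= F j) -> F i <= \sum_j F j.
Proof. by move=> F0; rewrite (bigD1 i)//= lerDl sumr_ge0. Qed.

(** The equation on [N] says that it is a power of two, as Lieb-Thirring requires. Up to errors of
    order 1/N, tr exp(A + B) is tr (1 + (A + B)/N)^N, which is tr ((1 + A/N)(1 + B/N))^N; this is at
    most tr (1 + A/N)^N (1 + B/N)^N, hence at most tr exp(A) exp(B). *)
Lemma tr_mul_mexp_ge A B N (c : 'rV[R]_n) U (a b : R) : A^T = A -> B^T = B ->
  sdec (A + B) U c -> N = (2 ^ trunc_log 2 N)%N ->
  0 <= a -> 0 <= b -> rowsum_le A a -> rowsum_le B b ->
  (forall i, `|c 0 i| <= N%:R) ->
  lef 0 ((1%:M + N%:R^-1 *: A) ^+ N) -> lef ((1%:M + N%:R^-1 *: A) ^+ N) (mexp A) ->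
  lef ((1%:M + N%:R^-1 *: B) ^+ N) (mexp B) ->
  \tr (mexp (A + B)) <= \tr (mexp A *m mexp B) +
    (n%:R * a * b * expR (a + b + a * b) + \sum_i expR (c 0 i) * c 0 i ^+ 2) / N%:R.
Proof.
move=> sA sB sC N2 a0 b0 Aa Bb cN A0 AN BN.
have N0 : (0 < N)%N by rewrite N2 expn_gt0.
have N1 : 1 <= N%:R :> R by rewrite ler1n.
have N0' : 0 < N%:R :> R by lra.
have V1 : N%:R^-1 <= 1 :> R by rewrite invf_le1.
have V0 : 0 < N%:R^-1 :> R by rewrite invr_gt0.
set v : R := N%:R^-1 in V0 V1 *; have Nv : N%:R * v = 1 by rewrite mulfV// gt_eqF.
set X := 1%:M + v *: A in A0 AN *; set Y := 1%:M + v *: B in BN *.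
set Q := 1%:M + v *: (A + B).
have sX : X^T = X by rewrite /X linearD /= trmx1 linearZ /= sA.
have sY : Y^T = Y by rewrite /Y linearD /= trmx1 linearZ /= sB.
have XYQ : X * Y - Q = (v ^+ 2) *: (A * B).
  rewrite /X /Y /Q mulrDl !mulrDr -!mulmxE !(mul1mx, mulmx1) -scalemxAr -scalemxAl scalerA expr2 scalerDr.
  by move: (A *m B) => Z; apply/matrixP => i j; rewrite !mxE; ring.
pose r := a + b + a * b; have r0 : 0 <= r by rewrite !addr_ge0// mulr_ge0.
have Xr : rowsum_le (X * Y) (1 + v * r).
  apply: (rowsum_le_mon _ (rowsum_leM _ (rowsum_leD rowsum_le1 (rowsum_leZ (ltW V0) Aa)) (rowsum_leD rowsum_le1 (rowsum_leZ (ltW V0) Bb)))).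
    have : 0 <= v * (1 - v) * (a * b) by rewrite !mulr_ge0//; lra.
    rewrite /r; nra.
  by have := mulr_ge0 (ltW V0) b0; lra.
have Qr : rowsum_le Q (1 + v * r).
  apply: (rowsum_le_mon _ (rowsum_leD rowsum_le1 (rowsum_leZ (ltW V0) (rowsum_leD Aa Bb)))).
  by rewrite lerD2l ler_pM2l// /r lerDl mulr_ge0.
have PQr : rowsum_le (Q - X * Y) (v ^+ 2 * (a * b)).
  move=> i; under eq_bigr do rewrite -opprB mxE normrN.
  by rewrite XYQ; apply: rowsum_leZ; [exact: sqr_ge0|exact: rowsum_leM].
have vr0 : 0 <= v * r by rewrite mulr_ge0// ltW.
have [] := @rowsum_leX_sub Q (X * Y) (1 + v * r) (v ^+ 2 * (a * b)) N _ _ Qr Xr PQr.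
- lra.
- by rewrite mulr_ge0 ?sqr_ge0// mulr_ge0.
move=> _ /rowsum_le_tr; rewrite trB.
have := expr_le_expR N (x := v * r) ltac:(lra); rewrite mulrA Nv mul1r.
set p := (1 + v * r) ^+ N => pr H1.
have {}H1 : \tr (Q ^+ N) <= \tr ((X * Y) ^+ N) + n%:R * a * b * expR r * v.
  rewrite -lerBlDl; apply: (le_trans H1).
  have -> : n%:R * (N%:R * (v ^+ 2 * (a * b)) * p) = (n%:R * a * b * v) * p * (N%:R * v) by ring.
  rewrite Nv mulr1 mulrAC -mulrA -[leRHS]mulrA ler_wpM2l ?mulr_ge0//.
  by rewrite ler_wpM2r// ltW.
have H2 : \tr ((X * Y) ^+ N) <= \tr (mexp A *m mexp B).
  have := (lieb_thirring_pow2 (trunc_log 2 N)).1 X Y sX sY; rewrite -N2 => /le_trans; apply.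
  apply: (@le_trans _ _ (\tr (X ^+ N *m mexp B))).
    by rewrite -mulmxE; apply: lef_trM => //; rewrite sym_exprX.
  rewrite mxtrace_mulC [leRHS]mxtrace_mulC; apply: lef_trM => //; first exact: tr_mexp.
  exact: mexp_ge0.
have H3 : \tr (mexp (A + B)) - v * \sum_i expR (c 0 i) * c 0 i ^+ 2 <= \tr (Q ^+ N).
  rewrite (sdec_trace (sdec_fc expR sC)) (sdec_trace (sdecX N (sdecD (sdec_scalar 1 sC) (sdecZ v sC)))).
  rewrite mulr_sumr -sumrB; apply: ler_sum => i _; rewrite !mxE.
  have h : `|v * c 0 i| <= 1 by rewrite normrM gtr0_norm// ler_pdivrMl// mulr1.
  apply: le_trans (expR_le_expr N h).
  have -> : N%:R * (v * c 0 i) = c 0 i by rewrite mulrA Nv mul1r.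
  rewrite mulrBr mulr1 lerD2l lerN2.
  have -> : N%:R * (v * c 0 i) ^+ 2 = (N%:R * v) * (v * c 0 i ^+ 2) by ring.
  by rewrite Nv mul1r mulrCA.
rewrite -/r mulrDl [X in _ <= _ + (_ + X)]mulrC; lra.
Qed.

Theorem golden_thompson A B : A^T = A -> B^T = B ->
  \tr (mexp (A + B)) <= \tr (mexp A *m mexp B).
Proof.
move=> sA sB; have sAB : (A + B)^T = A + B by rewrite linearD /= sA sB.
have [U [d s]] := sym_sdec sA; have [V [e t]] := sym_sdec sB.
have [W [c sC]] := sym_sdec sAB.
have [a a0 Aa] := rowsum_le_exists A; have [b b0 Bb] := rowsum_le_exists B.
set E := n%:R * a * b * expR (a + b + a * b) + \sum_i expR (c 0 i) * c 0 i ^+ 2.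
have E0 : 0 <= E.
  rewrite addr_ge0 ?mulr_ge0 ?expR_ge0//.
  by apply: sumr_ge0 => i _; rewrite mulr_ge0 ?expR_ge0 ?sqr_ge0.
apply/ler_addgt0Pr => ep ep0.
(* [N] has to dominate the eigenvalues of A, B and A + B in absolute value, as the comparison with
   exp requires, and also E/ep, so that the error E/N is at most ep. *)
pose M := \sum_i `|d 0 i| + \sum_i `|e 0 i| + \sum_i `|c 0 i| + E / ep.
have M0 : 0 <= M by rewrite !addr_ge0 ?divr_ge0 ?(ltW ep0)//; apply: sumr_ge0.
pose k := Num.truncn M; pose N := (2 ^ k.+1)%N.
have MN : M <= N%:R.
  apply: ltW; apply: (lt_le_trans (truncnS_gt M)).
  by rewrite ler_nat; apply: ltnW; apply: ltn_expl.
have N0 : (0 < N)%N by rewrite expn_gt0.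
have N0' : 0 < N%:R :> R by rewrite ltr0n.
have Sd i : `|d 0 i| <= \sum_i `|d 0 i| by apply: (@ler_sum_finType _ (fun i => `|d 0 i|)).
have Se i : `|e 0 i| <= \sum_i `|e 0 i| by apply: (@ler_sum_finType _ (fun i => `|e 0 i|)).
have Sc i : `|c 0 i| <= \sum_i `|c 0 i| by apply: (@ler_sum_finType _ (fun i => `|c 0 i|)).
have P1 : 0 <= \sum_i `|d 0 i| by apply: sumr_ge0.
have P2 : 0 <= \sum_i `|e 0 i| by apply: sumr_ge0.
have P3 : 0 <= \sum_i `|c 0 i| by apply: sumr_ge0.
have P4 : 0 <= E / ep by rewrite divr_ge0// ltW.
have dN i : `|d 0 i| <= N%:R by apply: le_trans MN; rewrite /M; have := Sd i; lra.
have eN i : `|e 0 i| <= N%:R by apply: le_trans MN; rewrite /M; have := Se i; lra.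
have cN i : `|c 0 i| <= N%:R by apply: le_trans MN; rewrite /M; have := Sc i; lra.
have [A0 AN] := sdec_expr_le s N0 dN; have [B0 BN] := sdec_expr_le t N0 eN.
have N2 : N = (2 ^ trunc_log 2 N)%N by rewrite /N trunc_expnK.
apply: (le_trans (tr_mul_mexp_ge sA sB sC N2 a0 b0 Aa Bb cN A0 AN BN)).
rewrite lerD2l -/E ler_pdivrMr// -ler_pdivrMl// mulrC.
by apply: le_trans MN; rewrite /M; lra.
Qed.

(* The tangent inequality turns the averaged factor back into an exponent. *)
Lemma tr_mexp_mean (I : finType) (p : I -> R) A (X : I -> 'M[R]_n) G :
  A^T = A -> G^T = G -> (forall i, (X i)^T = X i) -> (forall i, 0 <= p i) ->
  lef (\sum_i p i *: mexp (X i)) (1%:M + G) ->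
  \sum_i p i * \tr (mexp (A + X i)) <= \tr (mexp (A + G)).
Proof.
move=> sA sG sX p0 H.
have sAG : (A + G)^T = A + G by rewrite linearD /= sA sG.
apply: le_trans (mexp_klein sA sAG).
have -> : 1%:M + (A + G) - A = 1%:M + G by rewrite addrCA addrAC subrr add0r.
apply: (@le_trans _ _ (\tr (mexp A *m \sum_i p i *: mexp (X i)))).
  rewrite mulmx_sumr linear_sum /=; apply: ler_sum => i _.
  by rewrite -scalemxAr linearZ /= ler_wpM2l// golden_thompson.
by apply: lef_trM => //; [exact: tr_mexp|exact: mexp_ge0].
Qed.

End Golden_Thompson.

(** * Rank, multiplicities and nuclear norm from a spectral decomposition *)

Section Rank_and_trace.
Context {R : realType} {n : nat}.
Implicit Types (A U : 'M[R]_n) (d : 'rV[R]_n).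

Lemma rank_diag_le d : (\rank (diag_mx d) <= #|[pred i | d 0%R i != 0%R]|)%N.
Proof.
have -> : diag_mx d = \sum_(i | d 0 i != 0) d 0 i *: delta_mx i i.
  apply/matrixP => i j; rewrite summxE !mxE.
  have [di|di] := eqVneq (d 0 i) 0.
    rewrite di mul0rn big1// => k dk; rewrite !mxE.
    by case: (eqVneq i k) => [ik|]; rewrite ?mulr0//; rewrite -ik di eqxx in dk.
  rewrite (bigD1 i)//= big1 ?addr0 => [|k /andP[_ ki]]; rewrite !mxE eq_sym ?eqxx /=.
    by rewrite mulr_natr.
  by rewrite (negPf ki) mulr0.
rewrite -sum1_card; elim/big_rec2: _ => [|i k M _ IH]; first by rewrite mxrank0.
apply: (leq_trans (mxrank_add _ _)); rewrite leq_add//.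
by apply: (leq_trans (mxrank_scale _ _)); rewrite mxrank_delta.
Qed.

(** For the lower bound, adding the indicator [e] of the zero entries makes the matrix invertible,
    while the rank of [diag_mx e] is at most the number of zeros. *)
Lemma rank_diag d : \rank (diag_mx d) = #|[pred i | d 0%R i != 0%R]|.
Proof.
apply/eqP; rewrite eqn_leq rank_diag_le /=.
pose e : 'rV[R]_n := \row_i (d 0 i == 0)%:R.
have U : diag_mx (d + e) \in unitmx.
  rewrite unitmxE det_diag unitfE; apply/prodf_neq0 => i _; rewrite !mxE.
  by have [->|d0] := eqVneq (d 0 i) 0; rewrite ?add0r ?oner_eq0 ?addr0.
have := mxrank_add (diag_mx d) (diag_mx e); rewrite -linearD /= (mxrank_unit U).
rewrite -{1}(card_ord n) -(cardC [pred i | d 0 i != 0]) addnC => /leq_trans H.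
rewrite -(leq_add2r (\rank (diag_mx e))) addnC; apply: leq_trans (H _ (leqnn _)).
rewrite leq_add2r; apply: (leq_trans (rank_diag_le e)); apply/subset_leq_card/fintype.subsetP => i.
by rewrite !inE !mxE; case: (d 0 i == 0); rewrite ?eqxx.
Qed.

Lemma sdec_unit A U d : sdec A U d -> U \in unitmx /\ U^T \in unitmx.
Proof. by move=> s; split; [case: (mulmx1_unit s.1)|case: (mulmx1_unit s.1)]. Qed.

Lemma sdec_rank A U d : sdec A U d -> \rank A = #|[pred i | d 0%R i != 0%R]|.
Proof.
move=> s; have [u1 u2] := sdec_unit s; rewrite -rank_diag s.2.
rewrite mxrankMfree ?row_free_unit//.
by rewrite -mxrank_tr trmx_mul trmxK mxrankMfree ?row_free_unit// tr_diag_mx.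
Qed.

Lemma sdec_eigenspace A U d t : sdec A U d -> \rank (eigenspace A t) = #|[pred i | d 0%R i == t]|.
Proof.
move=> s; rewrite /eigenspace mxrank_ker.
have -> : A - t%:M = A + (- t)%:M by rewrite raddfN.
rewrite (sdec_rank (sdecD s (sdec_scalar (- t) s))).
rewrite -{1}(card_ord n) -(cardC [pred i | d 0 i == t]).
rewrite -[X in (_ - X)%N](_ : #|[predC [pred i | d 0 i == t]]| = _) ?addnK//.
by apply: eq_card => i; rewrite !inE !mxE subr_eq0.
Qed.

End Rank_and_trace.

Section Nuclear_norm.
Context {R : realType}.

Lemma qf_mulT m n (B : 'M[R]_(m, n)) x : qf (B *m B^T) x = sqn (x *m B).
Proof. by rewrite /qf /sqn trmx_mul !mulmxA. Qed.

Lemma sdec_gram_ge0 m n (A : 'M[R]_(m, n)) U d i : sdec (A *m A^T) U d -> 0 <= d 0 i.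
Proof. by move=> s; rewrite -(sdec_row_qf i s) qf_mulT sqn_ge0. Qed.

Lemma tr_gram m n (A : 'M[R]_(m, n)) : (A *m A^T)^T = A *m A^T.
Proof. by rewrite trmx_mul trmxK. Qed.

Lemma gram_sdec m n (A : 'M[R]_(m, n)) : exists U d, sdec (A^T *m A) U d.
Proof. by apply: sym_sdec; rewrite trmx_mul trmxK. Qed.

(** The definition sums over distinct positive singular values, listed by [sg], with multiplicity.
    Zero eigenvalues can be included on the right because their root is 0. *)
Lemma nuclear_normE m1 m2 (A : 'M[R]_(m1, m2)) U d : sdec (A^T *m A) U d ->
  nuclear_norm A = \sum_i Num.sqrt (d 0 i).
Proof.
move=> s; have d0 i : 0 <= d 0 i by apply: (@sdec_gram_ge0 _ _ A^T U); rewrite trmxK.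
pose sg := undup [seq Num.sqrt (d 0 i) | i <- enum 'I_m2 & 0 < d 0 i].
have SV : singular_values A = [set` sg].
  apply/seteqP; split=> t /=; rewrite mem_undup.
    case=> t0 /eigenvalueP [v vt v0].
    have : (0 < \rank (eigenspace (A^T *m A) (t ^+ 2)))%N.
      rewrite lt0n mxrank_eq0; apply: contra v0 => /eqP E.
      by have /eigenspaceP := vt; rewrite E submx0.
    rewrite (sdec_eigenspace _ s) => /card_gt0P [i]; rewrite inE => /eqP dt.
    apply/mapP; exists i; last by rewrite dt sqrtr_sqr gtr0_norm.
    by rewrite mem_filter mem_enum dt exprn_gt0.
  case/mapP => i; rewrite mem_filter => /andP[di _] ->; split; first by rewrite sqrtr_gt0.
  rewrite sqr_sqrtr//; apply/eigenvalueP; exists (row i U).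
    rewrite -row_mul s.2 !mulmxA s.1 mul1mx row_mul row_diag_mx -scalemxAl.
    by rewrite -rowE.
  by rewrite -sqn_eq0 (sdec_row_sqn i s) oner_eq0.
rewrite /nuclear_norm SV -fsbig_seq ?undup_uniq//.
have sg0 t : t \in sg -> 0 < t.
  by rewrite mem_undup => /mapP [i]; rewrite mem_filter => /andP[di _] ->; rewrite sqrtr_gt0.
have E1 t : t \in sg -> t *+ singular_mult A t = \sum_i (if t == Num.sqrt (d 0 i) then t else 0).
  move=> /sg0 t0; rewrite /singular_mult (sdec_eigenspace _ s) -big_mkcond /= sumr_const; congr (_ *+ _).
  apply: eq_card => i; rewrite !inE; apply/eqP/eqP => [->|->]; first by rewrite sqrtr_sqr gtr0_norm.
  by rewrite sqr_sqrtr.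
rewrite (eq_big_seq _ E1) exchange_big /=; apply: eq_bigr => i _.
have [di|di] := leP (d 0 i) 0.
  rewrite (ler0_sqrtr di) big_seq big1// => t /sg0; by case: eqVneq => // ->; rewrite ltxx.
have mi : Num.sqrt (d 0 i) \in sg.
  by rewrite mem_undup; apply/mapP; exists i => //; rewrite mem_filter di mem_enum.
rewrite (bigD1_seq _ mi (undup_uniq _)) /= eqxx big1 ?addr0// => t /negPf.
by rewrite eq_sym => ->.
Qed.

Lemma nuclear_norm_ge0 m1 m2 (A : 'M[R]_(m1, m2)) : 0 <= nuclear_norm A.
Proof.
have [U [d s]] := gram_sdec A; rewrite (nuclear_normE s).
by apply: sumr_ge0 => i _; rewrite sqrtr_ge0.
Qed.

End Nuclear_norm.

(** * Trace inner product, duality of operator and nuclear norms, polar factor *)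

Section Inner_product.
Context {R : realType} {m1 m2 : nat}.
Implicit Types (A B C : 'M[R]_(m1, m2)).

Lemma mx_innerE A B : mx_inner A B = \sum_i \sum_j A i j * B i j.
Proof.
rewrite /mx_inner /mxtrace exchange_big; apply: eq_bigr => j _; rewrite mxE.
by apply: eq_bigr => i _; rewrite mxE.
Qed.

Lemma mx_innerC A B : mx_inner A B = mx_inner B A.
Proof. by rewrite !mx_innerE; apply: eq_bigr => i _; apply: eq_bigr => j _; rewrite mulrC. Qed.

Lemma mx_innerDl A B C : mx_inner (A + B) C = mx_inner A C + mx_inner B C.
Proof. by rewrite /mx_inner linearD /= mulmxDl linearD. Qed.

Lemma mx_innerZl a B C : mx_inner (a *: B) C = a * mx_inner B C.
Proof. by rewrite /mx_inner linearZ /= -scalemxAl linearZ. Qed.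

Lemma mx_innerNl B C : mx_inner (- B) C = - mx_inner B C.
Proof. by rewrite -scaleN1r mx_innerZl mulN1r. Qed.

Lemma mx_innerBl A B C : mx_inner (A - B) C = mx_inner A C - mx_inner B C.
Proof. by rewrite mx_innerDl mx_innerNl. Qed.

Lemma mx_innerDr A B C : mx_inner A (B + C) = mx_inner A B + mx_inner A C.
Proof. by rewrite mx_innerC mx_innerDl !(mx_innerC A). Qed.

Lemma mx_innerZr a B C : mx_inner B (a *: C) = a * mx_inner B C.
Proof. by rewrite mx_innerC mx_innerZl mx_innerC. Qed.

Lemma mx_innerNr B C : mx_inner B (- C) = - mx_inner B C.
Proof. by rewrite mx_innerC mx_innerNl mx_innerC. Qed.

Lemma mx_innerBr A B C : mx_inner A (B - C) = mx_inner A B - mx_inner A C.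
Proof. by rewrite mx_innerDr mx_innerNr. Qed.

Definition fro2 A : R := mx_inner A A.

Lemma fro2_ge0 A : 0 <= fro2 A.
Proof.
by rewrite /fro2 mx_innerE; apply: sumr_ge0 => i _; apply: sumr_ge0 => j _; rewrite -expr2 sqr_ge0.
Qed.

Lemma fro2E A : fro2 A = \sum_i \sum_j A i j ^+ 2.
Proof. by rewrite /fro2 mx_innerE; apply: eq_bigr => i _; apply: eq_bigr => j _; rewrite expr2. Qed.

Lemma fro2D A B : fro2 (A + B) = fro2 A + 2 * mx_inner A B + fro2 B.
Proof. by rewrite /fro2 !mx_innerDl !mx_innerDr (mx_innerC B A); ring. Qed.

Lemma fro2N A : fro2 (- A) = fro2 A.
Proof. by rewrite /fro2 mx_innerNl mx_innerNr opprK. Qed.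

Lemma fro2B A B : fro2 (A - B) = fro2 A - 2 * mx_inner A B + fro2 B.
Proof. by rewrite fro2D fro2N mx_innerNr; ring. Qed.

Lemma fro2Z a A : fro2 (a *: A) = a ^+ 2 * fro2 A.
Proof. by rewrite /fro2 mx_innerZl mx_innerZr; ring. Qed.

Lemma mx_inner_young A B : 2 * mx_inner A B <= fro2 A + fro2 B.
Proof. by have := fro2_ge0 (A - B); rewrite fro2B; lra. Qed.

Lemma frobenius_norm_sq A : frobenius_norm A ^+ 2 = fro2 A.
Proof. by rewrite /frobenius_norm sqr_sqrtr// fro2_ge0. Qed.

Lemma mx_inner_trl A B : mx_inner A B = \tr (B *m A^T).
Proof. by rewrite /mx_inner mxtrace_mulC. Qed.

Lemma mx_inner_Ml (P : 'M[R]_m1) A B : P^T = P -> mx_inner (P *m A) B = mx_inner A (P *m B).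
Proof. by move=> sP; rewrite /mx_inner trmx_mul sP mulmxA. Qed.

Lemma mx_inner_Mr (P : 'M[R]_m2) A B : P^T = P -> mx_inner (A *m P) B = mx_inner A (B *m P).
Proof. by move=> sP; rewrite !mx_inner_trl trmx_mul sP mulmxA. Qed.

End Inner_product.

(** The operator norm is at most |c|, expressed on row vectors and without a supremum. *)
Definition opb {R : realType} {m1 m2 : nat} (B : 'M[R]_(m1, m2)) (c : R) : Prop :=
  forall x, sqn (x *m B) <= c ^+ 2 * sqn x.

Section Duality.
Context {R : realType}.

Definition dotv n (x y : 'rV[R]_n) : R := (x *m y^T) 0 0.

Lemma dotvE n (x y : 'rV[R]_n) : dotv x y = \sum_i x 0 i * y 0 i.
Proof. by rewrite /dotv mxE; apply: eq_bigr => i _; rewrite mxE. Qed.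

Lemma dotv_sq_le n (x y : 'rV[R]_n) : dotv x y ^+ 2 <= sqn x * sqn y.
Proof.
have P (a : R) : 0 <= a ^+ 2 * sqn x - 2 * a * dotv x y + sqn y.
  have := sqn_ge0 (a *: x - y); suff -> : sqn (a *: x - y) = a ^+ 2 * sqn x - 2 * a * dotv x y + sqn y by [].
  rewrite !sqnE dotvE !mulr_sumr -sumrB -big_split /=; apply: eq_bigr => i _.
  by rewrite !mxE; ring.
have [x0|x0] := eqVneq (sqn x) 0.
  have [->|d0] := eqVneq (dotv x y) 0; first by rewrite expr0n /= mulr_ge0 ?sqn_ge0.
  have := P ((sqn y + 1) / (2 * dotv x y)); rewrite x0.
  have -> : 2 * ((sqn y + 1) / (2 * dotv x y)) * dotv x y = sqn y + 1 by field.
  lra.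
have x1 : 0 < sqn x by rewrite lt_neqAle eq_sym x0 sqn_ge0.
have := P (dotv x y / sqn x).
have -> : (dotv x y / sqn x) ^+ 2 * sqn x - 2 * (dotv x y / sqn x) * dotv x y + sqn y
   = (sqn x * sqn y - dotv x y ^+ 2) / sqn x by field.
by rewrite pmulr_lge0 ?invr_gt0// subr_ge0.
Qed.

Lemma dotv_le n (x y : 'rV[R]_n) a b : 0 <= a -> 0 <= b -> sqn x <= a ^+ 2 -> sqn y <= b ^+ 2 ->
  dotv x y <= a * b.
Proof.
move=> a0 b0 xa yb; apply: (le_trans (ler_norm _)).
rewrite -(@ler_pXn2r _ 2) ?nnegrE ?mulr_ge0// real_normK ?num_real//.
by apply: (le_trans (dotv_sq_le x y)); rewrite exprMn ler_pM ?sqn_ge0.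
Qed.

(** With z = y B^T one has |z|^2 = <zB, y>, so Cauchy-Schwarz and the bound on [B] give |z|^4 <= c^2
    |z|^2 |y|^2, and |z|^2 cancels. *)
Lemma opb_tr m1 m2 (B : 'M[R]_(m1, m2)) c : 0 <= c -> opb B c -> opb B^T c.
Proof.
move=> c0 Bc y; set z := y *m B^T.
have zE : sqn z = dotv (z *m B) y by rewrite /sqn /dotv -mulmxA {2}/z trmx_mul trmxK.
have [z0|z0] := eqVneq (sqn z) 0; first by rewrite z0 mulr_ge0 ?sqr_ge0 ?sqn_ge0.
have z1 : 0 < sqn z by rewrite lt_neqAle eq_sym z0 sqn_ge0.
have := dotv_sq_le (z *m B) y; rewrite -zE => H.
rewrite -(@ler_pM2l _ (sqn z))// -expr2; apply: (le_trans H).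
by rewrite mulrA [_ * c ^+ 2]mulrC ler_wpM2r ?sqn_ge0.
Qed.

(** In an orthonormal eigenbasis u_i of A^T A the trace is the sum of <u_i B^T, u_i A^T>, where |u_i
    A^T| is the i-th root in [nuclear_normE] and |u_i B^T| <= c. *)
Lemma nuclear_dual_le m1 m2 (A B : 'M[R]_(m1, m2)) (c : R) : 0 <= c -> opb B c ->
  mx_inner B A <= c * nuclear_norm A.
Proof.
move=> c0 Bc; have [U [d s]] := gram_sdec A; rewrite (nuclear_normE s) mulr_sumr.
have sU : U^T *m U = 1%:M := sdecK s.
have -> : mx_inner B A = \sum_i dotv (row i U *m B^T) (row i U *m A^T).
  rewrite /mx_inner -[B^T *m A]mul1mx -sU -mulmxA mxtrace_mulC /mxtrace.
  apply: eq_bigr => i _; rewrite /dotv trmx_mul trmxK tr_row !mulmxA -!row_mul.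
  rewrite [RHS]mxE [LHS]mxE [RHS]mxE; apply: eq_bigr => j _.
  by rewrite [col i _ _ _]mxE.
apply: ler_sum => i _; apply: dotv_le => //.
- by apply: (le_trans (opb_tr c0 Bc _)); rewrite (sdec_row_sqn i s) mulr1.
- have qE : sqn (row i U *m A^T) = d 0 i.
    by have := qf_mulT A^T (row i U); rewrite trmxK => <-; exact: sdec_row_qf.
  by rewrite sqr_sqrtr -qE ?sqn_ge0.
Qed.

Lemma opb_mono m1 m2 (B : 'M[R]_(m1, m2)) a b : 0 <= a -> a <= b -> opb B a -> opb B b.
Proof.
move=> a0 ab Ba x; apply: (le_trans (Ba x)); rewrite ler_wpM2r ?sqn_ge0//.
by rewrite lerXn2r// nnegrE//; apply: le_trans ab.
Qed.

(* [P1], [P2] are the orthogonal projectors on the column and row spaces of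
   [A], and [S] is its partial isometry factor. *)
Definition polar_triple m1 m2 (A S : 'M[R]_(m1, m2)) (P1 : 'M[R]_m1) (P2 : 'M[R]_m2) : Prop :=
  [/\ [/\ P1^T = P1, P1 *m P1 = P1, P1 *m A = A & \tr P1 = (\rank A)%:R],
     [/\ P2^T = P2, P2 *m P2 = P2, A *m P2 = A & \tr P2 = (\rank A)%:R],
     [/\ P1 *m S = S, S *m P2 = S & opb S 1] &
     [/\ mx_inner S A = nuclear_norm A & fro2 S = (\rank A)%:R]].


(** Used with c = 0 for the projector on a column space, and with c a penalty level to truncate a
    spectrum. *)
Lemma sdec_projector n (A : 'M[R]_n) U d (c : R) : sdec A U d ->
  let P := fc (fun t => (c < t)%R%:R) A in
  [/\ P^T = P, P *m P = P, lef 0 P, lef P 1%:M & \tr P = (\rank P)%:R].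
Proof.
move=> s P; have t := sdec_fc (fun t => (c < t)%R%:R) s; rewrite -/P in t.
split.
- exact: sdec_tr t.
- have PP := sdecM t t; rewrite PP.2 [in RHS]t.2; congr (_ *m diag_mx _ *m _).
  by apply/rowP => i; rewrite !mxE; case: (c < _); rewrite ?mulr1 ?mulr0.
- by move=> x; rewrite qf0 (sdec_qf x t); apply: sumr_ge0 => i _; rewrite mulr_ge0 ?sqr_ge0// mxE ler0n.
- apply: (lef_sdec t (sdec_scalar 1 t)) => i; rewrite !mxE.
  by case: (c < _); rewrite ?ler01.
rewrite (sdec_trace t) (sdec_rank t) -sum1_card natr_sum [RHS]big_mkcond /=.
by apply: eq_bigr => i _; rewrite inE mxE; case: (c < _); rewrite ?oner_eq0 ?eqxx.
Qed.

Lemma row_projector m1 m2 (A : 'M[R]_(m1, m2)) (P := fc (fun t => (0 < t)%R%:R) (A *m A^T)) :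
  [/\ P^T = P, P *m P = P, P *m A = A & \tr P = (\rank A)%:R] /\ (lef 0 P /\ lef P 1%:M).
Proof.
have [U [d s]] := sym_sdec (tr_gram A).
have [Ps PP P0 P1 trP] := sdec_projector 0 s.
rewrite -/P in Ps PP P0 P1 trP.
have d0 i : 0 <= d 0 i := sdec_gram_ge0 i s.
have PA : P *m A = A.
  apply/eqP; rewrite -subr_eq0; apply/eqP.
  (* (P - 1) A A^T (P - 1) has the eigenvalues t (1_{t > 0} - 1)^2, which vanish for t >= 0. *)
  have E : (P *m A - A) *m (P *m A - A)^T = 0.
    have -> : P *m A - A = (P - 1%:M) *m A by rewrite mulmxBl mul1mx.
    rewrite trmx_mul.
    have t := sdecD (sdec_fc (fun t => (0 < t)%R%:R) s) (sdecZ (-1) (sdec_scalar 1 s)).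
    rewrite -/P scaleN1r in t.
    rewrite (sdec_tr t) mulmxA -(mulmxA _ A) (sdecM (sdecM t s) t).2.
    rewrite (_ : \row__ _ = 0) ?linear0 ?mulmx0 ?mul0mx//.
    apply/rowP => i; rewrite !mxE; have := d0 i; rewrite le_eqVlt => /orP[/eqP <-|->].
      by rewrite mulr0 mul0r.
    by rewrite mulr1 subrr mul0r mul0r.
  apply/row_matrixP => i; rewrite row0 rowE; apply/eqP.
  by rewrite -sqn_eq0 -qf_mulT E qf0.
split=> //; split=> //; rewrite trP; congr (_%:R); apply/eqP; rewrite eqn_leq.
apply/andP; split; last by rewrite -{1}PA mxrankM_maxl.
(* As [0^-1 = 0], the calculus of [t^-1] is the pseudo-inverse; it exhibits [P] as a right multiple
   of [A], so that its rank is at most that of [A]. *)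
have -> : P = A *m (A^T *m fc (fun t => t^-1) (A *m A^T)).
  rewrite mulmxA (sdecM s (sdec_fc (fun t => t^-1) s)).2 /P (fcE (fun t => (0 < t)%R%:R) s).
  congr (_ *m diag_mx _ *m _); apply/rowP => i; rewrite !mxE.
  have := d0 i; rewrite le_eqVlt => /orP[/eqP <-|di]; first by rewrite ltxx mul0r.
  by rewrite di mulfV// gt_eqF.
exact: mxrankM_maxl.
Qed.

(** S = A (A^T A)^(-1/2), where [0^-1 = 0] makes the inverse root [h] vanish on the kernel; then S^T
    S is the projector [P2]. *)
Lemma polar_exists m1 m2 (A : 'M[R]_(m1, m2)) : exists S P1 P2, polar_triple A S P1 P2.
Proof.
have [[s1 p1 PA tr1] _] := row_projector A; set P1 := fc _ _ in s1 p1 PA tr1.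
have [[s2 p2 PA2 tr2] [_ P2le]] := row_projector A^T; set P2 := fc _ _ in s2 p2 PA2 tr2 P2le.
have AP : A *m P2 = A by rewrite -[LHS]trmxK trmx_mul s2 PA2 trmxK.
have [U [d s]] := gram_sdec A.
have d0 i : 0 <= d 0 i by apply: (@sdec_gram_ge0 _ _ _ A^T U); rewrite trmxK.
pose h (t : R) := (Num.sqrt t)^-1.
pose H := fc h (A^T *m A); have sH := sdec_fc h s; rewrite -/H in sH.
have tH := sdec_tr sH.
have sq0 i : 0 <= Num.sqrt (d 0 i) by exact: sqrtr_ge0.
have dq i : d 0 i = Num.sqrt (d 0 i) ^+ 2 by rewrite sqr_sqrtr.
have HP : P2 *m H = H.
  have -> : H = A^T *m (A *m fc (fun t => h t ^+ 3) (A^T *m A)).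
    rewrite mulmxA (sdecM s (sdec_fc _ s)).2 [LHS]sH.2; congr (_ *m diag_mx _ *m _).
    apply/rowP => i; rewrite !mxE {2}dq /h; set q := Num.sqrt _.
    have [->|qn] := eqVneq q 0; first by rewrite invr0 expr0n mul0r.
    by field.
  by rewrite mulmxA PA2.
have SS : (A *m H)^T *m (A *m H) = P2.
  rewrite trmx_mul tH !mulmxA -(mulmxA H) (sdecM (sdecM sH s) sH).2 /P2 trmxK (fcE _ s).
  congr (_ *m diag_mx _ *m _); apply/rowP => i; rewrite !mxE -sqrtr_gt0 {2}dq /h.
  have := sq0 i; set q := Num.sqrt _ => q0.
  have [->|qn] := eqVneq q 0; first by rewrite ltxx invr0 mul0r mul0r.
  by rewrite lt_neqAle eq_sym qn q0 /=; field.
have rk : \tr P2 = (\rank A)%:R by rewrite tr2 mxrank_tr.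
exists (A *m H), P1, P2; split; split=> //.
- by rewrite mulmxA PA.
- by rewrite -mulmxA; congr (_ *m _); rewrite -[LHS]trmxK trmx_mul s2 tH HP.
- rewrite -[A *m H]trmxK; apply: opb_tr => // x.
  by rewrite -qf_mulT trmxK SS; apply: (le_trans (P2le x)); rewrite qf_scalar expr1n.
- rewrite /mx_inner trmx_mul tH -mulmxA (sdec_trace (sdecM sH s)) (nuclear_normE s).
  apply: eq_bigr => i _; rewrite !mxE {2}dq /h; set q := Num.sqrt _.
  have [->|qn] := eqVneq q 0; first by rewrite invr0 mul0r.
  by field.
- by rewrite /fro2 /mx_inner SS.
Qed.

(** The polar factor [S] of A + B attains its nuclear norm, and by duality pairs with [A] and [B] to
    at most theirs. *)
Lemma nuclear_normD m1 m2 (A B : 'M[R]_(m1, m2)) : nuclear_norm (A + B) <= nuclear_norm A + nuclear_norm B.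
Proof.
have [S [P1 [P2 [_ _ [_ _ S1] [<- _]]]]] := polar_exists (A + B).
rewrite mx_innerDr; have := nuclear_dual_le A ler01 S1; have := nuclear_dual_le B ler01 S1.
lra.
Qed.

Lemma nuclear_normZ m1 m2 a (A : 'M[R]_(m1, m2)) : 0 <= a -> nuclear_norm (a *: A) <= a * nuclear_norm A.
Proof.
move=> a0; have [S [P1 [P2 [_ _ [_ _ S1] [<- _]]]]] := polar_exists (a *: A).
by rewrite mx_innerZr ler_wpM2l//; have := nuclear_dual_le A ler01 S1; rewrite mul1r.
Qed.

End Duality.

(** * The proximal map of the nuclear norm and its oracle inequalities *)

Section Soft_thresholding.
Context {R : realType} {m1 m2 : nat}.
Implicit Types (A B Z : 'M[R]_(m1, m2)).

(** |A - Z|^2 + 2 tau |A|_1 without the constant |Z|^2. *)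
Definition prox_crit (tau : R) Z A : R := fro2 A - 2 * mx_inner Z A + 2 * tau * nuclear_norm A.

(** First-order optimality without subgradients: compare with the point Ah - s (Ah - A), use
    convexity of the nuclear norm, divide by s and let s tend to 0. *)
Lemma prox_variational (tau : R) Z Ah : 0 <= tau ->
  (forall B, prox_crit tau Z Ah <= prox_crit tau Z B) ->
  forall A, mx_inner (Ah - Z) (Ah - A) <= tau * (nuclear_norm A - nuclear_norm Ah).
Proof.
move=> tau0 opt A; set D := Ah - A.
have key s : 0 < s -> s <= 1 ->
    2 * mx_inner (Ah - Z) D - s * fro2 D <= 2 * tau * (nuclear_norm A - nuclear_norm Ah).
  move=> s0 s1; have := opt (Ah - s *: D); rewrite /prox_crit => H.
  have E : Ah - s *: D = (1 - s) *: Ah + s *: A.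
    by rewrite /D scalerBr scalerBl scale1r opprB addrA addrAC.
  have N1 : nuclear_norm (Ah - s *: D) <= (1 - s) * nuclear_norm Ah + s * nuclear_norm A.
    rewrite E; apply: (le_trans (nuclear_normD _ _)).
    by rewrite lerD ?nuclear_normZ ?subr_ge0// ltW.
  have N2 : 2 * tau * nuclear_norm (Ah - s *: D) <= 2 * tau * ((1 - s) * nuclear_norm Ah + s * nuclear_norm A).
    by rewrite ler_wpM2l// mulr_ge0.
  have H1 : fro2 (Ah - s *: D) = fro2 Ah - 2 * s * mx_inner Ah D + s ^+ 2 * fro2 D.
    by rewrite fro2B mx_innerZr fro2Z; ring.
  have H2 : mx_inner Z (Ah - s *: D) = mx_inner Z Ah - s * mx_inner Z D by rewrite mx_innerBr mx_innerZr.
  rewrite H1 H2 in H; rewrite mx_innerBl -(ler_pM2l s0).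
  move: H N2; set a := nuclear_norm (_ - _); nra.
apply/ler_addgt0Pr => e e0.
have [D0|D0] := eqVneq (fro2 D) 0.
  by have := key 1 ltr01 (lexx _); rewrite D0; nra.
have D1 : 0 < fro2 D by rewrite lt_neqAle eq_sym D0 fro2_ge0.
pose s := Num.min 1 (e / fro2 D).
have s0 : 0 < s by rewrite lt_min ltr01 divr_gt0.
have s1 : s <= 1 by rewrite ge_min lexx.
have := key s s0 s1; have : s * fro2 D <= e by rewrite -ler_pdivlMr// ge_min lexx orbT.
nra.
Qed.

(** Adding the two variational inequalities cancels the nuclear norms and leaves |A1 - A2|^2 <= <Z1
    - Z2, A1 - A2>. *)
Lemma prox_lipschitz (tau : R) Z1 Z2 A1 A2 : 0 <= tau ->
  (forall B, prox_crit tau Z1 A1 <= prox_crit tau Z1 B) ->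
  (forall B, prox_crit tau Z2 A2 <= prox_crit tau Z2 B) ->
  fro2 (A1 - A2) <= fro2 (Z1 - Z2).
Proof.
move=> tau0 /(prox_variational tau0)/(_ A2) V1 /(prox_variational tau0)/(_ A1) V2.
have := mx_inner_young (Z1 - Z2) (A1 - A2).
have E : mx_inner (A1 - Z1) (A1 - A2) + mx_inner (A2 - Z2) (A2 - A1) =
    fro2 (A1 - A2) - mx_inner (Z1 - Z2) (A1 - A2).
  by rewrite /fro2 !(mx_innerBl, mx_innerBr) (mx_innerC A2 A1); ring.
lra.
Qed.

(** This is the part of the noise that touches the column or the row space. Its two pieces are
    orthogonal, and projecting by P leaves a square norm of at most tau^2 tr P. Both traces will
    equal the rank r, hence the bound 2 tau^2 r and the sqrt 2 of the oracle constant. *)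
Lemma opb_projectors (N : 'M[R]_(m1, m2)) tau (P1 : 'M[R]_m1) (P2 : 'M[R]_m2) :
  0 <= tau -> opb N tau -> P1^T = P1 -> P1 *m P1 = P1 -> P2^T = P2 -> P2 *m P2 = P2 ->
  fro2 (P1 *m N + (1%:M - P1) *m N *m P2) <= tau ^+ 2 * (\tr P1 + \tr P2).
Proof.
move=> tau0 Nt s1 p1 s2 p2.
have s1' : (1%:M - P1)^T = 1%:M - P1 by rewrite linearB /= trmx1 s1.
have q1 : P1 *m (1%:M - P1) = 0 by rewrite mulmxBr mulmx1 p1 subrr.
have fr1 k1 k2 (M : 'M[R]_(k1, k2)) (P : 'M[R]_k1) : opb M tau -> P^T = P -> P *m P = P ->
    fro2 (P *m M) <= tau ^+ 2 * \tr P.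
  move=> Mt sP pP; rewrite /fro2 mx_inner_trl trmx_mul sP mulmxA mxtrace_mulC !mulmxA pP.
  rewrite -mulmxA -mxtraceZ -[tau ^+ 2 *: P]mul_mx_scalar.
  have P0 : lef 0 P.
    by move=> x; rewrite qf0 -pP -{2}sP qf_mulT sqn_ge0.
  by apply: lef_trM => // x; rewrite qf_mulT qf_scalar; exact: Mt.
have orth : mx_inner (P1 *m N) ((1%:M - P1) *m N *m P2) = 0.
  by rewrite mx_inner_Ml// -!mulmxA mulmxA q1 mul0mx /mx_inner mulmx0 linear0.
rewrite fro2D orth mulr0 addr0 mulrDr lerD ?fr1//.
have -> : fro2 ((1%:M - P1) *m N *m P2) = fro2 (P2 *m N^T) - fro2 (P1 *m N *m P2).
  have -> : (1%:M - P1) *m N *m P2 = N *m P2 - P1 *m (N *m P2) by rewrite !mulmxBl mul1mx mulmxA.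
  rewrite fro2B -mx_inner_Ml// -!mulmxA.
  have -> : mx_inner (P1 *m (N *m P2)) (N *m P2) = fro2 (P1 *m (N *m P2)).
    by rewrite /fro2 -{1}p1 -mulmxA mx_inner_Ml.
  have -> : fro2 (P2 *m N^T) = fro2 (N *m P2).
    by rewrite -{1}s2 -trmx_mul /fro2 /mx_inner trmxK mxtrace_mulC.
  ring.
have := fro2_ge0 (P1 *m N *m P2); have := fr1 _ _ N^T P2 (opb_tr tau0 Nt) s2 p2; lra.
Qed.

(** First bound: compare the criterion at [Ah] and [A]; the penalty of [Ah] cancels the noise paired
    with it, and the noise paired with [A] doubles the penalty of [A]. Second bound: the noise
    orthogonal to both spaces of [A] is absorbed by the nuclear norm of [A'], and what remains, N1 -
    tau S, has length at most tau (sqrt 2 + 1) sqrt r. *)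
Lemma prox_oracle (tau : R) A0 Z Ah A : 0 <= tau -> opb (Z - A0) tau ->
  (forall B, prox_crit tau Z Ah <= prox_crit tau Z B) ->
  fro2 (Ah - A0) <= fro2 (A - A0) + 4 * tau * nuclear_norm A /\
  fro2 (Ah - A0) <= fro2 (A - A0) + (1 + Num.sqrt 2) ^+ 2 * tau ^+ 2 * (\rank A)%:R.
Proof.
move=> tau0 Nt opt; set N := Z - A0 in Nt *.
have ZE : Z = A0 + N by rewrite /N addrC subrK.
clearbody N.
have nN : opb (- N) tau by move=> x; rewrite mulmxN -scaleN1r sqnZ sqrrN expr1n mul1r; exact: Nt.
split.
  have := opt A; rewrite /prox_crit ZE => H.
  have h1 := nuclear_dual_le Ah tau0 Nt; have h2 := nuclear_dual_le A tau0 nN.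
  rewrite mx_innerNl in h2; rewrite !mx_innerDl in H.
  by rewrite !fro2B (mx_innerC Ah) (mx_innerC A); lra.
have V := prox_variational tau0 opt A.
have [S [P1 [P2 [[s1 p1 PA tr1] [s2 p2 AP tr2] [PS SP S1] [SA S2]]]]] := polar_exists A.
pose D := Ah - A; pose Q1 := 1%:M - P1; pose Q2 := 1%:M - P2.
have sQ1 : Q1^T = Q1 by rewrite /Q1 linearB /= trmx1 s1.
have sQ2 : Q2^T = Q2 by rewrite /Q2 linearB /= trmx1 s2.
have PQ1 : P1 *m Q1 = 0 by rewrite /Q1 mulmxBr mulmx1 p1 subrr.
have PQ2 : P2 *m Q2 = 0 by rewrite /Q2 mulmxBr mulmx1 p2 subrr.
have QP2 : Q2 *m P2 = 0 by rewrite /Q2 mulmxBl mul1mx p2 subrr.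
have QA : Q1 *m A = 0 by rewrite /Q1 mulmxBl mul1mx PA subrr.
pose A' := Q1 *m Ah *m Q2.
have [S' [_ [_ [_ _ [_ _ S'1] [SA' _]]]]] := polar_exists A'.
(* [S + W] is a dual certificate: [W] acts between the orthogonal complements of the two spaces of
   [A], so the operator norm stays at most 1, while pairing with [Ah] also collects the nuclear norm
   of [A']. *)
pose W := Q1 *m S' *m Q2.
have WA0 : mx_inner W A = 0.
  by rewrite /W mx_inner_Mr// mx_inner_Ml// mulmxA QA mul0mx /mx_inner mulmx0 linear0.
have WAh : mx_inner W Ah = nuclear_norm A'.
  by rewrite /W mx_inner_Mr// mx_inner_Ml// mulmxA -/A' -SA'.
have SWop : opb (S + W) 1.
  move=> x; rewrite expr1n mul1r.
  have pyth k (M : 'M[R]_k) (y : 'rV[R]_k) : M^T = M -> M *m M = M ->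
      sqn (y *m M) + sqn (y *m (1%:M - M)) = sqn y.
    move=> sM pM; rewrite -!qf_mulT sM pM.
    have -> : (1%:M - M)^T = 1%:M - M by rewrite linearB /= trmx1 sM.
    have -> : (1%:M - M) *m (1%:M - M) = 1%:M - M.
      by rewrite mulmxBl mul1mx mulmxBr mulmx1 pM subrr subr0.
    by rewrite -qfD addrC subrK qf_scalar mul1r.
  have z0 : sqn (x *m S + x *m W) = sqn (x *m S) + sqn (x *m W).
    have o : x *m S *m (x *m W)^T = 0.
      by rewrite -SP /W !trmx_mul sQ2 -!mulmxA (mulmxA P2) PQ2 mul0mx !mulmx0.
    have o' : x *m W *m (x *m S)^T = 0 by rewrite -[LHS]trmxK trmx_mul trmxK o trmx0.
    by rewrite /sqn linearD /= mulmxDl !mulmxDr o o' addr0 add0r mxE.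
  rewrite mulmxDr z0 -(pyth _ P1 x s1 p1); apply: lerD.
    by rewrite -PS mulmxA; apply: (le_trans (S1 _)); rewrite expr1n mul1r.
  have := pyth _ P2 (x *m Q1 *m S') s2 p2; have := sqn_ge0 (x *m Q1 *m S' *m P2).
  have := S'1 (x *m Q1); rewrite expr1n mul1r /W /Q1 /Q2 !mulmxA; lra.
have nAh : nuclear_norm A + mx_inner S D + nuclear_norm A' <= nuclear_norm Ah.
  have := nuclear_dual_le Ah ler01 SWop; rewrite mul1r mx_innerDl WAh /D mx_innerBr SA; lra.
pose N1 := P1 *m N + Q1 *m N *m P2.
have NE : N = N1 + Q1 *m N *m Q2.
  have q2 : P2 + Q2 = 1%:M by rewrite /Q2 addrC subrK.
  have q1 : P1 + Q1 = 1%:M by rewrite /Q1 addrC subrK.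
  by rewrite /N1 -addrA -mulmxDr q2 mulmx1 -mulmxDl q1 mul1mx.
have NA' : mx_inner (Q1 *m N *m Q2) D <= tau * nuclear_norm A'.
  rewrite mx_inner_Mr// mx_inner_Ml// mulmxA /D (mulmxBr Q1) QA subr0 -/A'.
  exact: nuclear_dual_le.
have N1b : fro2 N1 <= tau ^+ 2 * (2 * (\rank A)%:R).
  by have := opb_projectors tau0 Nt s1 p1 s2 p2; rewrite tr1 tr2 mulr2n mulrDl mul1r.
set r := (\rank A)%:R in S2 N1b *; have r0 : 0 <= r by rewrite ler0n.
set q := Num.sqrt 2.
have q2 : q ^+ 2 = 2 by rewrite sqr_sqrtr.
have q0 : 0 < q by rewrite sqrtr_gt0.
have NS : fro2 (N1 - tau *: S) <= (1 + q) ^+ 2 * tau ^+ 2 * r.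
  (* Young's inequality with weight q = sqrt 2, the ratio of the bounds on |N1| and tau |S|. *)
  have Y : - 2 * (tau * mx_inner N1 S) <= q^-1 * fro2 N1 + q * (tau ^+ 2 * fro2 S).
    have := fro2_ge0 (N1 + (q * tau) *: S); rewrite fro2D mx_innerZr fro2Z => H.
    rewrite -subr_ge0 -(pmulr_rge0 _ q0); apply: (le_trans H); rewrite le_eqVlt; apply/orP; left; apply/eqP.
    by field; rewrite gt_eqF.
  rewrite fro2B mx_innerZr fro2Z; rewrite S2 in Y *.
  have qi : q^-1 = q / 2 by rewrite -q2 expr2 invfM mulrA divff ?mul1r// gt_eqF.
  rewrite qi in Y.
  have : (1 + q / 2) * fro2 N1 <= (1 + q / 2) * (tau ^+ 2 * (2 * r)) by rewrite ler_wpM2l// addr_ge0// divr_ge0// ltW.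
  have -> : (1 + q) ^+ 2 * tau ^+ 2 * r = (1 + q / 2) * (tau ^+ 2 * (2 * r)) + (1 + q) * (tau ^+ 2 * r) + (q ^+ 2 - 2) * (tau ^+ 2 * r) by field.
  rewrite q2 subrr mul0r addr0; lra.
have Yg := mx_inner_young (N1 - tau *: S) D.
have E1 : fro2 (Ah - A0) = fro2 (A - A0) + 2 * mx_inner (Ah - A0) D - fro2 D.
  by rewrite /fro2 /D !(mx_innerBl, mx_innerBr) (mx_innerC A Ah) (mx_innerC A0) (mx_innerC A0 A); ring.
have E2 : mx_inner (Ah - A0) D = mx_inner (Ah - Z) D + mx_inner N1 D + mx_inner (Q1 *m N *m Q2) D.
  by rewrite -addrA -mx_innerDl -NE -mx_innerDl ZE opprD addrA subrK.
have E3 : mx_inner (N1 - tau *: S) D = mx_inner N1 D - tau * mx_inner S D by rewrite mx_innerBl mx_innerZl.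
have nAh' : tau * (nuclear_norm A + mx_inner S D + nuclear_norm A') <= tau * nuclear_norm Ah by rewrite ler_wpM2l.
rewrite -/D in V; rewrite E1 E2; rewrite E3 in Yg; lra.
Qed.

(* The minimizer keeps the singular components of [A0] above the threshold. *)
Lemma rank_penalty_minimizer A0 (c : R) : 0 <= c ->
  exists Am, forall A, fro2 (Am - A0) + c * (\rank Am)%:R <= fro2 (A - A0) + c * (\rank A)%:R.
Proof.
move=> c0; have [U [d s]] := sym_sdec (tr_gram A0).
have [sP pP P0 P1 trP] := sdec_projector c s; set P := fc _ _ in sP pP P0 P1 trP.
have proj_dist (Q : 'M[R]_m1) : Q^T = Q -> Q *m Q = Q -> fro2 (A0 - Q *m A0) = \tr (A0 *m A0^T) - \tr (A0 *m A0^T *m Q).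
  move=> sQ pQ; rewrite fro2B -mx_inner_Ml//.
  have -> : fro2 (Q *m A0) = mx_inner (Q *m A0) A0 by rewrite /fro2 mx_inner_Ml// mulmxA pQ -mx_inner_Ml.
  rewrite (mx_inner_trl (Q *m A0)) trmx_mul sQ mulmxA /fro2 mx_inner_trl; ring.
exists (P *m A0) => A.
have [[sQ pQ QA trQ] [Q0 Q1]] := row_projector A; set Q := fc _ _ in sQ pQ QA trQ Q0 Q1.
have lo : fro2 (A0 - Q *m A0) <= fro2 (A - A0).
  have E : A - A0 = Q *m (A - A0) + (Q *m A0 - A0) by rewrite mulmxBr QA addrA subrK.
  rewrite [in leRHS]E [leRHS]fro2D.
  have -> : mx_inner (Q *m (A - A0)) (Q *m A0 - A0) = 0.
    by rewrite mx_inner_Ml// mulmxBr mulmxA pQ subrr /mx_inner mulmx0 linear0.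
  by rewrite mulr0 addr0 -[leLHS]fro2N opprB lerDr fro2_ge0.
have up : (\rank (P *m A0))%:R <= \tr P by rewrite trP ler_nat mxrankM_maxl.
rewrite -[fro2 (P *m A0 - A0)]fro2N opprB (proj_dist P)//; rewrite (proj_dist Q)// in lo.
have up' : c * (\rank (P *m A0))%:R <= c * \tr P by rewrite ler_wpM2l.
rewrite -trQ; suff : c * \tr P - \tr (A0 *m A0^T *m P) <= c * \tr Q - \tr (A0 *m A0^T *m Q) by lra.
have trE (X : 'M[R]_m1) : \tr X = \sum_i qf X (row i U).
  have := sdec_trM X (sdec_scalar 1 s); rewrite mul1mx => ->.
  by apply: eq_bigr => i _; rewrite mxE mul1r.
(* In the eigenbasis u_i of A0 A0^T, with eigenvalues d_i, the comparison is termwise: (c - d_i) q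
   with q in [0, 1] is least at q = 1 if d_i > c and at q = 0 otherwise, which are the values taken
   by [P]. *)
rewrite !(sdec_trM _ s) !trE !mulr_sumr -!sumrB; apply: ler_sum => i _.
rewrite (sdec_row_qf i (sdec_fc _ s)) mxE -!mulrBl.
have := Q0 (row i U); have := Q1 (row i U); rewrite qf0 qf_scalar (sdec_row_sqn i s) mulr1.
case: ltP => dc q1 q0; rewrite ?mulr1 ?mulr0; nra.
Qed.

End Soft_thresholding.

(** * Polynomial bounds on the exponential; hyperbolic functions *)

Section Exponential_bounds.
Context {R : realType}.
Implicit Types (p : {poly R}) (a b x t g : R).

(** The derivative of p(x) e^(-x) is (p' - p) e^(-x), so the Taylor bounds below reduce to comparing
    a polynomial with its derivative. *)
Lemma poly_expRN_le p a b : a <= b -> (forall x, a <= x <= b -> p.[x] <= p^`().[x]) ->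
  p.[a] * expR (- a) <= p.[b] * expR (- b).
Proof.
move=> ab H; pose f x := p.[x] * expR (- x).
pose df x := (p^`().[x] - p.[x]) * expR (- x).
have df_ x : is_derive x 1 f (df x).
  have dp : is_derive x 1 (horner p) (p^`().[x]).
    by apply: DeriveDef; [exact: derivable_horner|rewrite derivE derive1E].
  have -> : f = (horner p) * (expR \o -%R) by apply/funext => y.
  apply: is_derive_eq.
  by rewrite /df /= /GRing.scale /=; ring.
have [|c /andP[ac cb] E] := @MVT_segment R f df a b ab (fun x _ => df_ x).
  by apply: derivable_within_continuous => x _; apply: ex_derive.
rewrite -subr_ge0 -/(f a) -/(f b) E mulr_ge0 ?subr_ge0// mulr_ge0 ?expR_ge0// subr_ge0 H//.
by move: ac cb; rewrite !bnd_simp => -> ->.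
Qed.

Lemma expR_le_poly p x : 0 <= x -> 1 <= p.[0] -> (forall t, 0 <= t <= x -> p.[t] <= p^`().[t]) ->
  expR x <= p.[x].
Proof.
move=> x0 p0 /(poly_expRN_le x0); rewrite oppr0 expR0 mulr1 => /(le_trans p0).
by rewrite expRN ler_pdivlMr ?expR_gt0// mul1r.
Qed.

Lemma poly_le_expR p x : 0 <= x -> p.[0] <= 1 -> (forall t, 0 <= t <= x -> p^`().[t] <= p.[t]) ->
  p.[x] <= expR x.
Proof.
move=> x0 p0 H; have := @poly_expRN_le (- p) 0 x x0.
rewrite !hornerN derivN oppr0 expR0 mulr1 mulNr lerN2 => /(_ _)/le_trans/(_ p0) K.
rewrite -[leRHS]mul1r -ler_pdivrMr ?expR_gt0// -expRN; apply: K => t /H.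
by rewrite !hornerN lerN2.
Qed.

(** With p = 1 + t + g t^2, the sign of p' - p = t (2g - 1 - g t) shows that p(t) e^(-t) decreases
    up to 0, increases up to (2g - 1)/g, then decreases. On t <= x0 its minimum is the value 1 at 0
    or the value at x0, so one numerical check suffices. *)
Lemma expR_quad_le g (x0 : R) : 1 / 2 <= g -> 0 <= x0 -> expR x0 <= 1 + x0 + g * x0 ^+ 2 ->
  forall t, t <= x0 -> expR t <= 1 + t + g * t ^+ 2.
Proof.
move=> g2 x00 H t tx; pose p : {poly R} := 1 + 'X + g *: 'X^2.
have pE y : p.[y] = 1 + y + g * y ^+ 2 by rewrite /p !hornerE.
have dpE y : p^`().[y] = 1 + 2 * g * y.
  by rewrite /p !poly.derivE !hornerE /=; ring.
suff F : 1 <= p.[t] * expR (- t).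
  by rewrite -pE -[leLHS]mul1r -ler_pdivlMr ?expR_gt0// -expRN.
have neg a b : a <= b -> (forall x, a <= x <= b -> p^`().[x] <= p.[x]) -> p.[b] * expR (- b) <= p.[a] * expR (- a).
  move=> ab K; have := @poly_expRN_le (- p) a b ab.
  by rewrite !hornerN derivN !mulNr lerN2; apply => x /K; rewrite !hornerN lerN2.
have p0 : p.[0] * expR (- 0) = 1 by rewrite pE oppr0 expR0; ring.
have [t0|t0] := leP t 0.
  rewrite -p0; apply: neg => // y /andP[_ y0]; rewrite dpE pE.
  have h1 : 0 <= - y by lra.
  have h2 : 0 <= g * - y by rewrite mulr_ge0//; lra.
  have h3 : 0 <= - y * (2 * g - 1 + g * - y) by rewrite mulr_ge0//; lra.
  lra.
have [tm|tm] := leP (g * t) (2 * g - 1).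
  rewrite -p0; apply: poly_expRN_le; first exact: ltW.
  move=> y /andP[y0 yt]; rewrite dpE pE.
  have h1 : g * y <= g * t by rewrite ler_wpM2l//; lra.
  have h3 : 0 <= y * (2 * g - 1 - g * y) by rewrite mulr_ge0//; lra.
  lra.
apply: (@le_trans _ _ (p.[x0] * expR (- x0))).
  by rewrite expRN ler_pdivlMr ?expR_gt0// mul1r pE.
apply: neg => // y /andP[ty _]; rewrite dpE pE.
have h1 : g * t <= g * y by rewrite ler_wpM2l//; lra.
have h3 : 0 <= y * (1 - 2 * g + g * y) by rewrite mulr_ge0//; lra.
lra.
Qed.

(** The last coefficient is raised from 1/120 to 1/96 so that p <= p' on [0, 1]: there y^4/24 +
    y^5/96 <= 5 y^4/96. *)
Lemma expR_le_taylor5 x : 0 <= x <= 1 ->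
  expR x <= 1 + x + x ^+ 2 / 2 + x ^+ 3 / 6 + x ^+ 4 / 24 + x ^+ 5 / 96.
Proof.
move=> /andP[x0 x1].
pose p : {poly R} := 1 + 'X + 2^-1 *: 'X^2 + 6^-1 *: 'X^3 + 24^-1 *: 'X^4 + 96^-1 *: 'X^5.
have pE y : p.[y] = 1 + y + y ^+ 2 / 2 + y ^+ 3 / 6 + y ^+ 4 / 24 + y ^+ 5 / 96 by rewrite /p !hornerE /=; field.
rewrite -pE; apply: expR_le_poly => //; first by rewrite pE; lra.
move=> y /andP[y0 yx]; rewrite pE.
have -> : p^`().[y] = 1 + y + y ^+ 2 / 2 + y ^+ 3 / 6 + 5 / 96 * y ^+ 4.
  by rewrite /p !poly.derivE !hornerE /=; field.
have : 0 <= y ^+ 4 * (1 - y) by rewrite mulr_ge0 ?exprn_ge0//; lra.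
lra.
Qed.

Lemma expR_ge_taylor3 x : 0 <= x -> 1 + x + x ^+ 2 / 2 + x ^+ 3 / 6 <= expR x.
Proof.
move=> x0; pose p : {poly R} := 1 + 'X + 2^-1 *: 'X^2 + 6^-1 *: 'X^3.
have pE y : p.[y] = 1 + y + y ^+ 2 / 2 + y ^+ 3 / 6 by rewrite /p !hornerE /=; field.
rewrite -pE; apply: poly_le_expR => //; first by rewrite pE; lra.
move=> y /andP[y0 yx]; rewrite pE.
have -> : p^`().[y] = 1 + y + y ^+ 2 / 2 by rewrite /p !poly.derivE !hornerE /=; field.
have : 0 <= y ^+ 3 by rewrite exprn_ge0.
lra.
Qed.

Definition ch x : R := (expR x + expR (- x)) / 2.
Definition sh x : R := (expR x - expR (- x)) / 2.

Lemma chN x : ch (- x) = ch x.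
Proof. by rewrite /ch opprK addrC. Qed.

Lemma shN x : sh (- x) = - sh x.
Proof. by rewrite /sh opprK; lra. Qed.

Lemma ch_ge1 x : 1 <= ch x.
Proof.
have := expR_ge1Dx x; have := expR_ge1Dx (- x); rewrite /ch; lra.
Qed.

Lemma sh_gt x : 0 < x -> x < sh x.
Proof.
move=> x0; rewrite /sh expRN.
have q0 := expR_ge_taylor3 (ltW x0); set e := expR x in q0 *.
have x3 : 0 < x ^+ 3 by rewrite exprn_gt0.
have e1 : 1 <= e by nra.
have e0 : 0 < e by lra.
have : 0 < (e ^+ 2 - 1 - 2 * x * e) / e.
  by rewrite divr_gt0//; nra.
have -> : (e ^+ 2 - 1 - 2 * x * e) / e = e - e^-1 - 2 * x by field; rewrite gt_eqF.
lra.
Qed.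

Lemma sh_ge x : 0 <= x -> x <= sh x.
Proof.
rewrite le_eqVlt => /orP[/eqP <-|/sh_gt/ltW//].
by rewrite /sh oppr0 subrr mul0r.
Qed.

Lemma ch_le x t : `|t| <= x -> ch t <= ch x.
Proof.
wlog t0 : t / 0 <= t.
  move=> W; have [t0|t0] := leP 0 t; first exact: W.
  by rewrite -chN -normrN => tx; apply: W => //; lra.
rewrite ger0_norm// => tx; rewrite -subr_ge0.
have -> : ch x - ch t = (expR x - expR t) * (1 - expR (- x - t)) / 2.
  rewrite /ch (expRD (- x)) !expRN; field.
  by rewrite !gt_eqF ?expR_gt0.
rewrite divr_ge0// mulr_ge0// subr_ge0 ?ler_expR//.
by rewrite -expR0 ler_expR; lra.
Qed.

(** The sum-to-product formula writes sh x - sh t as 2 ch((x + t)/2) sh((x - t)/2), which is at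
    least x - t. *)
Lemma sh_sub_le x t : `|t| <= x -> `|sh t - t| <= sh x - x.
Proof.
wlog t0 : t / 0 <= t.
  move=> W; have [t0|t0] := leP 0 t; first exact: W.
  rewrite -[`|t|]normrN => tx; have := W (- t); rewrite shN opprK => /(_ _ tx).
  by rewrite addrC distrC => W'; apply: W'; lra.
rewrite ger0_norm// => tx; rewrite ger0_norm; last by rewrite subr_ge0 sh_ge.
have -> : sh x = sh t + 2 * ch ((x + t) / 2) * sh ((x - t) / 2).
  rewrite /ch /sh.
  have e1 : expR x = expR ((x + t) / 2) * expR ((x - t) / 2) by rewrite -expRD; congr expR; lra.
  have e2 : expR t = expR ((x + t) / 2) * expR (- ((x - t) / 2)) by rewrite -expRD; congr expR; lra.
  have e3 : expR (- x) = expR (- ((x + t) / 2)) * expR (- ((x - t) / 2)) by rewrite -expRD; congr expR; lra.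
  have e4 : expR (- t) = expR (- ((x + t) / 2)) * expR ((x - t) / 2) by rewrite -expRD; congr expR; lra.
  by rewrite e1 e2 e3 e4; field.
have u0 : 0 <= (x - t) / 2 by lra.
have := sh_ge u0; have := ch_ge1 ((x + t) / 2); set c := ch _; set s := sh _ => c1 s1.
have : s <= c * s by rewrite ler_peMl//; lra.
lra.
Qed.

End Exponential_bounds.

(** * A supermartingale bound for random walks, as a finite sum *)

Section Random_walk.
Context {R : realType} {V : finType} {M : nmodType}.
Variables (p : V -> R) (Z : V -> M).
Hypotheses (p_ge0 : forall v, 0 <= p v) (p_sum : \sum_v p v = 1).

Lemma big_tuple_cons n (F : n.+1.-tuple V -> R) :
  \sum_t F t = \sum_v \sum_(t : n.-tuple V) F [tuple of v :: t].
Proof.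
rewrite pair_big /= (reindex (fun q : V * n.-tuple V => [tuple of q.1 :: q.2])) //=.
exists (fun t => (thead t, [tuple of behead t])) => [[v t] _|t _].
  by congr (_, _); apply/val_inj.
by rewrite -tuple_eta.
Qed.

Lemma prod_tuple_cons n v (t : n.-tuple V) :
  \prod_(i < n.+1) p (tnth [tuple of v :: t] i) = p v * \prod_(i < n) p (tnth t i).
Proof. by rewrite big_ord_recl; congr (_ * _); apply: eq_bigr => i _; rewrite tnthS. Qed.

Lemma sum_prod_tuple n : \sum_(t : n.-tuple V) \prod_(i < n) p (tnth t i) = 1.
Proof.
elim: n => [|n IH].
  rewrite (eq_bigr (fun=> 1)) => [|t _]; last by rewrite big_ord0.
  by rewrite sumr_const card_tuple expn0.
rewrite big_tuple_cons (eq_bigr p) => [//|v _].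
rewrite (eq_bigr (fun t : n.-tuple V => p v * \prod_(i < n) p (tnth t i))) => [|t _].
  by rewrite -mulr_sumr IH mulr1.
exact: prod_tuple_cons.
Qed.

(** [k] counts the steps still to be taken. The alternative [1 <= Phi k.+1 w] replaces a stopping
    time: there the bound on a probability is trivial, so the drift condition is needed only
    elsewhere. *)
Lemma walk_bound (S : pred M) (Phi : nat -> M -> R) :
  (forall w, 0 <= Phi 0%N w) -> (forall w, S w -> 1 <= Phi 0%N w) ->
  (forall k w, 1 <= Phi k.+1 w \/ \sum_v p v * Phi k (w + Z v) <= Phi k.+1 w) ->
  forall n w, \sum_(t : n.-tuple V | S (w + \sum_(i < n) Z (tnth t i))) \prod_(i < n) p (tnth t i) <= Phi n w.
Proof.
move=> P0 PS step; elim=> [|n IH] w.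
  rewrite (eq_bigl (fun=> S w)) => [|t]; last by rewrite big_ord0 addr0.
  rewrite (eq_bigr (fun=> 1)) => [|t _]; last by rewrite big_ord0.
  case Sw: (S w); last by rewrite big_pred0.
  by rewrite sumr_const card_tuple expn0; exact: PS.
have [h|h] := step n w.
  apply: le_trans h; apply: (@le_trans _ _ (\sum_(t : n.+1.-tuple V) \prod_(i < n.+1) p (tnth t i))); last by rewrite sum_prod_tuple.
  rewrite [leLHS]big_mkcond /=.
  apply: ler_sum => t _; case: ifP => // _; exact: prodr_ge0.
apply: le_trans h; rewrite big_mkcond /= big_tuple_cons; apply: ler_sum => v _.
apply: le_trans (ler_wpM2l (p_ge0 v) (IH (w + Z v))).
rewrite mulr_sumr [leRHS]big_mkcond /=; apply: ler_sum => t _.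
rewrite prod_tuple_cons big_ord_recl tnth0 addrA.
have -> : \sum_(i < n) Z (tnth [tuple of v :: t] (lift ord0 i)) = \sum_(i < n) Z (tnth t i).
  by apply: eq_bigr => i _; rewrite tnthS.
by [].
Qed.

End Random_walk.

(** * Hermitian dilation and the first-order tail bound *)

Section Dilation.
Context {R : realType} {a b : nat}.
Implicit Types (W : 'M[R]_(a, b)).

Definition dil W : 'M[R]_(a + b) := block_mx 0 W W^T 0.

Lemma tr_dil W : (dil W)^T = dil W.
Proof. by rewrite /dil tr_block_mx !trmx0 trmxK. Qed.

Lemma dilD W1 W2 : dil (W1 + W2) = dil W1 + dil W2.
Proof. by rewrite /dil add_block_mx !addr0 linearD. Qed.

Lemma dilZ c W : dil (c *: W) = c *: dil W.
Proof. by rewrite /dil scale_block_mx !scaler0 linearZ. Qed.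

Lemma dil0 : dil 0 = 0.
Proof.
by rewrite /dil trmx0; apply/matrixP => i j; rewrite !mxE; case: splitP => ? _; rewrite !mxE; case: splitP => ? _; rewrite mxE.
Qed.

Lemma dil_sum (I : finType) (F : I -> 'M[R]_(a, b)) : dil (\sum_i F i) = \sum_i dil (F i).
Proof.
by apply: (big_morph dil dilD); rewrite dil0.
Qed.

Lemma qf_dil W (x : 'rV_a) (y : 'rV_b) : qf (dil W) (row_mx x y) = 2 * dotv (x *m W) y.
Proof.
rewrite /qf /dil mul_row_block !mulmx0 add0r addr0 tr_row_mx mul_row_col mxE.
rewrite mulr_natl mulr2n addrC; congr (_ + _).
have -> : y *m W^T *m x^T = (x *m W *m y^T)^T by rewrite !trmx_mul trmxK mulmxA.
by rewrite mxE.
Qed.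

Lemma sqn_row_mx n1 n2 (x : 'rV[R]_n1) (y : 'rV[R]_n2) : sqn (row_mx x y) = sqn x + sqn y.
Proof. by rewrite /sqn tr_row_mx mul_row_col mxE. Qed.

Lemma sqn_mul_fro2 W (x : 'rV_a) : sqn (x *m W) <= fro2 W * sqn x.
Proof.
rewrite sqnE fro2E exchange_big mulr_suml; apply: ler_sum => j _.
have -> : (x *m W) 0 j = dotv (\row_i W i j) x.
  by rewrite dotvE mxE; apply: eq_bigr => i _; rewrite !mxE mulrC.
apply: (le_trans (dotv_sq_le _ _)); rewrite sqnE.
by rewrite ler_wpM2r ?sqn_ge0//; apply: ler_sum => i _; rewrite mxE.
Qed.

Lemma sqrt_sqn_dotv_le n (x y : 'rV[R]_n) : 2 * dotv x y <= sqn x + sqn y.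
Proof.
have := sqn_ge0 (x - y); rewrite !sqnE dotvE => H.
have E : \sum_i (x - y) 0 i ^+ 2 = \sum_i x 0 i ^+ 2 + \sum_i y 0 i ^+ 2 - 2 * \sum_i x 0 i * y 0 i.
  by rewrite mulr_sumr -big_split -sumrB /=; apply: eq_bigr => i _; rewrite !mxE; ring.
by rewrite E in H; lra.
Qed.

Lemma dil_opb W f x : 0 <= f -> opb W f -> qf (dil W) x <= f * sqn x.
Proof.
move=> f0 Wf; rewrite -[x]hsubmxK qf_dil sqn_row_mx.
set u := lsubmx x; set v := rsubmx x.
have [f00|fn] := eqVneq f 0.
  have := Wf u; rewrite f00 expr0n /= mul0r => H.
  have : sqn (u *m W) = 0 by apply/eqP; rewrite eq_le H sqn_ge0.
  by move/eqP; rewrite sqn_eq0 => /eqP ->; rewrite /dotv mul0mx mxE mulr0 mul0r.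
have f1 : 0 < f by rewrite lt_neqAle eq_sym fn.
have := sqrt_sqn_dotv_le (u *m W) (f *: v).
have -> : dotv (u *m W) (f *: v) = f * dotv (u *m W) v by rewrite /dotv linearZ /= -scalemxAr mxE.
rewrite sqnZ => H; have := Wf u => H2.
rewrite -(ler_pM2l f1); nra.
Qed.

(* The spectrum of a dilation is symmetric, so only the even moments survive;
   each eigenvalue is at most f and their squares sum to at most 2 f^2. *)
Lemma tr_mexp_dil W f : 0 < f -> fro2 W <= f ^+ 2 ->
  \tr (mexp (dil W)) <= (a + b)%:R + 2 * (expR f - 1 - f).
Proof.
move=> f0 Wf; have [U [d s]] := sym_sdec (tr_dil W).
have op : opb W f.
  by move=> x; apply: (le_trans (sqn_mul_fro2 W x)); rewrite ler_wpM2r ?sqn_ge0.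
have df i : d 0 i <= f.
  by have := dil_opb (row i U) (ltW f0) op; rewrite (sdec_row_qf i s) (sdec_row_sqn i s) mulr1.
have trd : \sum_i d 0 i = 0.
  by rewrite -(sdec_trace s) /dil mxtrace_block !linear0 addr0.
have trd2 : \sum_i d 0 i ^+ 2 = 2 * fro2 W.
  have := sdec_trace (sdecM s s); rewrite /dil mulmx_block !(mul0mx, mulmx0) !add0r !addr0 mxtrace_block.
  rewrite (mxtrace_mulC W) -/(fro2 W) /fro2 /mx_inner => E.
  rewrite mulr_natl mulr2n E; apply: eq_bigr => i _; rewrite mxE expr2.
  by [].
pose g := (expR f - 1 - f) / f ^+ 2.
have g2 : 1 / 2 <= g.
  rewrite ler_pdivlMr ?exprn_gt0//; have := expR_ge_taylor3 (ltW f0).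
  have : 0 <= f ^+ 3 by rewrite exprn_ge0// ltW.
  lra.
have H := @expR_quad_le R g f g2 (ltW f0).
have gE : g * f ^+ 2 = expR f - 1 - f by rewrite /g divfK// expf_neq0// gt_eqF.
rewrite (sdec_trace (sdec_fc expR s)).
apply: (@le_trans _ _ (\sum_i (1 + d 0 i + g * d 0 i ^+ 2))).
  by apply: ler_sum => i _; rewrite mxE; apply: H => //; rewrite gE; lra.
rewrite !big_split /= trd addr0 sumr_const card_ord -mulr_sumr trd2 lerD2l -gE.
by rewrite mulrCA ler_wpM2l// ler_wpM2l//; lra.
Qed.

End Dilation.

(* One step of the sampling model with finitely many responses: outcome [v]
   observes the entry [(jv v, kv v)], uniformly distributed, with response [yv v]. *)
Section Sampling_model.
Context {R : realType} {V : finType} {a b : nat}.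
Variables (p : V -> R) (jv : V -> 'I_a) (kv : V -> 'I_b) (yv : V -> R).
Hypotheses (a0 : (0 < a)%N) (b0 : (0 < b)%N) (p_ge0 : forall v, 0 <= p v)
  (marg : forall (j : 'I_a) (k : 'I_b), \sum_(v | (jv v == j) && (kv v == k)) p v = (a * b)%:R^-1)
  (y_le1 : forall v, `|yv v| <= 1).
Implicit Types (W : 'M[R]_(a, b)).

Let ab0 : 0 < (a * b)%:R :> R. Proof. by rewrite ltr0n muln_gt0 a0. Qed.
Let a0' : 0 < a%:R :> R. Proof. by rewrite ltr0n. Qed.
Let b0' : 0 < b%:R :> R. Proof. by rewrite ltr0n. Qed.

Lemma sum_uniform (F : 'I_a -> 'I_b -> R) :
  \sum_v p v * F (jv v) (kv v) = (a * b)%:R^-1 * \sum_j \sum_k F j k.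
Proof.
rewrite mulr_sumr (partition_big jv xpredT)//=; apply: eq_bigr => j _.
rewrite mulr_sumr (partition_big kv xpredT)//=; apply: eq_bigr => k _.
rewrite -(marg j k) mulr_suml; apply: eq_bigr => v /andP[/eqP -> /eqP ->].
by [].
Qed.

Lemma sum_p : \sum_v p v = 1.
Proof.
rewrite (eq_bigr (fun v => p v * 1)); last by move=> v _; rewrite mulr1.
rewrite (sum_uniform (fun _ _ => 1)).
under eq_bigr do rewrite sumr_const card_ord.
by rewrite sumr_const card_ord -mulrnA (mulnC b) mulVf// gt_eqF.
Qed.

Definition atom v : 'M[R]_(a, b) := delta_mx (jv v) (kv v).
Definition mean_step : 'M[R]_(a, b) := \sum_v p v *: (yv v *: atom v).
(** The operator norm is at least [s] (for 0 <= s), as a boolean so that it can restrict a finite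
    sum. *)
Definition op_ge (s : R) W : bool := `[< exists x, sqn x = 1 /\ s ^+ 2 <= sqn (x *m W) >].
Definition tail_prob n (s : R) : R :=
  \sum_(t : n.-tuple V | op_ge s (\sum_(i < n) yv (tnth t i) *: atom (tnth t i) - n%:R *: mean_step))
    \prod_(i < n) p (tnth t i).

Lemma dotvZ m (c e : R) (x y : 'rV[R]_m) : dotv (c *: x) (e *: y) = c * e * dotv x y.
Proof. by rewrite !dotvE mulr_sumr; apply: eq_bigr => i _; rewrite !mxE; ring. Qed.

(** The dilation [K] of a matrix unit satisfies K^3 = K, so its eigenvalues lie in {-1, 0, 1} and
    its exponential is quadratic in [K]. *)
Lemma mexp_dil_delta (t : R) (j : 'I_a) (k : 'I_b) (K := dil (delta_mx j k : 'M[R]_(a, b))) :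
  mexp (t *: K) = 1%:M + ((ch t - 1) *: (K *m K) + sh t *: K).
Proof.
have K3 : K *m K *m K = K.
  rewrite /K /dil !mulmx_block !(mulmx0, mul0mx) !(addr0, add0r) trmx_delta.
  by rewrite !mul0mx !mul_delta_mx.
have [U [d s]] := sym_sdec (tr_dil (delta_mx j k : 'M[R]_(a, b))); rewrite -/K in s.
have d3 i : d 0 i * d 0 i * d 0 i = d 0 i.
  have := sdec_row_qf i (sdecM (sdecM s s) s); rewrite K3 (sdec_row_qf i s).
  by rewrite !mxE.
rewrite /mexp (fcE _ (sdecZ t s)).
rewrite [RHS](sdecD (sdec_scalar 1 s) (sdecD (sdecZ (ch t - 1) (sdecM s s)) (sdecZ (sh t) s))).2.
congr (_ *m diag_mx _ *m _); apply/rowP => i; rewrite !mxE.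
have : d 0 i * (d 0 i - 1) * (d 0 i + 1) = 0 by rewrite -[X in _ = X](subrr (d 0 i)) -{4}(d3 i); ring.
move/eqP; rewrite !mulf_eq0 subr_eq0 addr_eq0 => /orP[/orP[]|] /eqP ->.
- by rewrite !mulr0 expR0; lra.
- by rewrite /ch /sh !mulr1; lra.
- by rewrite /ch /sh mulrN1; lra.
Qed.

Lemma qf_dil_delta_sq (j : 'I_a) (k : 'I_b) x (K := dil (delta_mx j k : 'M[R]_(a, b))) :
  qf (K *m K) x = lsubmx x 0 j ^+ 2 + rsubmx x 0 k ^+ 2.
Proof.
have -> : K *m K = K *m K^T by rewrite /K tr_dil.
rewrite qf_mulT -[in LHS](hsubmxK x) /K /dil mul_row_block !mulmx0 add0r addr0 sqn_row_mx addrC.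
have E n1 n2 (i : 'I_n1) (l : 'I_n2) (u : 'rV[R]_n1) : sqn (u *m delta_mx i l) = u 0 i ^+ 2.
  have -> : u *m delta_mx i l = u 0 i *: delta_mx 0 l.
    apply/rowP => c; rewrite !mxE (bigD1 i)//= big1 ?addr0 => [|i' ii]; rewrite !mxE ?eqxx//=.
    by rewrite (negPf ii) mulr0.
  by rewrite sqnZ sqnE (bigD1 l)//= big1 ?addr0 => [|l' ll]; rewrite !mxE ?eqxx ?(negPf ll) /= ?expr1n ?mulr1// ?andbF ?expr0n.
by rewrite trmx_delta !E.
Qed.

Theorem first_order_tail n (s th : R) (de := n%:R / a%:R : R) (f := de * (sh th - th)) :
  (a <= b)%N -> (0 < n)%N -> 0 < th -> 0 < s ->
  tail_prob n s <= expR (- th * s + de * (ch th - 1)) * ((a + b)%:R + 2 * (expR f - 1 - f)).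
Proof.
move=> ab n0 th0 s0.
have de0 : 0 < de by rewrite divr_gt0 ?ltr0n.
pose K v := dil (atom v).
pose G := \sum_v p v *: ((ch (th * yv v) - 1) *: (K v *m K v) + sh (th * yv v) *: K v).
have sK v : (K v)^T = K v by exact: tr_dil.
have sG : G^T = G.
  rewrite /G linear_sum /=; apply: eq_bigr => v _.
  by rewrite !linearZ /= linearD /= !linearZ /= trmx_mul sK.
pose Ph (k : nat) W := expR (- th * s) * \tr (mexp (th *: dil W - (th * n%:R) *: dil mean_step + k%:R *: G)).
have sA k W : (th *: dil W - (th * n%:R) *: dil mean_step + k%:R *: G)^T = th *: dil W - (th * n%:R) *: dil mean_step + k%:R *: G.
  by rewrite linearD linearB /= !linearZ /= sG !tr_dil.
have mexp_tr0 (m : nat) (A : 'M[R]_m) : A^T = A -> 0 <= \tr (mexp A).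
  move=> /sym_sdec[U [d sd]]; rewrite (sdec_trace (sdec_fc _ sd)).
  by apply: sumr_ge0 => i _; rewrite mxE expR_ge0.
have Ph0 W : 0 <= Ph 0%N W by rewrite mulr_ge0 ?expR_ge0 ?mexp_tr0.
have PhS W : op_ge s (W - n%:R *: mean_step) -> 1 <= Ph 0%N W.
  move=> /asboolP[x [x1 xs]]; rewrite /Ph.
  set W' := W - _ in xs.
  have -> : th *: dil W - (th * n%:R) *: dil mean_step + 0%:R *: G = th *: dil W'.
    by rewrite scale0r addr0 /W' dilD -[- (n%:R *: _)]scaleN1r !dilZ scalerDr scaleN1r scalerN scalerA.
  pose r := Num.sqrt (sqn (x *m W')).
  have rs : s <= r by rewrite -[leLHS](ger0_norm (ltW s0)) -sqrtr_sqr ler_sqrt// sqn_ge0.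
  have r0 : 0 < r by apply: lt_le_trans rs.
  have r2 : r ^+ 2 = sqn (x *m W') by rewrite sqr_sqrtr ?sqn_ge0.
  pose q : R := (Num.sqrt 2)^-1.
  have q2 : q ^+ 2 = 1 / 2 by rewrite exprVn sqr_sqrtr// mul1r.
  (* A unit vector made of [x] and its normalized image; the quadratic form of the dilation of [W']
     there is |x W'|. *)
  pose u : 'rV[R]_(a + b) := row_mx (q *: x) ((q / r) *: (x *m W')).
  have u1 : sqn u = 1.
    by rewrite sqn_row_mx !sqnZ x1 exprMn q2 -r2; field; rewrite gt_eqF.
  have := @tr_mexp_ge R (a + b) (th *: dil W') u.
  rewrite linearZ /= tr_dil => /(_ erefl u1).
  have -> : qf (th *: dil W') u = th * r.
    have -> : qf (th *: dil W') u = th * (2 * (q * (q / r) * sqn (x *m W'))).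
      by rewrite qfZ qf_dil -scalemxAl dotvZ.
    have -> : th * (2 * (q * (q / r) * sqn (x *m W'))) = th * (2 * q ^+ 2 * r).
      by rewrite -r2; field; rewrite gt_eqF.
    by rewrite q2; lra.
  move=> H; apply: le_trans (ler_wpM2l (expR_ge0 _) H).
  by rewrite -expRD -expR0 ler_expR mulNr addrC subr_ge0 ler_pM2l.
have step k W : \sum_v p v * Ph k (W + yv v *: atom v) <= Ph k.+1 W.
  have -> : \sum_v p v * Ph k (W + yv v *: atom v) = expR (- th * s) * \sum_v p v * \tr (mexp (th *: dil W - (th * n%:R) *: dil mean_step + k%:R *: G + (th * yv v) *: K v)).
    rewrite mulr_sumr; apply: eq_bigr => v _; rewrite /Ph mulrCA; congr (_ * (_ * \tr (mexp _))).
    rewrite dilD dilZ scalerDr scalerA -/(K v) -!addrA; congr (_ + _).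
    by rewrite [LHS]addrC -addrA.
  rewrite /Ph ler_wpM2l ?expR_ge0// -natr1 scalerDl scale1r addrA.
  apply: tr_mexp_mean => //; first by move=> v; rewrite linearZ /= sK.
  move=> x; rewrite le_eqVlt; apply/orP; left; apply/eqP; congr (qf _ x).
  under eq_bigr do rewrite mexp_dil_delta scalerDr.
  rewrite big_split /= -scaler_suml sum_p scale1r.
  by [].
have := @walk_bound R V _ p (fun v => yv v *: atom v) p_ge0 sum_p
  (fun W => op_ge s (W - n%:R *: mean_step)) Ph Ph0 PhS (fun k W => or_intror (step k W)) n 0.
rewrite /tail_prob; under eq_bigl do rewrite add0r.
move/le_trans; apply; rewrite /Ph expRD -mulrA ler_wpM2l ?expR_ge0//.
pose F := \sum_v (n%:R * p v * (sh (th * yv v) - th * yv v)) *: atom v.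
have FE j k : `|F j k| <= de / b%:R * (sh th - th).
  rewrite /F summxE; apply: (le_trans (ler_norm_sum _ _ _)).
  have -> : de / b%:R * (sh th - th) = \sum_v n%:R * (sh th - th) * (p v * ((jv v == j) && (kv v == k))%:R).
    rewrite -mulr_sumr (sum_uniform (fun j' k' => ((j' == j) && (k' == k))%:R)).
    have -> : \sum_(j' < a) \sum_(k' < b) ((j' == j) && (k' == k))%:R = 1 :> R.
      rewrite (bigD1 j)//= [X in _ + X]big1 ?addr0 => [|j' jj].
        rewrite (bigD1 k)//= [X in _ + X]big1 ?addr0 => [|k' kk]; last by rewrite (negPf kk) andbF.
        by rewrite !eqxx.
      by rewrite big1// => k' _; rewrite (negPf jj).
    by rewrite natrM /de; field; rewrite !gt_eqF.
  apply: ler_sum => v _; rewrite !mxE normrM [X in _ * X]ger0_norm ?ler0n// eq_sym [(k == _)]eq_sym mulrA.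
  rewrite ler_wpM2r ?ler0n// normrM ger0_norm ?mulr_ge0// [leRHS]mulrAC ler_wpM2l ?mulr_ge0//.
  by apply: sh_sub_le; rewrite normrM (gtr0_norm th0) ler_piMr// ltW.
have f0 : 0 < f by rewrite /f mulr_gt0// subr_gt0 sh_gt.
have Ff : fro2 F <= f ^+ 2.
  apply: (@le_trans _ _ (\sum_(i < a) \sum_(j < b) (f / b%:R) ^+ 2)).
    rewrite fro2E; apply: ler_sum => i _; apply: ler_sum => j _.
    rewrite -real_normK ?num_real// lerXn2r ?nnegrE//; first by rewrite divr_ge0// ltW.
    by apply: (le_trans (FE i j)); rewrite /f mulrAC.
  have -> (c : R) : \sum_(i < a) \sum_(j < b) c = c * b%:R * a%:R.
    by rewrite !sumr_const !card_ord !mulr_natr.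
  have -> : (f / b%:R) ^+ 2 * b%:R * a%:R = f ^+ 2 * (a%:R / b%:R) by field; rewrite gt_eqF.
  by rewrite ler_piMr ?sqr_ge0// ler_pdivrMr// mul1r ler_nat.
apply: le_trans (ler_wpM2l (expR_ge0 _) (tr_mexp_dil f0 Ff)).
have sF := tr_dil F; rewrite -mxtraceZ -(mexp_shift _ sF).
apply: tr_mexp_le; [exact: sA| by rewrite linearD /= sF tr_scalar_mx|] => x.
rewrite !qfD qfN !qfZ qf_scalar.
rewrite dil0 qf0 mulr0 sub0r.
have -> : qf (dil F) x = n%:R * \sum_v p v * (sh (th * yv v) * qf (K v) x) - th * n%:R * qf (dil mean_step) x.
  rewrite /F /mean_step !dil_sum !qf_sum !mulr_sumr -sumrB; apply: eq_bigr => v _.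
  by rewrite !dilZ !qfZ -/(K v); ring.
have -> : qf G x = \sum_v p v * ((ch (th * yv v) - 1) * qf (K v *m K v) x) + \sum_v p v * (sh (th * yv v) * qf (K v) x).
  by rewrite /G qf_sum -big_split; apply: eq_bigr => v _; rewrite qfZ qfD !qfZ mulrDr.
suff : n%:R * \sum_v p v * ((ch (th * yv v) - 1) * qf (K v *m K v) x) <= de * (ch th - 1) * sqn x by lra.
apply: (@le_trans _ _ (n%:R * \sum_v p v * ((ch th - 1) * (lsubmx x 0 (jv v) ^+ 2 + rsubmx x 0 (kv v) ^+ 2)))).
  rewrite ler_wpM2l ?ler0n//; apply: ler_sum => v _; rewrite ler_wpM2l// qf_dil_delta_sq ler_wpM2r ?addr_ge0 ?sqr_ge0//.
  by rewrite lerD2r; apply: ch_le; rewrite normrM (gtr0_norm th0) ler_piMr// ltW.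
rewrite (sum_uniform (fun j k => (ch th - 1) * (lsubmx x 0 j ^+ 2 + rsubmx x 0 k ^+ 2))).
have -> : \sum_j \sum_k (ch th - 1) * (lsubmx x 0 j ^+ 2 + rsubmx x 0 k ^+ 2) =
   (ch th - 1) * (b%:R * sqn (lsubmx x) + a%:R * sqn (rsubmx x)).
  rewrite !sqnE mulrDr !mulr_sumr.
  have -> : \sum_(i < b) (ch th - 1) * (a%:R * rsubmx x 0 i ^+ 2) = \sum_(j < a) \sum_(i < b) (ch th - 1) * rsubmx x 0 i ^+ 2.
    rewrite exchange_big /=; apply: eq_bigr => i _.
    by rewrite sumr_const card_ord mulrCA mulr_natl.
  rewrite -big_split /=; apply: eq_bigr => j _.
  have -> : (ch th - 1) * (b%:R * lsubmx x 0 j ^+ 2) = \sum_(i < b) (ch th - 1) * lsubmx x 0 j ^+ 2.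
    by rewrite sumr_const card_ord mulrCA mulr_natl.
  by rewrite -big_split /=; apply: eq_bigr => k _; rewrite mulrDr.
have -> : sqn x = sqn (lsubmx x) + sqn (rsubmx x) by rewrite -sqn_row_mx hsubmxK.
have c0 : 0 <= ch th - 1 by rewrite subr_ge0 ch_ge1.
have -> : de * (ch th - 1) * (sqn (lsubmx x) + sqn (rsubmx x)) =
   n%:R * ((a * b)%:R^-1 * ((ch th - 1) * (b%:R * sqn (lsubmx x) + b%:R * sqn (rsubmx x)))).
  by rewrite /de natrM; field; rewrite !gt_eqF.
rewrite ler_wpM2l ?ler0n// ler_wpM2l ?invr_ge0 ?ler0n// ler_wpM2l// lerD2l ler_wpM2r ?sqn_ge0//.
by rewrite ler_nat.
Qed.

End Sampling_model.

(** * One step of the second-order potential *)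

Section Second_order_step.
Context {R : realType} {V : finType} {a b : nat}.
Variables (p : V -> R) (jv : V -> 'I_a) (kv : V -> 'I_b) (yv : V -> R).
Hypotheses (a0 : (0 < a)%N) (b0 : (0 < b)%N) (p_ge0 : forall v, 0 <= p v)
  (marg : forall (j : 'I_a) (k : 'I_b), \sum_(v | (jv v == j) && (kv v == k)) p v = (a * b)%:R^-1)
  (y_le1 : forall v, `|yv v| <= 1).
Implicit Types (W : 'M[R]_(a, b)).

Local Notation E0 := (mean_step p jv kv yv).
Local Notation atom := (@atom R V a b jv kv).
Local Notation N := ((a * b)%:R : R).

Let N0 : 0 < N. Proof. by rewrite ltr0n muln_gt0 a0. Qed.
Let a0' : 0 < a%:R :> R. Proof. by rewrite ltr0n. Qed.
Let b0' : 0 < b%:R :> R. Proof. by rewrite ltr0n. Qed.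
Let y2 v : yv v ^+ 2 <= 1.
Proof. by rewrite -real_normK ?num_real// expr_le1. Qed.

Lemma mean_stepE j k : E0 j k = \sum_(v | (jv v == j) && (kv v == k)) p v * yv v.
Proof.
rewrite /mean_step summxE [RHS]big_mkcond; apply: eq_bigr => v _.
by rewrite !mxE eq_sym [k == _]eq_sym; case: ifP; rewrite ?mulr1 ?mulr0.
Qed.

Lemma mean_step_le j k : `|E0 j k| <= N^-1.
Proof.
rewrite mean_stepE -(marg j k); apply: (le_trans (ler_norm_sum _ _ _)); apply: ler_sum => v _.
by rewrite normrM ger0_norm// ler_piMr.
Qed.

Lemma fro2_mean_step : fro2 E0 <= N^-1.
Proof.
rewrite fro2E; apply: (@le_trans _ _ (\sum_(j < a) \sum_(k < b) N^-1 ^+ 2)).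
  apply: ler_sum => j _; apply: ler_sum => k _; rewrite -real_normK ?num_real//.
  by rewrite lerXn2r ?nnegrE ?mean_step_le// invr_ge0 ltW.
have -> (c : R) : \sum_(i < a) \sum_(j < b) c = N * c.
  by rewrite !sumr_const !card_ord -mulrnA mulr_natl mulnC.
by rewrite expr2 mulrA mulfV ?gt_eqF// mul1r.
Qed.

Section Rank_two.
Context (W : 'M[R]_(a, b)) (v : V).
(** The first-order variation of W W^T in the direction of the atom; its rank is at most two. *)
Definition cross : 'M[R]_a := W *m (atom v)^T + atom v *m W^T.

Lemma tr_cross : cross^T = cross.
Proof. by rewrite /cross linearD /= !trmx_mul !trmxK addrC. Qed.

Lemma mul_atom (x : 'rV[R]_a) : x *m atom v = x 0 (jv v) *: delta_mx 0 (kv v).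
Proof.
apply/rowP => c; rewrite !mxE (bigD1 (jv v))//= big1 ?addr0 => [|i' ii]; rewrite !mxE ?eqxx//=.
by rewrite (negPf ii) mulr0.
Qed.

Lemma mul_atom_tr (x : 'rV[R]_b) : x *m (atom v)^T = x 0 (kv v) *: delta_mx 0 (jv v).
Proof.
apply/rowP => c; rewrite !mxE (bigD1 (kv v))//= big1 ?addr0 => [|i' ii]; rewrite !mxE ?eqxx ?andbT//=.
by rewrite (negPf ii) andbF mulr0.
Qed.

Lemma sqn_delta m (j : 'I_m) : sqn (delta_mx 0 j : 'rV[R]_m) = 1.
Proof.
rewrite sqnE (bigD1 j)//= big1 ?addr0 => [|l ll]; rewrite !mxE ?eqxx ?expr1n//.
by rewrite (negPf ll) andbF expr0n.
Qed.

Lemma dotv_delta m (j : 'I_m) (x : 'rV[R]_m) : dotv (delta_mx 0 j) x = x 0 j.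
Proof.
rewrite dotvE (bigD1 j)//= big1 ?addr0 => [|l ll]; rewrite !mxE ?eqxx ?mul1r//.
by rewrite (negPf ll) andbF mul0r.
Qed.

Definition wcol : 'rV[R]_a := (col (kv v) W)^T.

Lemma mul_cross x : x *m cross = (x *m W) 0 (kv v) *: delta_mx 0 (jv v) + x 0 (jv v) *: wcol.
Proof.
rewrite /cross mulmxDr !mulmxA mul_atom_tr mul_atom -scalemxAl; congr (_ + _ *: _).
by rewrite -rowE /wcol tr_col.
Qed.

Lemma qf_cross x : qf cross x = 2 * ((x *m W) 0 (kv v) * x 0 (jv v)).
Proof.
rewrite /qf mul_cross mulmxDl -!scalemxAl mxE [X in X + _]mxE [X in _ + X]mxE.
rewrite -/(dotv _ x) -/(dotv _ x) dotv_delta.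
have -> : dotv wcol x = (x *m W) 0 (kv v).
  by rewrite dotvE mxE; apply: eq_bigr => i _; rewrite !mxE mulrC.
by ring.
Qed.

Lemma sqnD m (x y : 'rV[R]_m) : sqn (x + y) = sqn x + 2 * dotv x y + sqn y.
Proof.
rewrite !sqnE dotvE mulr_sumr -!big_split /=; apply: eq_bigr => i _.
by rewrite !mxE; ring.
Qed.

Lemma qf_cross_sq x : qf (cross *m cross) x =
  (x *m W) 0 (kv v) ^+ 2 + x 0 (jv v) ^+ 2 * sqn wcol
  + 2 * ((x *m W) 0 (kv v) * (x 0 (jv v) * W (jv v) (kv v))).
Proof.
rewrite -{2}tr_cross qf_mulT mul_cross sqnD !sqnZ sqn_delta dotvZ dotv_delta.
by rewrite /wcol !mxE; ring.
Qed.

Lemma qf_atom_sq x : qf (atom v *m (atom v)^T) x = x 0 (jv v) ^+ 2.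
Proof. by rewrite qf_mulT mul_atom sqnZ sqn_delta mulr1. Qed.

(* Buzano's inequality: |2 <x, e> x - |x|^2 e| = |x|^2 for a unit vector e. *)
Lemma qf_cross_le x (r : R) : 0 <= r -> sqn wcol <= r ^+ 2 ->
  `|qf cross x| <= (r + `|W (jv v) (kv v)|) * sqn x.
Proof.
move=> r0 wr; rewrite qf_cross.
set al := (x *m W) 0 _; set be := x 0 _; set wj := W _ _.
have alE : al = dotv x wcol by rewrite dotvE /al mxE; apply: eq_bigr => i _; rewrite !mxE.
pose u := (2 * be) *: x + (- sqn x) *: delta_mx 0 (jv v).
have u2 : sqn u = sqn x ^+ 2.
  rewrite /u sqnD !sqnZ sqn_delta dotvZ.
  have -> : dotv x (delta_mx 0 (jv v)) = be by rewrite /be -[RHS]dotv_delta !dotvE; apply: eq_bigr => i _; rewrite mulrC.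
  ring.
have uw : dotv u wcol = 2 * (al * be) - sqn x * wj.
  rewrite /u /dotv mulmxDl -!scalemxAl mxE [X in X + _]mxE [X in _ + X]mxE.
  rewrite -/(dotv x wcol) -alE -/(dotv _ wcol) dotv_delta /wcol !mxE -/wj; ring.
have H := dotv_sq_le u wcol; rewrite u2 uw in H.
have H2 : `|2 * (al * be) - sqn x * wj| <= sqn x * r.
  rewrite -(@ler_pXn2r _ 2) ?nnegrE ?mulr_ge0 ?sqn_ge0// real_normK ?num_real//.
  by apply: (le_trans H); rewrite exprMn ler_wpM2l ?sqr_ge0.
have H3 : `|sqn x * wj| = sqn x * `|wj| by rewrite normrM ger0_norm ?sqn_ge0.
have -> : 2 * (al * be) = (2 * (al * be) - sqn x * wj) + sqn x * wj by rewrite subrK.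
apply: (le_trans (ler_normD _ _)); rewrite H3; lra.
Qed.

End Rank_two.

Lemma sqnD_le m (e : R) (x y : 'rV[R]_m) : 0 < e ->
  sqn (x + y) <= (1 + e) * sqn x + (1 + e^-1) * sqn y.
Proof.
move=> e0; rewrite sqnD.
have := sqn_ge0 (e *: x + (-1) *: y); rewrite sqnD !sqnZ dotvZ => H.
have H2 : 0 <= e^-1 * (e ^+ 2 * sqn x + 2 * (e * -1 * dotv x y) + (-1) ^+ 2 * sqn y).
  by rewrite mulr_ge0// invr_ge0 ltW.
have E : e^-1 * (e ^+ 2 * sqn x + 2 * (e * -1 * dotv x y) + (-1) ^+ 2 * sqn y) =
  e * sqn x - 2 * dotv x y + e^-1 * sqn y by field; rewrite gt_eqF.
by rewrite E in H2; lra.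
Qed.

Lemma fro2D_le m1 m2 (e : R) (A B : 'M[R]_(m1, m2)) : 0 < e ->
  fro2 (A + B) <= (1 + e) * fro2 A + (1 + e^-1) * fro2 B.
Proof.
move=> e0; rewrite fro2D.
have := fro2_ge0 (e *: A - B); rewrite fro2B fro2Z mx_innerZl => H.
have H2 : 0 <= e^-1 * (e ^+ 2 * fro2 A - 2 * (e * mx_inner A B) + fro2 B).
  by rewrite mulr_ge0// invr_ge0 ltW.
have E : e^-1 * (e ^+ 2 * fro2 A - 2 * (e * mx_inner A B) + fro2 B) =
  e * fro2 A - 2 * mx_inner A B + e^-1 * fro2 B by field; rewrite gt_eqF.
by rewrite E in H2; lra.
Qed.

Lemma sum_uniform' (F : 'I_a -> 'I_b -> R) :
  \sum_v p v * F (jv v) (kv v) = N^-1 * \sum_j \sum_k F j k.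
Proof. exact: sum_uniform. Qed.

Section Increment.
Variables (T : 'M[R]_(a, b)) (th mu : R).
Hypotheses (th_ge0 : 0 <= th) (mu_ge0 : 0 <= mu).
Local Notation wv v := (T (jv v) (kv v)).

(** The change of th W W^T + mu |W|^2 when W passes from [T] to T + y_v atom_v. *)
Definition incr v : 'M[R]_a := (th * yv v) *: cross T v +
  ((th * yv v ^+ 2) *: (atom v *m (atom v)^T) + (mu * (2 * yv v * wv v + yv v ^+ 2))%:M).

Lemma tr_incr v : (incr v)^T = incr v.
Proof.
have trD (A B : 'M[R]_a) : A^T = A -> B^T = B -> (A + B)^T = A + B.
  by move=> sA sB; rewrite linearD /= sA sB.
have trZ c (A : 'M[R]_a) : A^T = A -> (c *: A)^T = c *: A by move=> sA; rewrite linearZ /= sA.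
apply: (trD _ _ _); first by apply: (trZ _ _); exact: tr_cross.
by apply: trD; [apply: trZ; rewrite trmx_mul trmxK|exact: tr_scalar_mx].
Qed.

Lemma qf_incr v x : qf (incr v) x = th * (yv v * qf (cross T v) x + yv v ^+ 2 * x 0 (jv v) ^+ 2)
  + mu * (2 * yv v * wv v + yv v ^+ 2) * sqn x.
Proof. by rewrite /incr qfD qfD qfZ qfZ qf_scalar qf_atom_sq; ring. Qed.

Lemma sqr_coord_le m (x : 'rV[R]_m) j : x 0 j ^+ 2 <= sqn x.
Proof. by rewrite sqnE (bigD1 j)//= lerDl sumr_ge0// => i _; rewrite sqr_ge0. Qed.

(** [r] bounds the column and [t] the entry of [T] that the atom meets. Buzano's factor r + t
    replaces the trivial 2r; at small entries this lowers the top of the spectrum and so permits a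
    smaller curvature constant. *)
Lemma qf_incr_le v x (r t : R) : 0 <= r -> sqn (wcol T v) <= r ^+ 2 -> `|wv v| <= t ->
  qf (incr v) x <= (th * (r + t + 1) + mu * (2 * t + 1)) * sqn x.
Proof.
move=> r0 wr wt; rewrite qf_incr.
have x0 := sqn_ge0 x; have t0 : 0 <= t by apply: le_trans wt.
have K := qf_cross_le x r0 wr.
have h1 : yv v * qf (cross T v) x <= (r + t) * sqn x.
  apply: (le_trans (ler_norm _)); rewrite normrM; apply: (@le_trans _ _ `|qf (cross T v) x|).
    by rewrite ler_piMl.
  by apply: (le_trans K); rewrite ler_wpM2r// lerD2l.
have h2 : yv v ^+ 2 * x 0 (jv v) ^+ 2 <= 1 * sqn x.
  by apply: ler_pM; rewrite ?sqr_ge0// sqr_coord_le.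
have h3 : 2 * yv v * wv v + yv v ^+ 2 <= 2 * t + 1.
  apply: lerD => //; rewrite -mulrA ler_pM2l//.
  by apply: (le_trans (ler_norm _)); rewrite normrM -[leRHS]mul1r ler_pM.
have h4 : th * (yv v * qf (cross T v) x + yv v ^+ 2 * x 0 (jv v) ^+ 2) <= th * ((r + t) * sqn x + 1 * sqn x).
  by rewrite ler_wpM2l// lerD.
have h5 : mu * (2 * yv v * wv v + yv v ^+ 2) * sqn x <= mu * (2 * t + 1) * sqn x.
  by rewrite ler_wpM2r// ler_wpM2l.
lra.
Qed.

(** The cross term dominates, so a small [e] leaves it nearly intact and charges 1 + 1/e to the
    rest. Splitting the rest with weight 1/4 produces the factors 5/4 and 5. *)
Lemma qf_incr_sq_le v x (e : R) : 0 < e -> qf (incr v *m incr v) x <=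
  (1 + e) * (th ^+ 2 * qf (cross T v *m cross T v) x) +
  (1 + e^-1) * (5 / 4 * th ^+ 2 * x 0 (jv v) ^+ 2 + 5 * mu ^+ 2 * (8 * wv v ^+ 2 + 2) * sqn x).
Proof.
move=> e0.
have -> : incr v *m incr v = incr v *m (incr v)^T by rewrite tr_incr.
rewrite qf_mulT {1}/incr mulmxDr.
apply: (le_trans (sqnD_le _ _ e0)); apply: lerD.
  rewrite ler_pM2l; last by lra.
  rewrite -scalemxAr sqnZ.
  have -> : cross T v *m cross T v = cross T v *m (cross T v)^T by rewrite tr_cross.
  rewrite qf_mulT exprMn -mulrA ler_wpM2l ?sqr_ge0//.
  by rewrite ler_piMl ?sqn_ge0.
have ei : 0 < e^-1 by rewrite invr_gt0.
rewrite ler_pM2l; last by lra.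
rewrite mulmxDr; apply: (le_trans (sqnD_le (e := 1 / 4) _ _ _)); first by lra.
have -> : (1 / 4 : R)^-1 = 4 by rewrite invfM invr1 mul1r invrK.
rewrite -scalemxAr mul_mx_scalar !sqnZ mulmxA mul_atom -scalemxAl sqnZ.
have -> : sqn (delta_mx 0 (kv v) *m (atom v)^T) = 1.
  by rewrite mul_atom_tr sqnZ sqn_delta mxE !eqxx /= expr1n mulr1.
have x0 := sqn_ge0 x; set be := x 0 (jv v); set w := wv v.
have h1 : (th * yv v ^+ 2) ^+ 2 * (be ^+ 2 * 1) <= th ^+ 2 * be ^+ 2.
  rewrite mulr1 ler_wpM2r ?sqr_ge0// exprMn ler_piMr ?sqr_ge0//.
  by rewrite exprn_ile1 ?sqr_ge0.
have h2 : (mu * (2 * yv v * w + yv v ^+ 2)) ^+ 2 * sqn x <= mu ^+ 2 * (8 * w ^+ 2 + 2) * sqn x.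
  rewrite ler_wpM2r// exprMn ler_wpM2l ?sqr_ge0//.
  have : 0 <= (2 * yv v * w - yv v ^+ 2) ^+ 2 by rewrite sqr_ge0.
  have : yv v ^+ 2 * w ^+ 2 <= w ^+ 2 by rewrite ler_piMl ?sqr_ge0.
  have : yv v ^+ 2 * yv v ^+ 2 <= 1 by rewrite mulr_ile1 ?sqr_ge0.
  lra.
lra.
Qed.

(** This second moment dictates the potential: it returns T T^T with factor (a + 2)/N, the quadratic
    term of the Riccati recursion, and creates |T|^2 times the identity, which the term mu |W|^2 has
    to absorb. *)
Lemma sum_cross_sq x : \sum_v p v * qf (cross T v *m cross T v) x =
  N^-1 * ((a%:R + 2) * sqn (x *m T) + sqn x * fro2 T).
Proof.
under eq_bigr do rewrite qf_cross_sq.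
rewrite (sum_uniform' (fun j k => (x *m T) 0 k ^+ 2 + x 0 j ^+ 2 * sqn ((col k T)^T)
  + 2 * ((x *m T) 0 k * (x 0 j * T j k)))); congr (_ * _).
under eq_bigr do rewrite !big_split /=.
rewrite !big_split /=.
have -> : \sum_(j < a) \sum_(k < b) (x *m T) 0 k ^+ 2 = a%:R * sqn (x *m T).
  by rewrite sumr_const card_ord mulr_natl sqnE.
have -> : \sum_(j < a) \sum_(k < b) x 0 j ^+ 2 * sqn ((col k T)^T) = sqn x * fro2 T.
  rewrite sqnE mulr_suml; apply: eq_bigr => j _; rewrite -mulr_sumr; congr (_ * _).
  by rewrite fro2E exchange_big /=; apply: eq_bigr => k _; rewrite sqnE; apply: eq_bigr => i _; rewrite !mxE.
have -> : \sum_(j < a) \sum_(k < b) 2 * ((x *m T) 0 k * (x 0 j * T j k)) = 2 * sqn (x *m T).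
  rewrite exchange_big sqnE mulr_sumr; apply: eq_bigr => k _.
  by rewrite -!mulr_sumr; congr (_ * _); rewrite -[X in _ * X](_ : (x *m T) 0 k = _) ?expr2// mxE.
ring.
Qed.

Lemma sqn_wcol_le v (sg : R) : 0 <= sg -> opb T sg -> sqn (wcol T v) <= sg ^+ 2.
Proof.
move=> sg0 Ts; have := opb_tr sg0 Ts (delta_mx 0 (kv v)).
by rewrite sqn_delta mulr1 -rowE /wcol tr_col.
Qed.

Lemma sqn_row_le j (sg : R) : opb T sg -> \sum_k T j k ^+ 2 <= sg ^+ 2.
Proof.
move=> Ts; have := Ts (delta_mx 0 j); rewrite sqn_delta mulr1 -rowE sqnE.
by under eq_bigr do rewrite mxE.
Qed.

(** The weight by the squared entry pays, in the manner of Chebyshev, for the large entries, where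
    only the worse curvature constant [g2] is available. *)
Lemma sum_cross_sq_weighted x (sg : R) : 0 <= sg -> opb T sg ->
  \sum_v p v * (wv v ^+ 2 * qf (cross T v *m cross T v) x) <= N^-1 * (4 * sg ^+ 2 * sg ^+ 2 * sqn x).
Proof.
move=> sg0 Ts.
apply: (@le_trans _ _ (\sum_v p v * (T (jv v) (kv v) ^+ 2 * (2 * (x *m T) 0 (kv v) ^+ 2)
   + 2 * sg ^+ 2 * (T (jv v) (kv v) ^+ 2 * x 0 (jv v) ^+ 2)))).
  apply: ler_sum => v _; rewrite ler_wpM2l//.
  have := ler_wpM2l (sqr_ge0 (T (jv v) (kv v))) (_ : qf (cross T v *m cross T v) x <= 2 * (x *m T) 0 (kv v) ^+ 2 + 2 * sg ^+ 2 * x 0 (jv v) ^+ 2).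
  have -> : T (jv v) (kv v) ^+ 2 * (2 * (x *m T) 0 (kv v) ^+ 2) + 2 * sg ^+ 2 * (T (jv v) (kv v) ^+ 2 * x 0 (jv v) ^+ 2)
    = T (jv v) (kv v) ^+ 2 * (2 * (x *m T) 0 (kv v) ^+ 2 + 2 * sg ^+ 2 * x 0 (jv v) ^+ 2) by ring.
  apply; rewrite qf_cross_sq.
  have H := sqn_wcol_le v sg0 Ts.
  have H2 : wv v ^+ 2 <= sqn (wcol T v) by have := sqr_coord_le (wcol T v) (jv v); rewrite /wcol !mxE.
  set al := (x *m T) 0 _; set be := x 0 _; set w := T _ _ in H2 *; set q := sqn (wcol T v) in H H2 *.
  have : 0 <= (al - be * w) ^+ 2 by rewrite sqr_ge0.
  have : be ^+ 2 * w ^+ 2 <= be ^+ 2 * q by rewrite ler_wpM2l ?sqr_ge0.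
  have : be ^+ 2 * q <= be ^+ 2 * sg ^+ 2 by rewrite ler_wpM2l ?sqr_ge0.
  lra.
rewrite (sum_uniform' (fun j k => T j k ^+ 2 * (2 * (x *m T) 0 k ^+ 2) + 2 * sg ^+ 2 * (T j k ^+ 2 * x 0 j ^+ 2))).
rewrite ler_pM2l ?invr_gt0//.
under eq_bigr do rewrite big_split /=.
rewrite big_split /=.
have s0 : 0 <= sg ^+ 2 by rewrite sqr_ge0.
have h1 : \sum_(j < a) \sum_(k < b) T j k ^+ 2 * (2 * (x *m T) 0 k ^+ 2) <= sg ^+ 2 * (2 * (sg ^+ 2 * sqn x)).
  apply: (@le_trans _ _ (sg ^+ 2 * (2 * sqn (x *m T)))); last by rewrite ler_wpM2l// ler_pM2l// Ts.
  rewrite exchange_big /= sqnE !mulr_sumr; apply: ler_sum => k _.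
  rewrite -mulr_suml; apply: ler_wpM2r; first by apply: mulr_ge0; rewrite ?sqr_ge0.
  have := opb_tr sg0 Ts (delta_mx 0 k); rewrite sqn_delta mulr1 -rowE sqnE.
  by under eq_bigr do rewrite !mxE.
have h2 : \sum_(j < a) \sum_(k < b) 2 * sg ^+ 2 * (T j k ^+ 2 * x 0 j ^+ 2) <= 2 * sg ^+ 2 * (sg ^+ 2 * sqn x).
  under eq_bigr do rewrite -mulr_sumr.
  rewrite -mulr_sumr ler_wpM2l ?mulr_ge0// sqnE mulr_sumr; apply: ler_sum => j _.
  by rewrite -mulr_suml; apply: ler_wpM2r; [exact: sqr_ge0|exact: sqn_row_le].
lra.
Qed.

Lemma sum_rest (x : 'rV[R]_a) : \sum_v p v * (5 / 4 * th ^+ 2 * x 0 (jv v) ^+ 2 + 5 * mu ^+ 2 * (8 * wv v ^+ 2 + 2) * sqn x)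
  = 5 / 4 * th ^+ 2 * (sqn x / a%:R) + 40 * mu ^+ 2 * (fro2 T / N) * sqn x + 10 * mu ^+ 2 * sqn x.
Proof.
rewrite (eq_bigr (fun v => 5 / 4 * th ^+ 2 * (p v * x 0 (jv v) ^+ 2) +
   (40 * mu ^+ 2 * sqn x * (p v * wv v ^+ 2) + 10 * mu ^+ 2 * sqn x * p v))); last by move=> v _; ring.
rewrite !big_split /= -!mulr_sumr (sum_p a0 b0 marg).
rewrite (sum_uniform' (fun j k => x 0 j ^+ 2)) (sum_uniform' (fun j k => T j k ^+ 2)) -fro2E.
have -> : \sum_(j < a) \sum_(k < b) x 0 j ^+ 2 = b%:R * sqn x.
  by rewrite sqnE mulr_sumr; apply: eq_bigr => j _; rewrite sumr_const card_ord mulr_natl.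
by rewrite natrM; field; rewrite !gt_eqF.
Qed.

End Increment.

(** A centred step subtracts the mean and then adds the observation; [T] is the state in between.
    [g1] serves the atoms that meet an entry of size at most rho sg and [g2] the others; [ga] is the
    price of writing [g2] as [g1] plus a multiple of the squared entry. The last three hypotheses
    are the recursions that the parameters must satisfy. *)
Lemma second_order_step (T : 'M[R]_(a, b)) (th mu nu th' mu' nu' g1 g2 ga rho sg x1 x2 : R) (W := T + E0) :
  0 <= th -> 0 <= mu -> 0 < sg -> opb T sg -> 0 <= rho -> 0 <= ga ->
  (forall t, t <= x1 -> expR t <= 1 + t + g1 * t ^+ 2) ->
  (forall t, t <= x2 -> expR t <= 1 + t + g2 * t ^+ 2) ->
  0 <= g1 -> g1 <= g2 -> g2 <= g1 + ga * rho ^+ 2 ->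
  th * (sg + rho * sg + 1) + mu * (2 * (rho * sg) + 1) <= x1 ->
  th * (sg + sg + 1) + mu * (2 * sg + 1) <= x2 ->
  th + g1 * (11 / 10) * th ^+ 2 * (101 / 100) * (a%:R + 2) * N^-1 <= th' ->
  mu + (g1 * (11 / 10) * th ^+ 2 + 440 * g2 * mu ^+ 2) * (101 / 100) * N^-1 <= mu' ->
  nu + th * a%:R^-1 + mu + g1 * (11 / 10) * th ^+ 2 * (a%:R + 3) * 101 * N^-1 ^+ 2 +
     ga * (11 / 10) * 4 * sg ^+ 2 * th ^+ 2 * N^-1 +
     g2 * 11 * (5 / 4 * th ^+ 2 * a%:R^-1 + 10 * mu ^+ 2 + 40 * mu ^+ 2 * 101 * N^-1 ^+ 2) <= nu' ->
  \sum_v p v * \tr (mexp (th *: ((T + yv v *: atom v) *m (T + yv v *: atom v)^T) +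
      (mu * fro2 (T + yv v *: atom v) + nu)%:M)) <=
  \tr (mexp (th' *: (W *m W^T) + (mu' * fro2 W + nu')%:M)).
Proof.
move=> th0 mu0 sg0 Ts rho0 ga0 H1 H2 g10 g12 g2ga X1 X2 TH MU NU.
have g20 : 0 <= g2 by apply: le_trans g12.
have sgg : 0 <= sg by exact: ltW.
pose Q v := incr T th mu v.
have sQ v : (Q v)^T = Q v by exact: tr_incr.
pose wv v := T (jv v) (kv v).
pose g v := if `|wv v| <= rho * sg then g1 else g2.
have gg2 v : g v <= g2 by rewrite /g; case: ifP.
have g0 v : 0 <= g v by rewrite /g; case: ifP.
have s20 : 0 < sg ^+ 2 by rewrite exprn_gt0.
have gga v : g v <= g1 + ga / sg ^+ 2 * wv v ^+ 2.
  rewrite /g; case: ifPn => [_|]; first by rewrite lerDl mulr_ge0 ?sqr_ge0// divr_ge0// ltW.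
  rewrite -ltNge => hw; apply: (le_trans g2ga); rewrite lerD2l mulrAC -mulrA ler_wpM2l//.
  rewrite ler_pdivlMr// -exprMn -[wv v ^+ 2]real_normK ?num_real// lerXn2r ?nnegrE ?mulr_ge0//.
  exact: ltW.
pose A := th *: (T *m T^T) + (mu * fro2 T + nu)%:M.
have sA : A^T = A by rewrite /A linearD /= tr_scalar_mx linearZ /= tr_gram.
have Ei v (B : 'M[R]_(a, b)) : mx_inner B (atom v) = B (jv v) (kv v).
  rewrite mx_innerE (bigD1 (jv v))//= [X in _ + X]big1 ?addr0 => [|i ii].
    rewrite (bigD1 (kv v))//= [X in _ + X]big1 ?addr0 => [|k kk]; rewrite !mxE ?eqxx ?mulr1//.
    by rewrite (negPf kk) andbF mulr0.
  by rewrite big1// => k _; rewrite !mxE (negPf ii) mulr0.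
have expo v : th *: ((T + yv v *: atom v) *m (T + yv v *: atom v)^T) +
      (mu * fro2 (T + yv v *: atom v) + nu)%:M = A + Q v.
  have -> : fro2 (T + yv v *: atom v) = fro2 T + 2 * yv v * wv v + yv v ^+ 2.
    rewrite fro2D mx_innerZr fro2Z.
    by rewrite /fro2 !Ei !mxE !eqxx mulr1 -/(wv v); ring.
  rewrite /A /Q /incr /cross -/(wv v).
  have -> : (T + yv v *: atom v) *m (T + yv v *: atom v)^T =
     T *m T^T + (yv v *: (T *m (atom v)^T + atom v *m T^T) + yv v ^+ 2 *: (atom v *m (atom v)^T)).
    rewrite linearD /= linearZ /= mulmxDl !mulmxDr -!scalemxAl -!scalemxAr scalerA -expr2.
    by rewrite scalerDr !addrA.
  apply/matrixP => i j; move: (T *m T^T) (T *m (atom v)^T + atom v *m T^T) (atom v *m (atom v)^T) => Z1 Z2 Z3.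
  by rewrite !mxE; case: (i == j); rewrite /= ?mulr1n ?mulr0n; ring.
under eq_bigr do rewrite expo.
pose G := \sum_v p v *: (Q v + g v *: (Q v *m Q v)).
have sG : G^T = G.
  rewrite /G linear_sum /=; apply: eq_bigr => v _; rewrite linearZ /= linearD /= linearZ /=.
  by rewrite trmx_mul sQ.
apply: le_trans (tr_mexp_mean sA sG sQ p_ge0 _) _.
  move=> x; rewrite qfD qf_scalar mul1r /G !qf_sum -[sqn x]mul1r -(sum_p a0 b0 marg) mulr_suml -big_split.
  apply: ler_sum => v _; rewrite !qfZ /= -mulrDr ler_wpM2l// qfD.
  have wl := sqn_wcol_le v sgg Ts.
  suff : lef (mexp (Q v)) (1%:M + Q v + g v *: (Q v *m Q v)).
    by move=> /(_ x); rewrite qfD qfD qf_scalar mul1r -addrA.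
  rewrite /g; case: ifPn => hw.
    apply: (mexp_quad (sQ v) _ H1) => z.
    apply: (le_trans (qf_incr_le th0 mu0 z sgg wl hw)).
    by rewrite ler_wpM2r ?sqn_ge0.
  apply: (mexp_quad (sQ v) _ H2) => z.
  have hw' : `|wv v| <= sg.
    rewrite -(@ler_pXn2r _ 2) ?nnegrE// real_normK ?num_real//; apply: le_trans wl.
    by have := sqr_coord_le (wcol T v) (jv v); rewrite /wcol !mxE.
  apply: (le_trans (qf_incr_le th0 mu0 z sgg wl hw')).
  by rewrite ler_wpM2r ?sqn_ge0.
apply: tr_mexp_le.
- by rewrite linearD /= sA sG.
- by rewrite linearD /= tr_scalar_mx linearZ /= tr_gram.
move=> x; rewrite qfD [leRHS]qfD qfZ qf_mulT qf_scalar.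
rewrite /A qfD qfZ qf_mulT qf_scalar.
set X := sqn x; have X0 : 0 <= X by exact: sqn_ge0.
have QQ : qf G x <= \sum_v p v * qf (Q v) x + \sum_v p v * (g v * qf (Q v *m Q v) x).
  by rewrite /G qf_sum -big_split le_eqVlt; apply/orP; left; apply/eqP; apply: eq_bigr => v _; rewrite qfZ qfD qfZ mulrDr.
set sT := sqn (x *m T); set FT := fro2 T.
have sT0 : 0 <= sT by exact: sqn_ge0.
have FT0 : 0 <= FT by exact: fro2_ge0.
pose KK v := qf (cross T v *m cross T v) x.
have KK0 v : 0 <= KK v.
  rewrite /KK -{2}(tr_cross T v) qf_mulT; exact: sqn_ge0.
(* The factors 11/10 and 11 are 1 + e and 1 + 1/e for e = 1/10. *)
have L2 : \sum_v p v * (g v * qf (Q v *m Q v) x) <=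
   g1 * (11 / 10) * th ^+ 2 * (N^-1 * ((a%:R + 2) * sT + X * FT)) +
   ga / sg ^+ 2 * (11 / 10) * th ^+ 2 * (N^-1 * (4 * sg ^+ 2 * sg ^+ 2 * X)) +
   g2 * 11 * (5 / 4 * th ^+ 2 * (X / a%:R) + 40 * mu ^+ 2 * (FT / N) * X + 10 * mu ^+ 2 * X).
  rewrite -(sum_cross_sq T x).
  have h2 : ga / sg ^+ 2 * (11 / 10) * th ^+ 2 * (\sum_v p v * (wv v ^+ 2 * KK v)) <=
      ga / sg ^+ 2 * (11 / 10) * th ^+ 2 * (N^-1 * (4 * sg ^+ 2 * sg ^+ 2 * X)).
    rewrite ler_wpM2l; [by []| |exact: sum_cross_sq_weighted].
    by rewrite !mulr_ge0 ?sqr_ge0// ?invr_ge0 ?(ltW s20)//; lra.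
  apply: le_trans (lerD (lerD (lexx _) h2) (lexx _)).
  rewrite -(sum_rest T th mu x) !mulr_sumr -!big_split /=; apply: ler_sum => v _.
  rewrite -/(KK v) -/(wv v).
  set rest := 5 / 4 * th ^+ 2 * _ + _.
  have rest0 : 0 <= rest.
    have w2 : 0 <= wv v ^+ 2 by exact: sqr_ge0.
    have r1 : 0 <= th ^+ 2 * x 0 (jv v) ^+ 2 by apply: mulr_ge0; exact: sqr_ge0.
    have r2 : 0 <= mu ^+ 2 * (8 * wv v ^+ 2 + 2) * X.
      by apply: mulr_ge0 => //; apply: mulr_ge0; [exact: sqr_ge0|lra].
    rewrite /rest -/X; lra.
  have h3 : qf (Q v *m Q v) x <= (11 / 10) * (th ^+ 2 * KK v) + 11 * rest.
    have e0 : 0 < (1 / 10 : R) by lra.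
    have := qf_incr_sq_le T th mu v x e0.
    have -> : (1 / 10 : R)^-1 = 10 by rewrite invfM invr1 mul1r invrK.
    rewrite -/(Q v) -/(KK v) -/(wv v) -/X -/rest => /le_trans; apply.
    lra.
  have h4 : g v * (11 / 10 * (th ^+ 2 * KK v)) <= (g1 + ga / sg ^+ 2 * wv v ^+ 2) * (11 / 10 * (th ^+ 2 * KK v)).
    by rewrite ler_wpM2r// !mulr_ge0 ?sqr_ge0//; lra.
  have h5 : g v * (11 * rest) <= g2 * (11 * rest) by rewrite ler_wpM2r// mulr_ge0.
  have h6 := ler_wpM2l (g0 v) h3.
  have h7 : p v * (g v * qf (Q v *m Q v) x) <= p v * ((g1 + ga / sg ^+ 2 * wv v ^+ 2) * (11 / 10 * (th ^+ 2 * KK v)) + g2 * (11 * rest)).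
    rewrite ler_wpM2l//; lra.
  apply: (le_trans h7); rewrite le_eqVlt; apply/orP; left; apply/eqP; ring.
have y2v v : yv v ^+ 2 <= 1 by rewrite -real_normK ?num_real// expr_le1.
have L1 : \sum_v p v * qf (Q v) x <= th * (2 * dotv (x *m T) (x *m E0) + X * a%:R^-1) +
    mu * (2 * mx_inner T E0 + 1) * X.
  have e1 : \sum_v p v * (yv v * qf (cross T v) x) = 2 * dotv (x *m T) (x *m E0).
    rewrite dotvE mulr_sumr.
    transitivity (\sum_v \sum_k 2 * ((x *m T) 0 k * (p v * yv v * (x *m atom v) 0 k))).
      apply: eq_bigr => v _; rewrite qf_cross (bigD1 (kv v))//= big1 ?addr0 => [|k kk].
        by rewrite mul_atom !mxE !eqxx /=; ring.
      by rewrite mul_atom !mxE (negPf kk) andbF !mulr0.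
    rewrite exchange_big /=; apply: eq_bigr => k _.
    rewrite -!mulr_sumr; congr (_ * (_ * _)).
    rewrite /mean_step mulmx_sumr summxE; apply: eq_bigr => v _.
    by rewrite -!scalemxAr !mxE; ring.
  have e2 : \sum_v p v * (yv v * wv v) = mx_inner T E0.
    rewrite mx_innerC /mx_inner /mean_step linear_sum mulmx_suml linear_sum /=; apply: eq_bigr => v _.
    by rewrite !linearZ /= -!scalemxAl !linearZ /= -/(mx_inner _ T) mx_innerC Ei.
  have e3 : \sum_v p v * (yv v ^+ 2 * x 0 (jv v) ^+ 2) <= X * a%:R^-1.
    apply: (@le_trans _ _ (\sum_v p v * x 0 (jv v) ^+ 2)).
      by apply: ler_sum => v _; rewrite ler_wpM2l// ler_piMl ?sqr_ge0.
    rewrite (sum_uniform' (fun j k => x 0 j ^+ 2)).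
    have -> : \sum_(j < a) \sum_(k < b) x 0 j ^+ 2 = b%:R * X.
      by rewrite /X sqnE mulr_sumr; apply: eq_bigr => j _; rewrite sumr_const card_ord mulr_natl.
    by rewrite natrM le_eqVlt; apply/orP; left; apply/eqP; field; rewrite !gt_eqF.
  have e4 : \sum_v p v * yv v ^+ 2 <= 1.
    rewrite -[leRHS](sum_p a0 b0 marg); apply: ler_sum => v _.
    by rewrite ler_piMr.
  have -> : \sum_v p v * qf (Q v) x = th * (\sum_v p v * (yv v * qf (cross T v) x) + \sum_v p v * (yv v ^+ 2 * x 0 (jv v) ^+ 2))
     + mu * (2 * (\sum_v p v * (yv v * wv v)) + \sum_v p v * yv v ^+ 2) * X.
    rewrite mulrDr !mulr_sumr -!big_split /= !mulr_sumr mulr_suml -!big_split /=; apply: eq_bigr => v _.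
    by rewrite /Q qf_incr -/X -/(wv v); ring.
  rewrite e1 e2; apply: lerD; first by rewrite ler_wpM2l// lerD2l.
  by rewrite ler_wpM2r// ler_wpM2l// lerD2l.
set D := dotv (x *m T) (x *m E0) in L1; set I := mx_inner T E0 in L1.
have sWE : sqn (x *m W) = sT + 2 * D + sqn (x *m E0) by rewrite /W mulmxDr sqnD.
have FWE : fro2 W = FT + 2 * I + fro2 E0 by rewrite /W fro2D.
have E01 := fro2_mean_step.
have sE0 := sqn_ge0 (x *m E0); have FE0 := fro2_ge0 E0.
have sE1 : sqn (x *m E0) <= N^-1 * X.
  by apply: (le_trans (sqn_mul_fro2 E0 x)); rewrite ler_wpM2r.
(* The second moments are computed at [T] but wanted at W = T + E0. Splitting with weight 1/100
   costs the factor 101/100, and 101 on terms controlled by |E0|^2 <= 1/N. *)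
have e0 : 0 < (1 / 100 : R) by lra.
have ei : (1 / 100 : R)^-1 = 100 by rewrite invfM invr1 mul1r invrK.
have sT1 : sT <= 101 / 100 * sqn (x *m W) + 101 * (N^-1 * X).
  have := sqnD_le (x *m W) (- (x *m E0)) e0; rewrite ei.
  have -> : x *m W - x *m E0 = x *m T by rewrite /W mulmxDr addrK.
  have -> : sqn (- (x *m E0)) = sqn (x *m E0) by rewrite -scaleN1r sqnZ sqrrN expr1n mul1r.
  rewrite -/sT; lra.
have FT1 : FT <= 101 / 100 * fro2 W + 101 * N^-1.
  have := fro2D_le W (- E0) e0; rewrite ei fro2N.
  have -> : W - E0 = T by rewrite /W addrK.
  rewrite -/FT; lra.
have sW0 := sqn_ge0 (x *m W); have FW0 := fro2_ge0 W.
set sW := sqn (x *m W) in sWE sT1 sW0 *; set FW := fro2 W in FWE FT1 FW0 *.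
have iN0 : 0 < N^-1 by rewrite invr_gt0.
set iN := N^-1 in L2 TH MU NU sT1 FT1 iN0 E01 sE1 *.
set ia := a%:R^-1 in L1 L2 TH MU NU *.
have an0 : 0 <= a%:R :> R by rewrite ler0n.
set an := a%:R in L2 TH NU an0 *.
set c1 := g1 * (11 / 10) * th ^+ 2 in L2 TH MU NU.
have c10 : 0 <= c1 by rewrite !mulr_ge0 ?sqr_ge0//; lra.
have sg2 : ga / sg ^+ 2 * (11 / 10) * th ^+ 2 * (iN * (4 * sg ^+ 2 * sg ^+ 2 * X)) =
   ga * (11 / 10) * 4 * sg ^+ 2 * th ^+ 2 * iN * X by field; rewrite gt_eqF.
rewrite sg2 in L2.
have p1 : c1 * (iN * ((an + 2) * sT + X * FT)) <= c1 * (iN * ((an + 2) * (101 / 100 * sW + 101 * (iN * X)) + X * (101 / 100 * FW + 101 * iN))).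
  rewrite ler_wpM2l// ler_wpM2l ?(ltW iN0)// lerD ?ler_wpM2l//; lra.
have p2 : g2 * 11 * (40 * mu ^+ 2 * (FT * iN) * X) <= g2 * 11 * (40 * mu ^+ 2 * ((101 / 100 * FW + 101 * iN) * iN) * X).
  rewrite ler_wpM2l ?mulr_ge0// ler_wpM2r// ler_wpM2l ?mulr_ge0 ?sqr_ge0//.
  by rewrite ler_wpM2r// ltW.
have q1 := ler_wpM2r sW0 TH.
have q2 := ler_wpM2r (mulr_ge0 FW0 X0) MU.
have q3 := ler_wpM2r X0 NU.
(* The drift 2 <xT, xE0> is what turns |xT|^2 into |xW|^2, up to the discarded |xE0|^2, so
   recentring costs nothing at first order. *)
have q4 : th * (sT + 2 * D) <= th * sW by rewrite ler_wpM2l// sWE lerDl.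
have q5 : mu * (FT + 2 * I) * X <= mu * FW * X by rewrite ler_wpM2r// ler_wpM2l// FWE lerDl.
lra.
Qed.

End Second_order_step.

(** The arithmetic behind the constant 39/50 of [nuk]. [iA], [iB], [iN] stand for 1/a, 1/b, 1/(ab),
    so iA/de is 1/n, the unit [w] of the proof. The sg^2 term contributes at most 0.37 units and the
    t^2/a term about 0.4. *)
Lemma schedule_error_le (R : realType) (t m de s L an iA iB : R) (sg := s + 1 / 20) (iN := iA * iB) :
  0 < t -> 0 <= m -> 30 <= de -> 30 <= s -> t * de <= 912 / 1000 -> s ^+ 2 = 4 * de * L ->
  0 < iA -> 0 < iB -> an * iA = 1 -> 1 <= an -> iA <= 1 -> iB <= iA -> iB * 600 <= 1 -> 80 * L * iB <= 1 ->
  m <= 1 / 2 * (t * iB) ->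
  4 / 5 * (11 / 10) * t ^+ 2 * (an + 3) * 101 * iN ^+ 2 +
     49 / 25 * (11 / 10) * 4 * sg ^+ 2 * t ^+ 2 * iN +
     26 / 25 * 11 * (5 / 4 * t ^+ 2 * iA + 10 * m ^+ 2 + 40 * m ^+ 2 * 101 * iN ^+ 2) <= 39 / 50 * (iA * de^-1).
Proof.
move=> t0 m0 de30 s30 tde s2 iA0 iB0 AiA an1 iA1 AB iB600 LiB ml.
have de0 : 0 < de by clear - de30; lra.
pose id := de^-1; have id0 : 0 < id by rewrite invr_gt0.
have did : de * id = 1 by rewrite mulfV ?gt_eqF.
have id30 : id * 30 <= 1.
  have h : 0 <= de - 30 by clear - de30; lra.
  by have := mulr_ge0 h (ltW id0); clear - did; lra.
have iN0 : 0 < iN by rewrite mulr_gt0.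
have iNE : iN = iA * iB by [].
pose u := t * de; have tE : t = u * id by rewrite /u -mulrA did mulr1.
have u0 : 0 <= u := mulr_ge0 (ltW t0) (ltW de0).
have u2 : u ^+ 2 <= 832 / 1000.
  by have := ler_pM u0 u0 tde tde; rewrite -/u expr2; clear; lra.
have uu0 : 0 <= u ^+ 2 by exact: sqr_ge0.
pose w := iA * id; have w0 : 0 < w by rewrite mulr_gt0.
have id30' : id <= 1 / 30 by clear - id30; lra.
have iB600' : iB <= 1 / 600 by clear - iB600; lra.
have iA0' := ltW iA0; have iB0' := ltW iB0; have id0' := ltW id0; have w0' := ltW w0.
have idB0 : 0 <= id * iB := mulr_ge0 id0' iB0'.
have a3 : 0 <= (an + 3) * iA by apply: mulr_ge0 => //; clear - an1; lra.
have idB : id * iB <= 1 / 30 * (1 / 600) := ler_pM id0' iB0' id30' iB600'.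
have E1 : 4 / 5 * (11 / 10) * t ^+ 2 * (an + 3) * 101 * iN ^+ 2 <= 1 / 1000 * w.
  have -> : 4 / 5 * (11 / 10) * t ^+ 2 * (an + 3) * 101 * iN ^+ 2 =
     4 / 5 * (11 / 10) * 101 * (u ^+ 2 * ((an + 3) * iA) * (id * iB * iB)) * w.
    by rewrite tE iNE /w; ring.
  apply: (ler_wpM2r w0').
  have q1 : (an + 3) * iA <= 4 by rewrite mulrDl AiA; clear - iA1; lra.
  have q2 := ler_pM uu0 a3 u2 q1.
  have q4 := ler_pM idB0 iB0' idB iB600'.
  have q5 := ler_pM (mulr_ge0 uu0 a3) (mulr_ge0 idB0 iB0') q2 q4.
  by clear - q5; lra.
have E2 : 49 / 25 * (11 / 10) * 4 * sg ^+ 2 * t ^+ 2 * iN <= 37 / 100 * w.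
  have sg2 : sg ^+ 2 <= 405 / 100 * de * L.
    have h : 0 <= (s - 30) * s by apply: mulr_ge0; clear - s30; lra.
    by have := s2; rewrite /sg; clear - h s30; lra.
  have q1 : sg ^+ 2 * id <= 405 / 100 * L.
    have := ler_wpM2r (ltW id0) sg2.
    have -> : 405 / 100 * de * L * id = 405 / 100 * L * (de * id) by ring.
    by rewrite did mulr1.
  have -> : 49 / 25 * (11 / 10) * 4 * sg ^+ 2 * t ^+ 2 * iN =
     49 / 25 * (11 / 10) * 4 * ((sg ^+ 2 * id * iB) * u ^+ 2) * w by rewrite tE iNE /w; ring.
  apply: (ler_wpM2r w0').
  have q2 : sg ^+ 2 * id * iB <= 405 / 100 * (1 / 80).
    by have := ler_wpM2r (ltW iB0) q1; clear - LiB; lra.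
  have q0 : 0 <= sg ^+ 2 * id * iB := mulr_ge0 (mulr_ge0 (sqr_ge0 _) id0') iB0'.
  have q3 := ler_pM q0 uu0 q2 u2.
  by clear - q3; lra.
have h12 : 0 <= 1 / 2 * (u * id * iB).
  by have := mulr_ge0 (mulr_ge0 u0 id0') iB0'; clear; lra.
have m2 : m ^+ 2 <= 1 / 4 * (u ^+ 2 * (id * iB)) * (iB * id).
  have h : m <= 1 / 2 * (u * id * iB) by rewrite -tE.
  by have := ler_pM m0 m0 h h; clear; lra.
have m3 : m ^+ 2 <= 1 / 10000 * w.
  apply: (le_trans m2).
  have q0 : iB * id <= w := ler_wpM2r id0' AB.
  have q2 := ler_pM uu0 idB0 u2 idB.
  have q3 := ler_wpM2r (mulr_ge0 iB0' id0') q2.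
  have q4 : 0 <= iB * id := mulr_ge0 iB0' id0'.
  by clear - q0 q3 q4; lra.
have E4 : 40 * m ^+ 2 * 101 * iN ^+ 2 <= 40 * 101 / 600 / 600 * m ^+ 2.
  have iN600 := ler_pM iA0' iB0' iA1 iB600'; rewrite -iNE in iN600.
  have iN0' := ltW iN0.
  have := ler_wpM2l (sqr_ge0 m) (ler_pM iN0' iN0' iN600 iN600); clear; lra.
have E3 : 5 / 4 * t ^+ 2 * iA <= 347 / 10000 * w.
  have -> : 5 / 4 * t ^+ 2 * iA = 5 / 4 * (u ^+ 2 * id) * w by rewrite tE /w; ring.
  apply: (ler_wpM2r w0').
  by have := ler_pM uu0 id0' u2 id30'; clear; lra.
have ww : 39 / 50 * (iA * id) = 39 / 50 * w by [].
have m20 : 0 <= m ^+ 2 by exact: sqr_ge0.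
by rewrite ww; clear - E1 E2 E3 E4 m3 m20; lra.
Qed.

(** * Schedule of the parameters and the tail bound in large dimension *)

Section Second_order_tail.
Context {R : realType} {V : finType} {a b : nat}.
Variables (p : V -> R) (jv : V -> 'I_a) (kv : V -> 'I_b) (yv : V -> R).
Hypotheses (a0 : (0 < a)%N) (b0 : (0 < b)%N) (p_ge0 : forall v, 0 <= p v)
  (marg : forall (j : 'I_a) (k : 'I_b), \sum_(v | (jv v == j) && (kv v == k)) p v = (a * b)%:R^-1)
  (y_le1 : forall v, `|yv v| <= 1).

(** This and the next lemma are the endpoint checks for [expR_quad_le]. The argument is halved to
    enter [0, 1], where the Taylor bound holds, and the result is squared. *)
Lemma expR_bound_1265 : expR (253 / 200 : R) <= 1 + 253 / 200 + 4 / 5 * (253 / 200) ^+ 2.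
Proof.
have -> : 253 / 200 = 253 / 400 + 253 / 400 :> R by lra.
have := @expR_le_taylor5 R (253 / 400) _; rewrite expRD => /(_ ltac:(apply/andP; split; lra)).
set e := expR _ => H; have e0 : 0 <= e by exact: expR_ge0.
have H2 : e <= 753 / 400 by lra.
have : e * e <= 753 / 400 * (753 / 400) by apply: ler_pM.
lra.
Qed.

Lemma expR_bound_186 : expR (93 / 50 : R) <= 1 + 93 / 50 + 26 / 25 * (93 / 50) ^+ 2.
Proof.
have -> : 93 / 50 = 93 / 100 + 93 / 100 :> R by lra.
have := @expR_le_taylor5 R (93 / 100) _; rewrite expRD => /(_ ltac:(apply/andP; split; lra)).
set e := expR _ => H; have e0 : 0 <= e by exact: expR_ge0.
have H2 : e <= 2535 / 1000 by lra.
have : e * e <= 2535 / 1000 * (2535 / 1000) by apply: ler_pM.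
lra.
Qed.

Lemma expR_bound_17 : expR (17 / 10 : R) <= 6.
Proof.
have -> : 17 / 10 = 85 / 100 + 85 / 100 :> R by lra.
have := @expR_le_taylor5 R (85 / 100) _; rewrite expRD => /(_ ltac:(apply/andP; split; lra)).
set e := expR _ => H; have e0 : 0 <= e by exact: expR_ge0.
have H2 : e <= 24 / 10 by lra.
have : e * e <= 24 / 10 * (24 / 10) by apply: ler_pM.
lra.
Qed.

(** In use e^L = a + b <= 2b, so this yields b >= 80 L and b >= 600. *)
Lemma expR_ge_160 (L : R) : 15 / 2 <= L -> 160 * L <= expR L.
Proof.
move=> L7.
have e1 := @expR_ge_taylor3 R (3 / 2) ltac:(lra).
have e2 : 1200 <= expR (15 / 2 : R).
  have -> : 15 / 2 = 5%:R * (3 / 2) :> R by lra.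
  rewrite expRM_natl; apply: (@le_trans _ _ ((67 / 16) ^+ 5)); first by lra.
  by apply: lerXn2r; rewrite ?nnegrE ?expR_ge0//; lra.
have H := expR_ge1Dx (L - 15 / 2).
have E : expR L = expR (15 / 2) * expR (L - 15 / 2) by rewrite -expRD addrC subrK.
have u0 : 0 <= expR (L - 15 / 2) by exact: expR_ge0.
have := ler_wpM2r u0 e2; rewrite -E; lra.
Qed.

Lemma opbD m1 m2 (A B : 'M[R]_(m1, m2)) s t : 0 <= s -> 0 <= t -> opb A s -> opb B t -> opb (A + B) (s + t).
Proof.
move=> s0 t0 As Bt x; rewrite mulmxDr sqnD.
have X0 := sqn_ge0 x; pose r := Num.sqrt (sqn x).
have r2 : r ^+ 2 = sqn x by rewrite sqr_sqrtr.
have r0 : 0 <= r by exact: sqrtr_ge0.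
have := @dotv_le _ _ (x *m A) (x *m B) (s * r) (t * r) (mulr_ge0 s0 r0) (mulr_ge0 t0 r0).
rewrite !exprMn r2 => /(_ (As x) (Bt x)).
have := As x; have := Bt x; rewrite -r2; lra.
Qed.

Lemma sqn0 m : sqn (0 : 'rV[R]_m) = 0.
Proof. by apply/eqP; rewrite sqn_eq0. Qed.

Lemma not_op_ge m1 m2 (W : 'M[R]_(m1, m2)) s : ~~ op_ge s W -> opb W s.
Proof.
move=> /asboolPn H x; have [->|x0] := eqVneq x 0; first by rewrite mul0mx !sqn0 mulr0.
have X0 : 0 < sqn x by rewrite lt_neqAle eq_sym sqn_eq0 x0 sqn_ge0.
rewrite leNgt; apply/negP => h; apply: H.
exists ((Num.sqrt (sqn x))^-1 *: x); rewrite -scalemxAl !sqnZ exprVn sqr_sqrtr ?sqn_ge0//.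
rewrite mulVf ?gt_eqF//; split=> //.
by rewrite mulrC ler_pdivlMr// ltW.
Qed.

Section Schedule.
Variables (n : nat) (de : R).
Hypotheses (n0 : (0 < n)%N) (deE : de = n%:R / a%:R) (b600 : 600 <= (b%:R : R)) (ab : (a <= b)%N).

Let A0 : 0 < a%:R :> R. Proof. by rewrite ltr0n. Qed.
Let B0 : 0 < b%:R :> R. Proof. by rewrite ltr0n. Qed.
Let n0' : 0 < n%:R :> R. Proof. by rewrite ltr0n. Qed.
Let de0 : 0 < de. Proof. by rewrite deE divr_gt0. Qed.
Let nE : n%:R = a%:R * de. Proof. by rewrite deE mulrC divfK// gt_eqF. Qed.
Let A1 : 1 <= a%:R :> R. Proof. by rewrite ler1n. Qed.

(* The Riccati recursion th' = th + rate * th * th', solved explicitly. *)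
Definition rate : R := 9 / 10 * (a%:R + 2) / (a%:R * b%:R).
Definition theta (k : nat) : R := (2 * de - k%:R * rate)^-1.

Let rate0 : 0 < rate.
Proof. by rewrite /rate divr_gt0 ?mulr_gt0//; lra. Qed.

Lemma n_rate : n%:R * rate <= 903 / 1000 * de.
Proof.
have -> : n%:R * rate = 9 / 10 * de * ((a%:R + 2) / b%:R) by rewrite /rate nE; field; rewrite !gt_eqF.
have : (a%:R + 2) / b%:R <= 1 + 1 / 300 :> R.
  have h : (a%:R : R) <= b%:R by rewrite ler_nat.
  by rewrite ler_pdivrMr//; have := b600; lra.
move=> /(ler_wpM2l (ltW de0)); lra.
Qed.

Lemma theta_den k : (k <= n)%N -> 1097 / 1000 * de <= 2 * de - k%:R * rate.
Proof.
move=> kn; have := n_rate; have : k%:R * rate <= n%:R * rate by rewrite ler_wpM2r ?(ltW rate0)// ler_nat.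
lra.
Qed.

Lemma theta_den_gt0 k : (k <= n)%N -> 0 < 2 * de - k%:R * rate.
Proof. by move=> /theta_den; have := de0; lra. Qed.

Lemma theta_gt0 k : (k <= n)%N -> 0 < theta k.
Proof. by move=> /theta_den_gt0; rewrite /theta invr_gt0. Qed.

Lemma theta_de k : (k <= n)%N -> theta k * de <= 912 / 1000.
Proof.
move=> kn; have D0 := theta_den_gt0 kn.
by rewrite /theta mulrC ler_pdivrMr; [have := theta_den kn; lra|].
Qed.

(** The index counts the steps still to come, so this is the last parameter of the walk: at the
    threshold s = 2 sqrt(de L) it gives theta_0 s^2 = 2 L, which offsets the prefactor e^(-2L). *)
Lemma theta0 : theta 0 = (2 * de)^-1.
Proof. by rewrite /theta mul0r subr0. Qed.

Lemma theta_sub k l : (k <= n)%N -> (l <= n)%N ->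
  theta l - theta k = (l%:R - k%:R) * rate * theta k * theta l.
Proof. by move=> /theta_den_gt0 h1 /theta_den_gt0 h2; rewrite /theta; field; rewrite !gt_eqF. Qed.

Lemma theta_mono k l : (k <= l)%N -> (l <= n)%N -> theta k <= theta l.
Proof.
move=> kl ln; have kn := leq_trans kl ln.
rewrite -subr_ge0 theta_sub// !mulr_ge0 ?(ltW (theta_gt0 _)) ?(ltW rate0)//.
by rewrite subr_ge0 ler_nat.
Qed.

(** By [sum_cross_sq] the growth that |W|^2 requires is that of theta divided by a + 2. *)
Definition muk k : R := (theta k - theta 0) / (a%:R + 2).

Lemma muk_ge0 k : (k <= n)%N -> 0 <= muk k.
Proof. by move=> kn; rewrite /muk divr_ge0 ?subr_ge0 ?theta_mono//; lra. Qed.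

Lemma muk_le k : (k <= n)%N -> muk k <= theta k / (2 * b%:R).
Proof.
move=> kn; have t0 := theta_gt0 kn.
have -> : muk k = (k%:R / n%:R) * (9 / 20 * theta k / b%:R).
  rewrite /muk theta_sub// theta0 subr0 /rate nE; field.
  by rewrite !gt_eqF//; lra.
have h : k%:R / n%:R <= 1 :> R by rewrite ler_pdivrMr// mul1r ler_nat.
apply: (@le_trans _ _ (1 * (9 / 20 * theta k / b%:R))).
  by rewrite ler_wpM2r// divr_ge0 ?(ltW B0)// mulr_ge0 ?(ltW t0)//; lra.
have -> : theta k / (2 * b%:R) = 1 / 2 * (theta k / b%:R) by field; rewrite gt_eqF.
have : 0 < theta k / b%:R by rewrite divr_gt0.
lra.
Qed.

Definition gap : R := theta n - theta 0.
(** It must grow by theta_k/a + mu_k plus errors of 39/50 in total. The increment 2k + 1 of k^2 pays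
    the chord bound of theta_k - theta_0 twice, once for theta_k and once for mu_k <= (theta_k -
    theta_0)/a. *)
Definition nuk k : R := k%:R * (theta 0 / a%:R) + k%:R ^+ 2 * (gap / (n%:R * a%:R)) + k%:R * (39 / 50 / n%:R).

Lemma nuk_n : nuk n <= 17 / 10.
Proof.
have -> : nuk n = theta n * de + 39 / 50.
  by rewrite /nuk /gap deE; field; rewrite !gt_eqF.
have := theta_de (leqnn n); lra.
Qed.

Lemma theta_chord k : (k <= n)%N -> theta k - theta 0 <= k%:R / n%:R * gap.
Proof.
move=> kn; rewrite /gap !theta_sub// !subr0.
have -> : k%:R / n%:R * (n%:R * rate * theta 0 * theta n) = k%:R * rate * theta 0 * theta n by field; rewrite gt_eqF.
rewrite ler_wpM2l ?theta_mono// !mulr_ge0 ?(ltW rate0) ?(ltW (theta_gt0 _))//.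
Qed.

Lemma gap_ge0 : 0 <= gap.
Proof. by rewrite subr_ge0 theta_mono. Qed.

Section Step.
Variables (k : nat) (s L : R).
Hypotheses (kn : (k < n)%N) (de30 : 30 <= de) (s30 : 30 <= s) (sde : s <= de)
  (s2 : s ^+ 2 = 4 * de * L) (L0 : 0 <= L) (Lb : 80 * L <= b%:R).
Let sg : R := s + 1 / 20.
Let t := theta k.
Let t' := theta k.+1.
Let m := muk k.
Let kn' : (k <= n)%N. Proof. exact: ltnW. Qed.
Let t0 : 0 < t. Proof. exact: theta_gt0. Qed.
Let m0 : 0 <= m. Proof. exact: muk_ge0. Qed.
Let tt : t <= t'. Proof. exact: theta_mono. Qed.
Let tde : t * de <= 912 / 1000. Proof. exact: theta_de. Qed.
Let m1000 : m <= t / 1000.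
Proof.
apply: (le_trans (muk_le kn')); rewrite -/t ler_pdivrMr; last by rewrite mulr_gt0.
have b6 : 0 <= (b%:R : R) - 600 by have := b600; lra.
have := mulr_ge0 (ltW t0) b6; have := t0; lra.
Qed.
Let iN : R := (a * b)%:R^-1.
Let iA : R := a%:R^-1.
Let iB : R := b%:R^-1.
Let iNE : iN = iA * iB. Proof. by rewrite /iN natrM invfM. Qed.
Let iA0 : 0 < iA. Proof. by rewrite invr_gt0. Qed.
Let iB0 : 0 < iB. Proof. by rewrite invr_gt0. Qed.
Let iN0 : 0 < iN. Proof. by rewrite iNE mulr_gt0. Qed.
Let tsub : t' - t = 9 / 10 * (a%:R + 2) * iN * (t * t').
Proof.
rewrite /t' /t theta_sub// -natr1 /rate /iN natrM; field.
by rewrite !gt_eqF.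
Qed.

(** As t s <= t de <= 0.912, the main term is 1.35 times 0.912; in [step_X2] it is twice 0.912. Both
    stay under the points where exp was checked, with room for the lower-order terms. *)
Lemma step_X1 : t * (sg + 7 / 20 * sg + 1) + m * (2 * (7 / 20 * sg) + 1) <= 253 / 200.
Proof.
have h1 : t * s <= t * de by rewrite ler_wpM2l// ltW.
have h2 : t * 30 <= t * de by rewrite ler_wpM2l// ltW.
have h3 : m * (2 * (7 / 20 * sg) + 1) <= t / 1000 * (2 * (7 / 20 * sg) + 1).
  by rewrite ler_wpM2r// /sg; have := s30; lra.
rewrite /sg in h3 *; have := tde; lra.
Qed.

Lemma step_X2 : t * (sg + sg + 1) + m * (2 * sg + 1) <= 93 / 50.
Proof.
have h1 : t * s <= t * de by rewrite ler_wpM2l// ltW.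
have h2 : t * 30 <= t * de by rewrite ler_wpM2l// ltW.
have h3 : m * (2 * sg + 1) <= t / 1000 * (2 * sg + 1).
  by rewrite ler_wpM2r// /sg; have := s30; lra.
rewrite /sg in h3 *; have := tde; lra.
Qed.

Let ttt : t ^+ 2 <= t * t'.
Proof. by rewrite expr2 ler_pM2l. Qed.

(** 4/5 times 11/10 times 101/100 is 0.8888, below the 9/10 in [rate]; replacing t^2 by the larger t
    t' gives the recursion that is solved explicitly. *)
Lemma step_TH : t + 4 / 5 * (11 / 10) * t ^+ 2 * (101 / 100) * (a%:R + 2) * iN <= t'.
Proof.
have c0 : 0 <= (a%:R + 2) * iN by rewrite mulr_ge0 ?(ltW iN0)// addr_ge0 ?ler0n.
have h := ler_wpM2r c0 ttt; have := tsub.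
have : 0 <= t ^+ 2 * ((a%:R + 2) * iN) by rewrite mulr_ge0 ?sqr_ge0.
lra.
Qed.

Lemma step_MU : m + (4 / 5 * (11 / 10) * t ^+ 2 + 440 * (26 / 25) * m ^+ 2) * (101 / 100) * iN <= muk k.+1.
Proof.
have -> : muk k.+1 = m + 9 / 10 * iN * (t * t').
  have -> : 9 / 10 * iN * (t * t') = (t' - t) / (a%:R + 2).
    rewrite tsub; field; rewrite gt_eqF//; have := A1; lra.
  rewrite /m /muk -/t -/t'; field; rewrite gt_eqF//; have := A1; lra.
(* [muk] is so much smaller than [theta] that its square fits into the gap between 0.8888 and
   9/10. *)
have m2 : m <= t / 250 by have := m1000; have := t0; lra.
have t250 : 0 <= t / 250 by have := t0; lra.
have m3 : m ^+ 2 <= (t / 250) ^+ 2 := ler_pM m0 m0 m2 m2.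
have t2 : 0 <= t ^+ 2 by exact: sqr_ge0.
have h : 101 / 100 * (4 / 5 * (11 / 10) * t ^+ 2 + 440 * (26 / 25) * m ^+ 2) <= 9 / 10 * (t * t').
  have := ttt; lra.
have := ler_wpM2r (ltW iN0) h; lra.
Qed.

Lemma step_NU : nuk k + t * iA + m + 4 / 5 * (11 / 10) * t ^+ 2 * (a%:R + 3) * 101 * iN ^+ 2 +
     49 / 25 * (11 / 10) * 4 * sg ^+ 2 * t ^+ 2 * iN +
     26 / 25 * 11 * (5 / 4 * t ^+ 2 * iA + 10 * m ^+ 2 + 40 * m ^+ 2 * 101 * iN ^+ 2) <= nuk k.+1.
Proof.
pose id := de^-1; have id0 : 0 < id by rewrite invr_gt0.
have did : de * id = 1 by rewrite mulfV ?gt_eqF.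
have iA1 : iA <= 1 by rewrite invf_le1.
have AiA : a%:R * iA = 1 by rewrite mulfV ?gt_eqF.
have BiB : b%:R * iB = 1 by rewrite mulfV ?gt_eqF.
have iB600 : iB * 600 <= 1.
  have h : 0 <= (b%:R : R) - 600 by have := b600; lra.
  by have := mulr_ge0 h (ltW iB0); lra.
have LiB : 80 * L * iB <= 1.
  have h : 0 <= (b%:R : R) - 80 * L by have := Lb; lra.
  by have := mulr_ge0 h (ltW iB0); lra.
have inE : n%:R^-1 = iA * id by rewrite nE invfM.
have chord : t * iA + m + k%:R * (theta 0 * iA) + k%:R ^+ 2 * (gap * (n%:R^-1 * iA)) <=
   (k%:R + 1) * (theta 0 * iA) + (k%:R + 1) ^+ 2 * (gap * (n%:R^-1 * iA)).
  have h1 : t - theta 0 <= k%:R * n%:R^-1 * gap := theta_chord kn'.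
  have h2 : m <= (t - theta 0) * iA.
    rewrite /m /muk -/t ler_wpM2l//; first by rewrite subr_ge0 theta_mono.
    by rewrite lef_pV2 ?posrE ?addr_gt0// lerDl.
  have h3 : (t - theta 0) * iA <= k%:R * n%:R^-1 * gap * iA by rewrite ler_wpM2r// ltW.
  have h4 : 0 <= gap * (n%:R^-1 * iA) by rewrite !mulr_ge0 ?gap_ge0 ?invr_ge0 ?ler0n// ltW.
  by lra.
have nukE j : nuk j = j%:R * (theta 0 * iA) + j%:R ^+ 2 * (gap * (n%:R^-1 * iA)) + j%:R * (39 / 50 * (iA * id)).
  by rewrite /nuk inE invfM -inE.
rewrite !nukE -natr1.
have AB : iB <= iA by rewrite lef_pV2 ?posrE// ler_nat.
have ml : m <= 1 / 2 * (t * iB).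
  apply: (le_trans (muk_le kn')); rewrite -/t invfM /iB le_eqVlt; apply/orP; left; apply/eqP; field.
  by rewrite gt_eqF.
have := schedule_error_le t0 m0 de30 s30 tde s2 iA0 iB0 AiA A1 iA1 AB iB600 LiB ml.
rewrite -/sg -iNE -/id; lra.
Qed.

End Step.

End Schedule.

Lemma tr_mexp_scalar m (c : R) : \tr (mexp (c%:M : 'M[R]_m)) = m%:R * expR c.
Proof.
have [U [d s]] := sym_sdec (tr_scalar_mx m (1 : R)).
rewrite (sdec_trace (sdec_fc expR (sdec_scalar c s))).
by under eq_bigr do rewrite !mxE; rewrite sumr_const card_ord mulr_natl.
Qed.

(** With m = a + b, the potential at W = 0 is m^(-2) a e^(nu_n), where e^(nu_n) <= 6 and 2a <= m;
    this is at most 3/m. *)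
Theorem second_order_tail n (L : R) (de := n%:R / a%:R : R) :
  (a <= b)%N -> (0 < n)%N -> expR L = (a + b)%:R -> 15 / 2 <= L -> 4 * L <= de ->
  tail_prob p jv kv yv n (2 * Num.sqrt (de * L)) <= 3 / (a + b)%:R.
Proof.
move=> ab n0 eL L7 deL; set s := 2 * _.
have A0 : 0 < a%:R :> R by rewrite ltr0n.
have AB : (a%:R : R) <= b%:R by rewrite ler_nat.
have eL2 : expR L <= 2 * b%:R by rewrite eL natrD; lra.
have Lb : 80 * L <= b%:R by have := expR_ge_160 L7; lra.
have b600 : 600 <= (b%:R : R) by lra.
have de30 : 30 <= de by lra.
have L0 : 0 <= L by lra.
have deL0 : 0 <= de * L by apply: mulr_ge0 => //; lra.
have s2 : s ^+ 2 = 4 * de * L by rewrite /s exprMn sqr_sqrtr//; ring.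
have s0 : 0 <= s by rewrite /s mulr_ge0 ?sqrtr_ge0.
have s30 : 30 <= s.
  rewrite leNgt; apply/negP => h.
  have h1 : s * s <= 30 * 30 by apply: ler_pM => //; exact: ltW.
  have h2 : 4 * L * (4 * L) <= 4 * de * L.
    have := ler_wpM2r L0 deL; lra.
  have h3 : 30 * 30 <= 4 * L * (4 * L) by apply: ler_pM; lra.
  have h4 : s = 30.
    apply/eqP; rewrite eq_le (ltW h) /=; rewrite -(@ler_pXn2r _ 2) ?nnegrE//.
    by rewrite s2 expr2; apply: le_trans h2.
  by move: h; rewrite h4 ltxx.
have sde : s <= de.
  have dge : 0 <= de by lra.
  rewrite -(@ler_pXn2r _ 2) ?nnegrE// s2.
  have := ler_wpM2l dge deL; lra.
pose th := theta de; pose mu := muk de; pose nu := nuk n de.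
pose E k (W : 'M[R]_(a, b)) := th k *: (W *m W^T) + (mu k * fro2 W + nu k)%:M : 'M[R]_a.
(* Beyond n steps the potential is set to 1, so that the trivial alternative of [walk_bound] holds
   there. *)
pose Phi k W := if (k <= n)%N then expR (- (2 * L)) * \tr (mexp (E k W)) else 1 : R.
have sE k W : (E k W)^T = E k W.
  by rewrite /E linearD /= tr_scalar_mx linearZ /= tr_gram.
have tr0 (A : 'M[R]_a) : A^T = A -> 0 <= \tr (mexp A).
  move=> /sym_sdec[U [d sd]]; rewrite (sdec_trace (sdec_fc _ sd)).
  by apply: sumr_ge0 => i _; rewrite mxE expR_ge0.
have nu0 k : (k <= n)%N -> 0 <= nu k.
  move=> kn; have t0 := ltW (theta_gt0 n0 (erefl de) b600 ab (leq0n n)).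
  have g0 := gap_ge0 n0 (erefl de) b600 ab.
  have k0 : 0 <= k%:R :> R by rewrite ler0n.
  have an : 0 <= n%:R * a%:R :> R by rewrite mulr_ge0 ?ler0n.
  apply: addr_ge0; [apply: addr_ge0|]; apply: mulr_ge0 => //.
  - by apply: divr_ge0 => //; exact: ltW.
  - exact: divr_ge0.
have PhiS k W : (k <= n)%N -> op_ge s W -> 1 <= Phi k W.
  move=> kn /asboolP[x [x1 xs]]; rewrite /Phi kn.
  apply: le_trans (ler_wpM2l (expR_ge0 _) (tr_mexp_ge (sE k W) x1)).
  rewrite -expRD -[leLHS]expR0 ler_expR addrC subr_ge0 /E qfD qfZ qf_mulT qf_scalar x1 mulr1.
  apply: (@le_trans _ _ (th k * sqn (x *m W))); last first.
    rewrite lerDl addr_ge0 ?nu0// mulr_ge0 ?fro2_ge0//.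
    exact: (muk_ge0 n0 (erefl de) b600 ab).
  apply: (@le_trans _ _ (th 0%N * s ^+ 2)).
    rewrite /th theta0 s2.
    have aux (u v : R) : 0 < u -> (2 * u)^-1 * (4 * u * v) = 2 * v by move=> u0; field; rewrite gt_eqF.
    by rewrite aux//; lra.
  have t0 := theta_gt0 n0 (erefl de) b600 ab (leq0n n).
  have t0k := theta_mono n0 (erefl de) b600 ab (leq0n k) kn.
  by apply: ler_pM; rewrite ?sqr_ge0 ?(ltW t0).
have Phi0 W : 0 <= Phi 0%N W by rewrite /Phi leq0n mulr_ge0 ?expR_ge0 ?tr0.
pose Z v := yv v *: atom jv kv v - mean_step p jv kv yv.
have step k W : 1 <= Phi k.+1 W \/ \sum_v p v * Phi k (W + Z v) <= Phi k.+1 W.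
  case: (ltnP k n) => [kn|nk]; last by left; rewrite /Phi ltnNge nk.
  (* If |W| >= s the potential is already at least 1, for every k <= n because theta_k >= theta_0;
     otherwise |W| <= s supplies the spectral bounds for the step. *)
  case: (boolP (op_ge s W)) => [hs|/not_op_ge Ws]; [by left; exact: PhiS|right].
  have kn' : (k <= n)%N by exact: ltnW.
  rewrite /Phi kn kn'.
  pose T := W - mean_step p jv kv yv.
  have WT : W = T + mean_step p jv kv yv by rewrite /T subrK.
  have -> : \sum_v p v * (expR (- (2 * L)) * \tr (mexp (E k (W + Z v)))) =
      expR (- (2 * L)) * \sum_v p v * \tr (mexp (E k (T + yv v *: atom jv kv v))).
    rewrite mulr_sumr; apply: eq_bigr => v _; rewrite mulrCA; congr (_ * (_ * \tr (mexp (E k _)))).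
    by rewrite /Z /T addrCA addrC.
  rewrite ler_wpM2l ?expR_ge0//.
  have f20 : 0 <= (1 / 20 : R) by lra.
  (* The mean step has Frobenius norm at most 1/sqrt(ab), below 1/20 because ab >= 600. *)
  have Ts : opb T (s + 1 / 20).
    rewrite /T -scaleN1r; apply: opbD => // x.
    rewrite scaleN1r mulmxN -scaleN1r sqnZ sqrrN expr1n [1 * sqn _]mul1r.
    apply: (le_trans (sqn_mul_fro2 _ _)); rewrite ler_wpM2r ?sqn_ge0//.
    apply: (le_trans (fro2_mean_step a0 b0 p_ge0 marg y_le1)).
    have N600 : 600 <= ((a * b)%:R : R).
      by apply: (le_trans b600); rewrite ler_nat leq_pmull.
    have N0 : 0 < ((a * b)%:R : R) by lra.
    rewrite -[leLHS]mul1r ler_pdivrMr//; lra.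
  rewrite [in leRHS]WT.
  have sg0 : 0 < s + 1 / 20 by lra.
  apply: (second_order_step a0 b0 p_ge0 marg y_le1 (g1 := 4 / 5) (g2 := 26 / 25) (ga := 49 / 25) (rho := 7 / 20)
    (sg := s + 1 / 20) (x1 := 253 / 200) (x2 := 93 / 50)) => //.
  - by rewrite ltW// (theta_gt0 n0 (erefl de) b600 ab).
  - exact: (muk_ge0 n0 (erefl de) b600 ab).
  - by apply: expR_quad_le; [lra|lra|exact: expR_bound_1265].
  - by apply: expR_quad_le; [lra|lra|exact: expR_bound_186].
  - by lra.
  - by lra.
  - exact: (step_X1 n0 (erefl de) b600 ab kn de30 s30 sde).
  - exact: (step_X2 n0 (erefl de) b600 ab kn de30 s30 sde).
  - exact: (step_TH n0 (erefl de) b600 ab kn).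
  - exact: (step_MU n0 (erefl de) b600 ab kn).
  - exact: (step_NU n0 (erefl de) b600 ab kn de30 s30 s2 Lb).
have := @walk_bound R V _ p Z p_ge0 (sum_p a0 b0 marg) (op_ge s) Phi Phi0 (fun W => PhiS 0%N W (leq0n n)) step n 0.
have -> : \sum_(t : n.-tuple V | op_ge s (0 + \sum_(i < n) Z (tnth t i))) \prod_(i < n) p (tnth t i) =
  tail_prob p jv kv yv n s.
  apply: eq_bigl => t; rewrite add0r /Z sumrB sumr_const card_ord scaler_nat.
  by [].
move=> H; apply: (le_trans H); rewrite /Phi leqnn /E mul0mx scaler0 add0r.
have -> : fro2 (0 : 'M[R]_(a, b)) = 0 by rewrite /fro2 /mx_inner mulmx0 linear0.
rewrite mulr0 add0r tr_mexp_scalar.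
have nu17 := nuk_n n0 (erefl de) b600 ab.
have e6 : expR (nu n) <= 6 by apply: le_trans expR_bound_17; rewrite ler_expR.
have -> : expR (- (2 * L)) = ((a + b)%:R^-1) ^+ 2 :> R.
  by rewrite -eL -expRN -expRM_natl; congr expR; ring.
have m0 : 0 < (a + b)%:R :> R by rewrite ltr0n addn_gt0 a0.
have h : a%:R * expR (nu n) <= 3 * (a + b)%:R.
  apply: (@le_trans _ _ (a%:R * 6)); first by rewrite ler_wpM2l// ltW.
  by rewrite natrD; lra.
rewrite expr2 -mulrA mulrC ler_wpM2r ?invr_ge0 ?(ltW m0)//.
by rewrite mulrC ler_pdivrMr.
Qed.

End Second_order_tail.

(** * Bernstein-type consequences of the first-order bound *)

Section First_order_numerics.
Context {R : realType} {V : finType} {a b : nat}.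
Variables (p : V -> R) (jv : V -> 'I_a) (kv : V -> 'I_b) (yv : V -> R).
Hypotheses (a0 : (0 < a)%N) (b0 : (0 < b)%N) (p_ge0 : forall v, 0 <= p v)
  (marg : forall (j : 'I_a) (k : 'I_b), \sum_(v | (jv v == j) && (kv v == k)) p v = (a * b)%:R^-1)
  (y_le1 : forall v, `|yv v| <= 1).

(** As m = a + b >= 2, the trace factor is at most m e^f, so even and odd losses join into de (e^th
    - 1 - th) <= de th^2 for th <= 1. If 4T <= de, th = sqrt(T/de) gives -2T + T; otherwise th = 1/2
    gives at most -2T + de/4 <= -T. *)
Theorem bennett_tail n (T s : R) (de := n%:R / a%:R : R) : (a <= b)%N -> (0 < n)%N -> 0 < T ->
  2 * Num.sqrt (de * T) <= s -> 4 * T <= s ->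
  tail_prob p jv kv yv n s <= (a + b)%:R * expR (- T).
Proof.
move=> ab n0 T0 s1 s2.
have de0 : 0 < de by rewrite divr_gt0 ?ltr0n.
have s0 : 0 < s by apply: lt_le_trans s2; rewrite mulr_gt0.
have m2 : 2 <= (a + b)%:R :> R.
  by rewrite (_ : 2 = (1 + 1)%:R :> R)// ler_nat leq_add.
have key th : 0 < th -> th <= 1 -> - th * s + de * th ^+ 2 <= - T ->
    tail_prob p jv kv yv n s <= (a + b)%:R * expR (- T).
  move=> th0 th1 H.
  apply: (le_trans (first_order_tail a0 b0 p_ge0 marg y_le1 ab n0 th0 s0)); rewrite -/de.
  set f := de * (sh th - th).
  have f0 : 0 <= f by rewrite mulr_ge0 ?(ltW de0)// subr_ge0 sh_ge ?ltW.
  have ef : 1 <= expR f by rewrite -[leLHS](@expR0 R) ler_expR.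
  have h1 : (a + b)%:R + 2 * (expR f - 1 - f) <= (a + b)%:R * expR f.
    have := mulr_ge0 (_ : 0 <= (a + b)%:R - 2) (_ : 0 <= expR f - 1).
    by rewrite !subr_ge0 => /(_ m2 ef); lra.
  apply: le_trans (ler_wpM2l (expR_ge0 _) h1) _.
  rewrite mulrCA ler_wpM2l ?ler0n// -expRD ler_expR.
  apply: le_trans H; rewrite -addrA lerD2l /f -mulrDr ler_wpM2l ?(ltW de0)//.
  have -> : ch th - 1 + (sh th - th) = expR th - 1 - th by rewrite /ch /sh; lra.
  have := @expR_quad_le R 1 1 ltac:(lra) ltac:(lra) _ th th1.
  have e1 := @expR_le_taylor5 R 1 ltac:(apply/andP; split; lra).
  have e3 : expR 1 <= 1 + 1 + 1 * 1 ^+ 2 :> R by lra.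
  by move=> /(_ e3); lra.
have [d4|d4] := leP (4 * T) de.
  pose th := Num.sqrt (T / de).
  have Td : 0 < T / de by rewrite divr_gt0.
  have th0 : 0 < th by rewrite sqrtr_gt0.
  have th2 : th ^+ 2 = T / de by rewrite sqr_sqrtr// ltW.
  have thd : th ^+ 2 * de = T by rewrite th2 divfK// gt_eqF.
  have sq : Num.sqrt (de * T) = th * de.
    have -> : de * T = (th * de) ^+ 2 by rewrite exprMn th2; field; rewrite gt_eqF.
    by rewrite sqrtr_sqr ger0_norm// mulr_ge0 ?ltW.
  apply: (key th th0).
    rewrite leNgt; apply/negP => h.
    have : 1 * 1 <= th * th by apply: ler_pM; lra.
    have : 0 <= (th ^+ 2 - 1) * de -> False by rewrite mulrBl thd; lra.
    rewrite -expr2 => h2 h3; apply: h2; rewrite mulr_ge0 ?(ltW de0)// subr_ge0; lra.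
  have := ler_wpM2l (ltW th0) s1; rewrite sq; lra.
apply: (key (1 / 2)); [lra|lra|].
lra.
Qed.

Lemma expR_le_taylor7 (x : R) : 0 <= x <= 1 ->
  expR x <= 1 + x + x ^+ 2 / 2 + x ^+ 3 / 6 + x ^+ 4 / 24 + x ^+ 5 / 120 + x ^+ 6 / 720 + x ^+ 7 / 4320.
Proof.
move=> /andP[x0 x1].
pose q : {poly R} := 1 + 'X + 2^-1 *: 'X^2 + 6^-1 *: 'X^3 + 24^-1 *: 'X^4 + 120^-1 *: 'X^5 + 720^-1 *: 'X^6 + 4320^-1 *: 'X^7.
have pE y : q.[y] = 1 + y + y ^+ 2 / 2 + y ^+ 3 / 6 + y ^+ 4 / 24 + y ^+ 5 / 120 + y ^+ 6 / 720 + y ^+ 7 / 4320 by rewrite /q !hornerE /=; field.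
rewrite -pE; apply: expR_le_poly => //; first by rewrite pE; lra.
move=> y /andP[y0 yx]; rewrite pE.
have -> : q^`().[y] = 1 + y + y ^+ 2 / 2 + y ^+ 3 / 6 + y ^+ 4 / 24 + y ^+ 5 / 120 + 7 / 4320 * y ^+ 6.
  by rewrite /q !poly.derivE !hornerE /=; field.
have : 0 <= y ^+ 6 * (1 - y) by rewrite mulr_ge0 ?exprn_ge0//; lra.
lra.
Qed.

Lemma expRN_le_taylor6 (x : R) : 0 <= x ->
  expR (- x) <= 1 - x + x ^+ 2 / 2 - x ^+ 3 / 6 + x ^+ 4 / 24 - x ^+ 5 / 120 + x ^+ 6 / 720.
Proof.
move=> x0.
pose q : {poly R} := 1 + 'X + 2^-1 *: 'X^2 + 6^-1 *: 'X^3 + 24^-1 *: 'X^4 + 120^-1 *: 'X^5 + 720^-1 *: 'X^6.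
have pE y : q.[y] = 1 + y + y ^+ 2 / 2 + y ^+ 3 / 6 + y ^+ 4 / 24 + y ^+ 5 / 120 + y ^+ 6 / 720 by rewrite /q !hornerE /=; field.
have dE y : q^`().[y] = 1 + y + y ^+ 2 / 2 + y ^+ 3 / 6 + y ^+ 4 / 24 + y ^+ 5 / 120.
  by rewrite /q !poly.derivE !hornerE /=; field.
have xx : - x <= 0 by lra.
have := @poly_expRN_le R (- q) (- x) 0 xx.
rewrite !hornerN derivN oppr0 expR0 opprK !mulNr lerN2 mulr1 pE => /(_ _)/wrap[].
  move=> y _; rewrite !hornerN lerN2 pE dE.
  have : 0 <= (y ^+ 3) ^+ 2 by exact: sqr_ge0.
  lra.
rewrite pE => H; rewrite expRN -[leLHS]mul1r ler_pdivrMr ?expR_gt0//.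
lra.
Qed.

Lemma expRN_ge_taylor3 (x : R) : 0 <= x -> 1 - x + x ^+ 2 / 2 - x ^+ 3 / 6 <= expR (- x).
Proof.
move=> x0; pose q : {poly R} := 1 + 'X + 2^-1 *: 'X^2 + 6^-1 *: 'X^3.
have pE y : q.[y] = 1 + y + y ^+ 2 / 2 + y ^+ 3 / 6 by rewrite /q !hornerE /=; field.
have dE y : q^`().[y] = 1 + y + y ^+ 2 / 2 by rewrite /q !poly.derivE !hornerE /=; field.
have xx : - x <= 0 by lra.
have := @poly_expRN_le R q (- x) 0 xx.
rewrite oppr0 expR0 opprK mulr1 pE => /(_ _)/wrap[].
  move=> y /andP[_ y0]; rewrite pE dE.
  have : 0 <= (- y) ^+ 3 by rewrite exprn_ge0//; lra.
  lra.
rewrite pE => H; rewrite expRN -[leRHS]mul1r ler_pdivlMr ?expR_gt0//.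
lra.
Qed.

End First_order_numerics.

(** * Optimizing the first-order bound in moderate dimension *)

Lemma bernstein_ge0 {R : realType} (y : R) i j : 0 <= y <= 1 / 6 -> 0 <= y ^+ i * (1 / 6 - y) ^+ j.
Proof. by move=> /andP[y0 y1]; rewrite mulr_ge0 ?exprn_ge0 ?subr_ge0. Qed.

(** A certificate in the Bernstein basis of [0, 1/6]: the difference of the two sides is a
    nonnegative combination of products y^i (1/6 - y)^j. The sixth power is first lowered to a
    square to keep the degree at five. *)
Lemma ch_loss_poly {R : realType} (y : R) : 0 <= y <= 1 / 6 ->
  2 * y ^+ 2 + y * (1 - y) ^+ 4 + 144 / 660 * (y ^+ 2 * (1 - y) ^+ 6) <= 142 / 1000.
Proof.
move=> yI; have B i j := bernstein_ge0 i j yI; have /andP[y0 y1] := yI.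
have q0 : 0 <= 1 - y by lra.
have q1 : 1 - y <= 1 by lra.
have h6 : (1 - y) ^+ 6 <= (1 - y) ^+ 2 by rewrite ler_wiXn2l.
have h62 := ler_wpM2l (sqr_ge0 y) h6.
apply: (@le_trans _ _ (2 * y ^+ 2 + y * (1 - y) ^+ 4 + 144 / 660 * (y ^+ 2 * (1 - y) ^+ 2))).
  by move: h62; clear; lra.
have := (B 5 0, B 4 1, B 3 2, B 2 3, B 1 4, B 0 5)%N.
clear; move=> [[[[[? ?] ?] ?] ?] ?]; lra.
Qed.

Lemma sh_loss_poly {R : realType} (y : R) : 0 <= y <= 1 / 6 ->
  (2 * y + 1 / 3) * (1 - y) ^+ 3 + y * (1 - y) ^+ 4 / 2 + (3 / 2 * y + 1 / 4) * y * (1 - y) ^+ 5 / 4 <= 44 / 100.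
Proof.
move=> yI; have B i j := bernstein_ge0 i j yI.
have := (B 7 0, B 6 1, B 5 2, B 4 3, B 3 4, B 2 5, B 1 6, B 0 7)%N.
clear; move=> [[[[[[[? ?] ?] ?] ?] ?] ?] ?]; lra.
Qed.

(** -2 e th + ch th is minimal at th = arsinh(2e), whose expansion to third order is 2e (1 - 2
    e^2/3), the [th] used here. The Gaussian exponent -2 e^2 is then missed by at most 0.142 e^2. *)
Lemma ch_exponent_le {R : realType} (e : R) (y := 2 / 3 * e ^+ 2) (th := 2 * e * (1 - y)) : 0 < e <= 1 / 2 ->
  [/\ 0 < th, th <= 1, - th * (2 * e) + (ch th - 1) <= e ^+ 2 * (142 / 1000 - 2)
    & sh th - th <= 44 / 100 * e ^+ 2].
Proof.
move=> /andP[e0 e1].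
have x0 : 0 < e ^+ 2 by rewrite exprn_gt0.
have x1 : e ^+ 2 <= 1 / 4.
  have : e * e <= 1 / 2 * (1 / 2) by apply: ler_pM; lra.
  by rewrite -expr2; lra.
have ex : e <= e ^+ 2 + 1 / 4 by have := sqr_ge0 (e - 1 / 2); lra.
have y0 : 0 < y by rewrite /y; lra.
have yI : 0 <= y <= 1 / 6 by apply/andP; rewrite /y; lra.
have q0 : 0 < 1 - y by lra.
have th0 : 0 < th by rewrite mulr_gt0// mulr_gt0.
have th1 : th <= 1.
  have : 2 * e * (1 - y) <= 1 * 1 by apply: ler_pM; lra.
  by rewrite /th; lra.
have B i j := bernstein_ge0 i j yI.
have thI : 0 <= th <= 1 by rewrite (ltW th0) th1.
have u7 := expR_le_taylor7 thI; have u5 := expR_le_taylor5 thI.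
have l6 := expRN_le_taylor6 (ltW th0); have l3 := expRN_ge_taylor3 (ltW th0).
have x3 : e ^+ 2 = 3 / 2 * y by rewrite /y; field.
have t2 : th ^+ 2 = 6 * y * (1 - y) ^+ 2 by rewrite /th !exprMn x3; field.
have t4 : th ^+ 4 = e ^+ 2 * (24 * y * (1 - y) ^+ 4).
  by rewrite -[th ^+ 4]/(th ^+ (2 + 2)%N) exprD t2 x3; field.
have t6 : th ^+ 6 = e ^+ 2 * (144 * y ^+ 2 * (1 - y) ^+ 6).
  by rewrite -[th ^+ 6]/(th ^+ (2 + 2 + 2)%N) !exprD t2 x3; field.
have t3 : th ^+ 3 = e ^+ 2 * (8 * e * (1 - y) ^+ 3) by rewrite /th; ring.
have t5 : th ^+ 5 = e ^+ 2 * (e * 48 * y * (1 - y) ^+ 5).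
  by rewrite -[th ^+ 5]/(th ^+ (3 + 2)%N) exprD t2 t3; ring.
split=> //.
  have t7 : th ^+ 7 <= th ^+ 6 by rewrite exprS ler_piMl// exprn_ge0// ltW.
  have c1 : ch th - 1 <= th ^+ 2 / 2 + th ^+ 4 / 24 + th ^+ 6 / 660.
    have : 0 <= th ^+ 6 by rewrite exprn_ge0// ltW.
    by move: u7 l6 t7; rewrite /ch; clear; lra.
  have p1 : 2 * y ^+ 2 + y * (1 - y) ^+ 4 + 144 / 660 * (y ^+ 2 * (1 - y) ^+ 6) <= 142 / 1000 by exact: ch_loss_poly.
  have := ler_wpM2l (ltW x0) p1.
  have -> : - th * (2 * e) = - (e ^+ 2 * (4 * (1 - y))) by rewrite /th; ring.
  have t2' : th ^+ 2 = e ^+ 2 * (4 * (1 - y) ^+ 2) by rewrite /th; ring.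
  rewrite t4 t6 t2' in c1.
  by move: c1; clear; lra.
have c1 : sh th - th <= th ^+ 3 / 6 + th ^+ 4 / 48 + th ^+ 5 / 192.
  by move: u5 l3; rewrite /sh; clear; lra.
have p2 := ler_wpM2l (ltW x0) (sh_loss_poly yI).
have ey : e <= 3 / 2 * y + 1 / 4 by rewrite -x3.
have w k : 0 <= e ^+ 2 * (1 - y) ^+ k by rewrite mulr_ge0 ?exprn_ge0 ?(ltW e0) ?(ltW q0).
have p3 := ler_wpM2r (w 3%N) ey.
have p5 := ler_wpM2r (mulr_ge0 (ltW y0) (w 5%N)) ey.
rewrite t3 t4 t5 in c1.
by move: c1 p2 p3 p5; clear; lra.
Qed.

Lemma expR_chord {R : realType} (c X x : R) : 0 < X -> 0 <= x <= X ->
  expR (c * x) <= 1 + x / X * (expR (c * X) - 1).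
Proof.
move=> X0 /andP[x0 xX]; set l := x / X.
have l0 : 0 <= l by rewrite divr_ge0// ltW.
have l1 : l <= 1 by rewrite ler_pdivrMr// mul1r.
have xE : x = l * X by rewrite divfK// gt_eqF.
have h1 := ler_wpM2l l0 (expR_tangent (c * x) (c * X)).
have l1' : 0 <= 1 - l by lra.
have h2 := ler_wpM2l l1' (expR_tangent (c * x) 0); rewrite expR0 in h2.
suff : expR (c * x) = l * (expR (c * x) * (1 + c * X - c * x)) + (1 - l) * (expR (c * x) * (1 + 0 - c * x)).
  lra.
have -> : l * (expR (c * x) * (1 + c * X - c * x)) + (1 - l) * (expR (c * x) * (1 + 0 - c * x)) =
  expR (c * x) * (1 + c * (l * X) - c * x) by ring.
by rewrite -xE addrK mulr1.
Qed.

(** The left side is convex in L and equals 3 at L = 0; at L = 15/2 the bounds 2.908 and 0.046 sum,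
    with weights 1 and 2, to exactly 3, so the chord stays below 3. The rate 0.418 is 1 - 0.142 -
    0.44. *)
Lemma exp_sum_le_3 {R : realType} (L : R) : 0 <= L <= 15 / 2 ->
  expR (142 / 1000 * L) + 2 * expR (- (418 / 1000) * L) <= 3.
Proof.
move=> LI; have X0 : 0 < 15 / 2 :> R by clear; lra.
have c1 := expR_chord (142 / 1000) X0 LI.
have c2 := expR_chord (- (418 / 1000)) X0 LI.
have k1 : expR (142 / 1000 * (15 / 2)) <= 2908 / 1000 :> R.
  have -> : 142 / 1000 * (15 / 2) = 2%:R * (213 / 400) :> R by lra.
  rewrite expRM_natl.
  pose x : R := 213 / 400; have t : 0 <= x <= 1 by apply/andP; rewrite /x; clear; lra.
  have g : expR (213 / 400) <= 1705 / 1000 :> R by have := expR_le_taylor5 t; rewrite /x; clear; lra.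
  have : expR (213 / 400) * expR (213 / 400) <= 1705 / 1000 * (1705 / 1000) :> R by apply: ler_pM; rewrite ?expR_ge0.
  by rewrite -expr2; clear; lra.
have k2 : expR (- (418 / 1000) * (15 / 2)) <= 46 / 1000 :> R.
  pose x : R := 3135 / 4000; have x0 : 0 <= x by rewrite /x; clear; lra.
  have -> : - (418 / 1000) * (15 / 2) = - (4%:R * x) by rewrite /x; field.
  have g : 217 / 100 <= expR x by have := expR_ge_taylor3 x0; rewrite /x; clear; lra.
  have g2 : 47 / 10 <= expR x ^+ 2.
    have : 217 / 100 * (217 / 100) <= expR x * expR x by apply: ler_pM (g) (g); clear; lra.
    by rewrite -expr2; clear; lra.
  have g4 : 22 <= expR x ^+ 4.
    have : 47 / 10 * (47 / 10) <= expR x ^+ 2 * expR x ^+ 2 by apply: ler_pM (g2) (g2); clear; lra.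
    by rewrite -exprD; clear; lra.
  have := ler_wpM2l (expR_ge0 (- (4%:R * x))) g4.
  rewrite -expRM_natl -expRD addNr expR0; clear; lra.
have l0 : 0 <= L / (15 / 2) by case/andP: LI => L0 _; rewrite divr_ge0// ltW.
have := mulr_ge0 l0 (_ : 0 <= 3 - (expR (142 / 1000 * (15 / 2)) + 2 * expR (- (418 / 1000) * (15 / 2)))).
move=> /(_ ltac:(move: k1 k2; clear; lra)); move: c1 c2; clear; lra.
Qed.

Section Small_dim_numerics.
Context {R : realType} {V : finType} {a b : nat}.
Variables (p : V -> R) (jv : V -> 'I_a) (kv : V -> 'I_b) (yv : V -> R).
Hypotheses (a0 : (0 < a)%N) (b0 : (0 < b)%N) (p_ge0 : forall v, 0 <= p v)
  (marg : forall (j : 'I_a) (k : 'I_b), \sum_(v | (jv v == j) && (kv v == k)) p v = (a * b)%:R^-1)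
  (y_le1 : forall v, `|yv v| <= 1).

(** With e^2 = L/de, the hypothesis 4L <= de is e <= 1/2. For m = a + b the tail is at most (m^0.142
    + 2 m^(-0.418))/m. *)
Lemma small_dim_tail n L (de := n%:R / a%:R : R) : (a <= b)%N -> (0 < n)%N ->
  expR L = (a + b)%:R -> L <= 15 / 2 -> 4 * L <= de ->
  tail_prob p jv kv yv n (2 * Num.sqrt (de * L)) <= 3 / (a + b)%:R.
Proof.
move=> ab n0 eL L1 L4.
have de0 : 0 < de by rewrite divr_gt0 ?ltr0n.
have L0 : 0 < L.
  rewrite -expR_gt1 eL (_ : 1 = 1%:R)// ltr_nat.
  by rewrite (@leq_trans (1 + 1))// leq_add.
pose e := Num.sqrt (L / de).
have Ld : 0 < L / de by rewrite divr_gt0.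
have e0 : 0 < e by rewrite sqrtr_gt0.
have e2 : e ^+ 2 = L / de by rewrite sqr_sqrtr// ltW.
have ed : de * e ^+ 2 = L by rewrite e2 mulrC divfK// gt_eqF.
have e1 : e <= 1 / 2.
  by rewrite -ler_sqr ?nnegrE ?divr_ge0 ?(ltW e0)// e2 ler_pdivrMr//; lra.
have sq : Num.sqrt (de * L) = e * de.
  have -> : de * L = (e * de) ^+ 2 by rewrite -{1}ed; ring.
  by rewrite sqrtr_sqr ger0_norm// mulr_ge0 ?ltW.
have eI : 0 < e <= 1 / 2 by rewrite e0.
have [] := ch_exponent_le eI; set th := 2 * e * _ => th0 th1 hc hs.
have s0 : 0 < 2 * Num.sqrt (de * L) by rewrite sq mulr_gt0// mulr_gt0.
apply: (le_trans (first_order_tail a0 b0 p_ge0 marg y_le1 ab n0 th0 s0)); rewrite -/de sq.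
set f := de * (sh th - th).
have f0 : 0 <= f by rewrite mulr_ge0 ?(ltW de0)// subr_ge0 sh_ge ?ltW.
have f1 : f <= 44 / 100 * L by have := ler_wpM2l (ltW de0) hs; move: ed; rewrite /f; lra.
have h1 : - th * (2 * (e * de)) + de * (ch th - 1) <= (142 / 1000 - 2) * L.
  by have := ler_wpM2l (ltW de0) hc; move: ed; lra.
have m0 : 0 < (a + b)%:R :> R by rewrite -eL expR_gt0.
have h2 : (a + b)%:R + 2 * (expR f - 1 - f) <= expR L + 2 * expR (44 / 100 * L).
  have : expR f <= expR (44 / 100 * L) by rewrite ler_expR.
  by rewrite eL; lra.
have h3 : 0 <= (a + b)%:R + 2 * (expR f - 1 - f).
  by have := expR_ge1Dx f; lra.
apply: (@le_trans _ _ (expR ((142 / 1000 - 2) * L) * (expR L + 2 * expR (44 / 100 * L)))).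
  by apply: ler_pM; rewrite ?expR_ge0// ler_expR.
have -> : expR ((142 / 1000 - 2) * L) * (expR L + 2 * expR (44 / 100 * L)) =
    expR (- L) * (expR (142 / 1000 * L) + 2 * expR (- (418 / 1000) * L)).
  by rewrite !mulrDr ![_ * (2 * _)]mulrCA -!expRD; congr (expR _ + 2 * expR _); field.
rewrite -eL -expRN mulrC ler_wpM2r ?expR_ge0// exp_sum_le_3//.
by rewrite (ltW L0).
Qed.

End Small_dim_numerics.

(** * Measurability, means of bounded functions, stability of operator bounds *)

Lemma measurable_of_locally_stable {d : measure_display} {T : measurableType d} {R : realType} {a b : nat}
  (F : T -> 'M[R]_(a, b)) (B : set T) :
  (forall i j, measurable_fun setT (fun w => F w i j)) ->
  (forall w, B w -> exists2 e : R, 0 < e &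
    forall w', (forall i j, `|F w i j - F w' i j| < e) -> B w') -> measurable B.
Proof.
move=> mF HB.
(* [B] is open for the topology pulled back along [F]. Rational centres and radii 1/(k + 1) give
   countably many measurable boxes, and [B] is the union of those it contains. *)
pose box (u : 'M[rat]_(a, b) * nat) : set T :=
  \bigcap_ij [set w | `|F w ij.1 ij.2 - ratr (u.1 ij.1 ij.2)| < u.2.+1%:R^-1].
have boxP u w : box u w <-> forall i j, `|F w i j - ratr (u.1 i j)| < u.2.+1%:R^-1.
  by split=> [H i j|H [i j] _]; [exact: (H (i, j))|exact: H].
have mbox u : measurable (box u).
  apply: fin_bigcap_measurable => [|[i j] _ /=]; first exact: finite_finset.
  have -> : [set w | `|F w i j - ratr (u.1 i j)| < u.2.+1%:R^-1] =
      (fun w => F w i j) @^-1` `]ratr (u.1 i j) - u.2.+1%:R^-1, ratr (u.1 i j) + u.2.+1%:R^-1[.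
    by apply/seteqP; split=> w /=; rewrite in_itv/= ltr_distl.
  by rewrite -[X in measurable X]setTI; exact: mF.
pose G u : set T := if `[< box u `<=` B >] then box u else set0.
have -> : B = \bigcup_u G u.
  apply/seteqP; split=> [w Bw|w [u _]]; last by rewrite /G; case: asboolP => // H /H.
  have [e e0 He] := HB w Bw.
  have [k k2] : exists k : nat, 2 * k.+1%:R^-1 <= e.
    exists (Num.truncn (2 / e)).
    rewrite ler_pdivrMr ?ltr0n// mulrC -ler_pdivrMr// ltW// truncnS_gt//.
  have rk : 0 < k.+1%:R^-1 :> R by rewrite invr_gt0 ltr0n.
  have Q i j : exists q : rat, `|F w i j - ratr q| < k.+1%:R^-1.
    have [q] : exists q : rat, ratr q \in `]F w i j - k.+1%:R^-1, F w i j + k.+1%:R^-1[.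
      by apply: rat_in_itvoo; move: rk; set r := _^-1; clear; lra.
    by rewrite in_itv/= -ltr_distl distrC; exists q.
  have [q Hq] := choice (fun ij => Q ij.1 ij.2).
  exists (\matrix_(i, j) q (i, j), k) => //; rewrite /G.
  have bw : box (\matrix_(i, j) q (i, j), k) w by apply/boxP => i j; rewrite mxE; exact: (Hq (i, j)).
  case: asboolP => // -[] w' /boxP /= Hw'; apply: He => i j.
  have := Hw' i j; have := Hq (i, j); rewrite mxE => h1 h2.
  apply: lt_le_trans k2; apply: le_lt_trans (ler_distD (ratr (q (i, j))) _ _) _.
  by rewrite [X in _ + X]distrC; move: h1 h2; set r := _^-1; clear; lra.
apply: countable_bigcupT_measurable => [|u]; first exact: countableP.
by rewrite /G; case: asboolP.
Qed.

Section Bounded_functions.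
Context {d : measure_display} {T : measurableType d} {R : realType} (P : probability T R).
Implicit Types (f g : T -> R).

(** Bounded measurable functions are integrable for a probability and closed under sums and
    products, so no other integrability condition has to be carried along. *)
Definition bmf f := measurable_fun setT f /\ exists c, forall w, `|f w| <= c.

Lemma bmf_integrable f : bmf f -> P.-integrable setT (EFin \o f).
Proof.
move=> [mf [c fc]]; apply: measurable_bounded_integrable => //.
  by rewrite -ge0_fin_numE// fin_num_measure.
by exists c; split => [|M cM w _]; [exact: num_real|exact: le_trans (ltW cM)].
Qed.

Lemma bmf_cst c : bmf (fun=> c).
Proof. by split; [exact: measurable_cst|exists `|c|]. Qed.

Lemma bmf_indic (A : set T) : measurable A -> bmf (\1_A).
Proof.
move=> mA; split; first exact: measurable_indic.
by exists 1 => w; rewrite indicE; case: (_ \in _); rewrite ?normr1 ?normr0.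
Qed.

Lemma bmfD f g : bmf f -> bmf g -> bmf (fun w => f w + g w).
Proof.
move=> [mf [c fc]] [mg [e ge]]; split; first exact: measurable_funD.
by exists (c + e) => w; apply: le_trans (ler_normD _ _) (lerD _ _).
Qed.

Lemma bmfM f g : bmf f -> bmf g -> bmf (fun w => f w * g w).
Proof.
move=> [mf [c fc]] [mg [e ge]]; split; first exact: measurable_funM.
by exists (c * e) => w; rewrite normrM ler_pM.
Qed.

Lemma bmfZ c f : bmf f -> bmf (fun w => c * f w).
Proof. by move=> bf; apply: bmfM => //; exact: bmf_cst. Qed.

Lemma bmf_sum (I : Type) (s : seq I) (Q : pred I) (f : I -> T -> R) :
  (forall i, bmf (f i)) -> bmf (fun w => \sum_(i <- s | Q i) f i w).
Proof.
move=> bf; elim: s => [|i s IH].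
  by rewrite (_ : (fun _ => _) = fun=> 0); [exact: bmf_cst|apply/funext => w; rewrite big_nil].
rewrite (_ : (fun _ => _) = fun w => (if Q i then f i w else 0) + \sum_(j <- s | Q j) f j w).
  by case: (Q i); apply: bmfD => //; exact: bmf_cst.
by apply/funext => w; rewrite big_cons; case: (Q i) => //; rewrite add0r.
Qed.

Lemma bmfB f g : bmf f -> bmf g -> bmf (fun w => f w - g w).
Proof.
move=> bf bg; have := bmfD bf (bmfZ (-1) bg).
by congr bmf; apply/funext => w; rewrite mulN1r.
Qed.

Local Notation E f := (Rintegral P setT f).

Lemma mean_cst c : E (fun=> c) = c.
Proof.
have P1 : P setT = 1%E := @probability_setT _ _ _ P.
rewrite Rintegral_cst// -[RHS]mulr1; congr (_ * _); exact: (congr1 fine P1). Qed.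

Lemma meanD f g : bmf f -> bmf g -> E (fun w => f w + g w) = E f + E g.
Proof. by move=> bf bg; rewrite RintegralD//; exact: bmf_integrable. Qed.

Lemma meanB f g : bmf f -> bmf g -> E (fun w => f w - g w) = E f - E g.
Proof. by move=> bf bg; rewrite RintegralB//; exact: bmf_integrable. Qed.

Lemma meanZ c f : bmf f -> E (fun w => c * f w) = c * E f.
Proof. by move=> bf; rewrite RintegralZl//; exact: bmf_integrable. Qed.

Lemma mean_sum (I : Type) (s : seq I) (Q : pred I) (f : I -> T -> R) : (forall i, bmf (f i)) ->
  E (fun w => \sum_(i <- s | Q i) f i w) = \sum_(i <- s | Q i) E (f i).
Proof.
move=> bf; elim: s => [|i s IH].
  rewrite big_nil -[RHS](mean_cst 0); congr Rintegral.
  by apply/funext => w; rewrite big_nil.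
rewrite big_cons -IH (_ : (fun _ => _) = fun w => (if Q i then f i w else 0) + \sum_(j <- s | Q j) f j w).
  have bs := bmf_sum s Q bf.
  by case: (Q i); rewrite meanD ?mean_cst ?add0r//; exact: bmf_cst.
by apply/funext => w; rewrite big_cons; case: (Q i) => //; rewrite add0r.
Qed.

Lemma mean_le f g : bmf f -> bmf g -> (forall w, f w <= g w) -> E f <= E g.
Proof. by move=> bf bg fg; apply: le_Rintegral => //; exact: bmf_integrable. Qed.

Lemma mean_indic (A : set T) : measurable A -> (E (\1_A))%:E = P A.
Proof.
move=> mA; rewrite /Rintegral integral_indic// setIT fineK//.
exact: fin_num_measure.
Qed.

End Bounded_functions.

Section Operator_bounds.
Context {R : realType} {a b : nat}.
Implicit Types M W : 'M[R]_(a, b).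

Lemma opb_entries M (e : R) : 0 <= e -> (forall i j, `|M i j| <= e) -> opb M ((a * b)%:R * e).
Proof.
move=> e0 Me x; apply: le_trans (sqn_mul_fro2 _ _) _; rewrite ler_wpM2r ?sqn_ge0//.
apply: (@le_trans _ _ ((a * b)%:R * e ^+ 2)); last first.
  rewrite exprMn ler_wpM2r ?sqr_ge0// -natrX ler_nat.
  by case: (a * b)%N => // m; rewrite leq_pmull.
rewrite fro2E; apply: (@le_trans _ _ (\sum_(i < a) \sum_(j < b) e ^+ 2)).
  by do 2!apply: ler_sum => ? _; rewrite -real_normK ?num_real// lerXn2r ?nnegrE.
under eq_bigr do rewrite sumr_const card_ord.
by rewrite sumr_const card_ord -mulrnA mulr_natl mulnC.
Qed.

Lemma opbZ W (c s : R) : opb W s -> opb (c *: W) (c * s).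
Proof.
by move=> Ws x; rewrite -scalemxAr sqnZ exprMn -[leRHS]mulrA; apply: (ler_wpM2l (sqr_ge0 c)); exact: Ws.
Qed.

Lemma opb_limit W (c : R) : 0 <= c -> (forall e, 0 < e -> opb W (c + e)) -> opb W c.
Proof.
move=> c0 H x; rewrite leNgt; apply/negP => lt.
have X0 := sqn_ge0 x; have Y0 : 0 < sqn (x *m W) by apply: le_lt_trans lt; rewrite mulr_ge0// sqr_ge0.
have [X1|Xp] := eqVneq (sqn x) 0.
  by have := H 1 ltr01 x; rewrite X1 mulr0 leNgt Y0.
have {X0}Xp : 0 < sqn x by rewrite lt_neqAle eq_sym Xp.
pose u := Num.sqrt (sqn (x *m W) / sqn x).
have u2 : u ^+ 2 = sqn (x *m W) / sqn x by rewrite sqr_sqrtr// divr_ge0// ltW.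
have cu : c < u.
  by rewrite -ltr_sqr ?nnegrE ?sqrtr_ge0// u2 ltr_pdivlMr.
have := H ((u - c) / 2); rewrite divr_gt0 ?subr_gt0// => /(_ isT x).
rewrite -ler_pdivrMr// -u2 ler_sqr ?nnegrE ?sqrtr_ge0//; lra.
Qed.

(** By [opb_limit] a failure at [c] persists at some c + e, a margin that small changes of the
    entries cannot consume. *)
Lemma not_opb_stable M (c : R) : (0 < a)%N -> (0 < b)%N -> 0 <= c -> ~ opb M c ->
  exists2 e : R, 0 < e & forall M', (forall i j, `|M i j - M' i j| < e) -> ~ opb M' c.
Proof.
move=> a0 b0 c0 nM.
have [e [e0 He]] : exists e, 0 < e /\ ~ opb M (c + e).
  apply: contrapT => H; apply: nM; apply: opb_limit => // e e0.
  by apply: contrapT => K; apply: H; exists e.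
have ab0 : 0 < (a * b)%:R :> R by rewrite ltr0n muln_gt0 a0.
exists (e / (a * b)%:R) => [|M' HM M'c]; first by rewrite divr_gt0.
apply: He; rewrite -[M](subrK M') addrC; apply: opbD => //; first exact: ltW.
have := @opb_entries (M - M') (e / (a * b)%:R); rewrite [X in opb _ X](_ : _ = e); first apply.
- by rewrite divr_ge0 ?ltW.
- by move=> i j; have := HM i j; rewrite !mxE => /ltW.
- by rewrite mulrC divfK // gt_eqF.
Qed.

End Operator_bounds.

(** * From i.i.d. observations to the finite sampling model *)

Section Sampling_transfer.
Context {d : measure_display} {T : measurableType d} {R : realType} {P : probability T R}
  {d' : measure_display} {D : measurableType d'} {n : nat}.
Variables (Z : 'I_n -> T -> D) (Z0 : T -> D).
Hypotheses (n0 : (0 < n)%N) (mZ : forall i, measurable_fun setT (Z i))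
  (mZ0 : measurable_fun setT Z0) (iid : iid_replications P Z Z0).
Context {a b : nat}.
Variables (S : 'I_a -> 'I_b -> set D) (f : D -> R) (eta : R).
Hypotheses (a0 : (0 < a)%N) (b0 : (0 < b)%N) (mS : forall j k, measurable (S j k))
  (S_disj : forall j k j' k' z, S j k z -> S j' k' z -> j = j' /\ k = k')
  (S_unif : forall j k, P (Z0 @^-1` S j k) = ((a * b)%:R^-1)%:E)
  (mf : measurable_fun setT f) (f_bd : forall z, `|f z| <= eta).

Local Notation E g := (Rintegral P setT g).

(** [S j k] is the event that entry (j, k) is observed. Keeping these events abstract allows rows
    and columns to be exchanged later. *)
Definition obs z : 'M[R]_(a, b) := \matrix_(j, k) (f z * \1_(S j k) z).
Definition mean_obs : 'M[R]_(a, b) := \matrix_(j, k) E (fun w => f (Z0 w) * \1_(S j k) (Z0 w)).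
Definition deviation w : 'M[R]_(a, b) := \sum_i obs (Z i w) - n%:R *: mean_obs.

Let bf : bmf f. Proof. by split; last exists eta. Qed.
Let bS j k : bmf (\1_(S j k) : D -> R). Proof. exact: bmf_indic. Qed.

Lemma bmf_comp (g : D -> R) (Y : T -> D) : measurable_fun setT Y -> bmf g -> bmf (fun w => g (Y w)).
Proof.
by move=> mY [mg [c gc]]; split; [exact: measurableT_comp mg mY|exists c].
Qed.

Lemma measurable_deviation j k : measurable_fun setT (fun w => deviation w j k).
Proof.
have bo i : bmf (fun w => obs (Z i w) j k).
  rewrite (_ : (fun _ => _) = fun w => f (Z i w) * \1_(S j k) (Z i w)).
    by apply: bmfM; exact: bmf_comp.
  by apply/funext => w; rewrite mxE.
rewrite (_ : (fun _ => _) = fun w => \sum_i obs (Z i w) j k - n%:R * mean_obs j k).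
  by case: (bmfB (bmf_sum (index_enum 'I_n) xpredT bo) (bmf_cst (n%:R * mean_obs j k))).
by apply/funext => w; rewrite !mxE summxE.
Qed.

Section Discretization.
Variable K : nat.
Hypothesis eta0 : 0 <= eta.

(** The rescaled response [u] ranges over the closed interval [0, K + 1], whose right end needs a
    level of its own: hence K + 2 levels. If eta = 0, division by zero makes [u] vanish and every
    response falls in level 0. *)
Let V : finType := ('I_a * 'I_b * 'I_K.+2)%type.
Let jv (v : V) := v.1.1.
Let kv (v : V) := v.1.2.
Let yv (v : V) : R := 2 * v.2%:R / K.+1%:R - 1.
Let u z := (f z + eta) / (2 * eta) * K.+1%:R.
Let cell (v : V) : set D := S (jv v) (kv v) `&` (u @^-1` `[v.2%:R, v.2.+1%:R[).
Let p (v : V) := E (fun w => \1_(cell v) (Z0 w)).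

Let K0 : 0 < K.+1%:R :> R. Proof. by rewrite ltr0n. Qed.

Let u_itv z : 0 <= u z <= K.+1%:R.
Proof.
have := f_bd z; rewrite ler_norml => /andP[f1 f2].
have h : 0 <= (f z + eta) / (2 * eta) <= 1.
  have [e0|e0] := eqVneq eta 0; first by rewrite e0 mulr0 invr0 mulr0 lexx ler01.
  have e2 : 0 < 2 * eta by rewrite mulr_gt0// lt_neqAle eq_sym e0.
  rewrite divr_ge0 ?(ltW e2)//=; last by lra.
  by rewrite ler_pdivrMr//; lra.
case/andP: h => h1 h2; rewrite /u mulr_ge0 ?(ltW K0)//=.
by rewrite -[leRHS]mul1r ler_wpM2r ?(ltW K0).
Qed.

Let cell_level v z : cell v z -> Num.truncn (u z) = v.2 :> nat.
Proof.
case=> _ /=; rewrite in_itv/= => /andP[h1 h2].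
by apply/truncn_def; rewrite h1.
Qed.

Let cell_exists j k z : S j k z -> exists2 v : V, v.1 = (j, k) & cell v z.
Proof.
move=> Sz; have /andP[u0 u1] := u_itv z.
have lt : (Num.truncn (u z) < K.+2)%N by rewrite ltnS -(ler_nat R) (le_trans _ u1)// truncn_le.
exists (j, k, Ordinal lt) => //; split=> //=; rewrite in_itv/=.
exact: truncn_itv.
Qed.

Let cell_inj v v' z : cell v z -> cell v' z -> v = v'.
Proof.
move=> c c'; have := cell_level c; rewrite (cell_level c') => e.
case: c c' => s _ [s' _]; have [e1 e2] := S_disj s s'.
move: v v' e e1 e2 {s s'} => [[j k] l] [[j' k'] l'] /= e; rewrite /jv /kv /= => -> ->.
by congr (_, _); apply: val_inj.
Qed.

Let mu : measurable_fun setT u.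
Proof.
rewrite /u (_ : (fun _ => _) = fun z => (K.+1%:R / (2 * eta)) * (f z + eta)).
  by apply: measurable_funM => //; exact: measurable_funD.
by apply/funext => z; ring.
Qed.

Let mcell v : measurable (cell v).
Proof.
apply: measurableI => //; rewrite -[X in measurable X]setTI.
exact: mu.
Qed.

Let bcell v : bmf (\1_(cell v) : D -> R). Proof. exact: bmf_indic. Qed.

Let sum_cell (h : V -> R) (Q : pred V) v z : cell v z ->
  \sum_(v' | Q v') h v' * \1_(cell v') z = if Q v then h v else 0.
Proof.
move=> cv; rewrite (bigID (pred1 v)) /= [X in _ + X]big1 ?addr0; last first.
  move=> v' /andP[_ vv']; rewrite indicE memNset ?mulr0// => cv'.
  by move: vv'; rewrite (cell_inj cv cv') eqxx.
case: ifPn => Qv; last by rewrite big_pred0// => v'; case: eqP => [->|]; rewrite ?andbF ?(negPf Qv).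
rewrite (big_pred1 v) => [|v']; first by rewrite indicE mem_set ?mulr1.
by rewrite /= andbC; case: eqP => // ->.
Qed.

Let sum_cell_jk (h : V -> R) j k z (Q := fun v : V => (jv v == j) && (kv v == k)) :
  (~ S j k z /\ \sum_(v | Q v) h v * \1_(cell v) z = 0) \/
  (exists v, [/\ S j k z, v.1 = (j, k), cell v z & \sum_(v | Q v) h v * \1_(cell v) z = h v]).
Proof.
have [Sz|nSz] := pselect (S j k z); [right|left].
  have [v vE cv] := cell_exists Sz; exists v; split=> //.
  by rewrite (sum_cell h Q cv) /Q /jv /kv vE !eqxx.
split=> //; rewrite big1// => v /andP[/eqP jE /eqP kE].
by rewrite indicE memNset ?mulr0// => -[]; rewrite jE kE.
Qed.

Let p_ge0 v : 0 <= p v.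
Proof.
rewrite -(mean_cst P 0); apply: mean_le => [|//|w]; first exact: bmf_cst.
  exact: bmf_comp.
by rewrite indicE.
Qed.

Let marg j k : \sum_(v | (jv v == j) && (kv v == k)) p v = (a * b)%:R^-1.
Proof.
rewrite /p -mean_sum => [|v]; last exact: bmf_comp.
apply: EFin_inj; rewrite -(S_unif j k) -mean_indic; last first.
  by rewrite -[X in measurable X]setTI; exact: mZ0.
congr (_%:E); congr Rintegral; apply/funext => w.
under eq_bigr do rewrite -[\1_ _ _]mul1r.
have [[nS ->]|[v [Sz _ _ ->]]] := sum_cell_jk (fun=> 1) j k (Z0 w).
  by rewrite indicE memNset.
by rewrite indicE mem_set.
Qed.

Let y_le1 v : `|yv v| <= 1.
Proof.
have h : v.2%:R <= K.+1%:R :> R by rewrite ler_nat -ltnS.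
have h0 : 0 <= v.2%:R / K.+1%:R :> R by rewrite divr_ge0// ltW.
have h1 : v.2%:R / K.+1%:R <= 1 :> R by rewrite ler_pdivrMr ?mul1r.
rewrite (_ : yv v = 2 * (v.2%:R / K.+1%:R) - 1); last by rewrite /yv mulrA.
rewrite ler_norml.
by move: h0 h1; set r := _ / _; move=> *; apply/andP; split; lra.
Qed.

Let f_yv v z : cell v z -> `|f z - eta * yv v| <= 2 * eta / K.+1%:R.
Proof.
case=> _ /=; rewrite in_itv/= => /andP[h1 h2].
have [e0|e0] := eqVneq eta 0.
  have := f_bd z; rewrite e0 normr_le0 => /eqP ->.
  by rewrite mul0r subr0 normr0 mulr0 mul0r.
have e2 : 0 < eta by rewrite lt_neqAle eq_sym e0.
have -> : f z - eta * yv v = 2 * eta / K.+1%:R * (u z - v.2%:R).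
  rewrite /u /yv; field; rewrite e0 gt_eqF//=.
have w0 : 0 <= 2 * eta / K.+1%:R by rewrite divr_ge0 ?mulr_ge0 ?(ltW K0).
rewrite normrM (ger0_norm w0) -[leRHS]mulr1 ler_wpM2l// ger0_norm ?subr_ge0//.
by rewrite lerBlDl natr1 ltW.
Qed.

Let W (t : n.-tuple V) := \sum_(i < n) yv (tnth t i) *: atom (R := R) jv kv (tnth t i) - n%:R *: mean_step p jv kv yv.

Let atomE v z j k : cell v z -> atom (R := R) jv kv v j k = \1_(S j k) z.
Proof.
move=> [Sz _]; rewrite !mxE indicE; congr (nat_of_bool _)%:R; apply/idP/idP.
  by case/andP => /eqP -> /eqP ->; rewrite mem_set.
by rewrite inE => Sz'; have [-> ->] := S_disj Sz' Sz; rewrite !eqxx.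
Qed.

Let mean_close j k : `|mean_obs j k - eta * mean_step p jv kv yv j k| <= 2 * eta / K.+1%:R.
Proof.
have w0 : 0 <= 2 * eta / K.+1%:R by rewrite divr_ge0 ?mulr_ge0 ?(ltW K0).
pose Q := fun v : V => (jv v == j) && (kv v == k).
have bh : bmf (fun w => \sum_(v | Q v) yv v * \1_(cell v) (Z0 w)).
  by apply: bmf_sum => v; apply: bmfZ; exact: bmf_comp.
have bfS : bmf (fun w => f (Z0 w) * \1_(S j k) (Z0 w)).
  by apply: bmfM; exact: bmf_comp.
have -> : mean_step p jv kv yv j k = E (fun w => \sum_(v | Q v) yv v * \1_(cell v) (Z0 w)).
  rewrite mean_sum => [|v]; last by apply: bmfZ; exact: bmf_comp.
  rewrite summxE [RHS]big_mkcond; apply: eq_bigr => v _; rewrite !mxE.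
  rewrite (eq_sym j) (eq_sym k) -/(Q v); case: (Q v); rewrite ?mulr0//.
  rewrite mulr1 mulrC meanZ//; exact: bmf_comp.
rewrite mxE -meanZ// -meanB//; last exact: bmfZ.
have bd w : `|f (Z0 w) * \1_(S j k) (Z0 w) - eta * \sum_(v | Q v) yv v * \1_(cell v) (Z0 w)| <= 2 * eta / K.+1%:R.
  have [[nS ->]|[v [Sz _ cv ->]]] := sum_cell_jk yv j k (Z0 w).
    by rewrite indicE memNset// !mulr0 subr0 normr0.
  by rewrite indicE mem_set// mulr1 f_yv.
have bb := bmfB bfS (bmfZ eta bh).
rewrite ler_norml -[X in - X <= _](mean_cst P) -[X in _ && (_ <= X)](mean_cst P) -mulN1r -meanZ; last exact: bmf_cst.
apply/andP; split; apply: mean_le => //; try exact: bmf_cst; move=> w; have := bd w; rewrite ler_norml => /andP[? ?].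
  by rewrite mulN1r.
by [].
Qed.

Let E_prod (t : n.-tuple V) : E (\1_(\bigcap_i (Z i @^-1` cell (tnth t i)))) = \prod_(i < n) p (tnth t i).
Proof.
have mC v (Y : T -> D) : measurable_fun setT Y -> measurable (Y @^-1` cell v).
  by move=> mY; rewrite -[X in measurable X]setTI; exact: mY.
apply: EFin_inj; rewrite mean_indic; last first.
  by apply: fin_bigcap_measurable => [|i _]; [exact: finite_finset|exact: mC].
rewrite iid.1// -prodEFin; apply: eq_bigr => i _.
by rewrite iid.2// -mean_indic//; exact: mC.
Qed.

(** Each observation contributes an entrywise error of at most 2 eta/(K + 1), and so does each copy
    of the mean; the factor ab passes from entries to the operator norm. *)
Lemma discretized_tail (s e : R) : 0 <= s -> (a * b)%:R * (n%:R * (4 * eta / K.+1%:R)) <= e ->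
  measurable [set w | ~ opb (deviation w) (eta * s + e)] ->
  exists (V : finType) (p : V -> R) (jv : V -> 'I_a) (kv : V -> 'I_b) (yv : V -> R),
  [/\ forall v, 0 <= p v,
    forall j k, \sum_(v | (jv v == j) && (kv v == k)) p v = (a * b)%:R^-1,
    forall v, `|yv v| <= 1
    & (P [set w | ~ opb (deviation w) (eta * s + e)] <= (tail_prob p jv kv yv n s)%:E)%E].
Proof.
move=> s0 He mB; exists V, p, jv, kv, yv; split=> //.
have w0 : 0 <= 2 * eta / K.+1%:R by rewrite divr_ge0 ?mulr_ge0 ?(ltW K0).
set B := [set w | _] in mB *.
pose bad (M : 'M[R]_(a, b)) := op_ge s M.
pose C (t : n.-tuple V) := \bigcap_i (Z i @^-1` cell (tnth t i)).
have mC t : measurable (C t).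
  apply: fin_bigcap_measurable => [|i _]; first exact: finite_finset.
  by rewrite -[X in measurable X]setTI; exact: mZ.
(* [N] counts the observations that hit no [S j k]. It has mean 0 since the atoms carry total mass
   1; a pointwise bound by [N] thus replaces almost-sure reasoning. *)
pose N w := \sum_(i < n) (1 - \sum_j \sum_k \1_(S j k) (Z i w)) : R.
have bN i : bmf (fun w => 1 - \sum_j \sum_k \1_(S j k) (Z i w) : R).
  apply: bmfB; first exact: bmf_cst.
  by apply: bmf_sum => j; apply: bmf_sum => k; exact: bmf_comp.
have EN : E N = 0.
  rewrite mean_sum// big1// => i _; rewrite meanB; first last.
  - by apply: bmf_sum => j; apply: bmf_sum => k; exact: bmf_comp.
  - exact: bmf_cst.
  rewrite mean_cst mean_sum => [|j]; last by apply: bmf_sum => k; exact: bmf_comp.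
  rewrite (eq_bigr (fun=> \sum_(k < b) (a * b)%:R^-1)) => [|j _].
    under eq_bigr do rewrite sumr_const card_ord.
    by rewrite sumr_const card_ord -mulrnA (mulnC b) -[X in 1 - X]mulr_natr mulVf ?subrr// pnatr_eq0 muln_eq0 negb_or -!lt0n a0.
  rewrite mean_sum => [|k]; last exact: bmf_comp.
  apply: eq_bigr => k _; apply: EFin_inj; rewrite -(S_unif j k) -(iid.2 i _ (mS j k)).
  by rewrite -mean_indic// -[X in measurable X]setTI; exact: mZ.
have le w : \1_B w <= N w + \sum_(t | bad (W t)) \1_(C t) w :> R.
  have S01 i : (\sum_j \sum_k \1_(S j k) (Z i w) = 1 :> R /\ exists v, cell v (Z i w)) \/
      \sum_j \sum_k \1_(S j k) (Z i w) = 0 :> R.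
    have [[j [k Sz]]|nS] := pselect (exists j k, S j k (Z i w)); [left|right].
      split; last by have [v _ ?] := cell_exists Sz; exists v.
      rewrite (bigD1 j)//= (bigD1 k)//= indicE mem_set// !big1 ?addr0// => [j' jj'|k' kk'].
        rewrite big1// => k' _; rewrite indicE memNset// => Sz'.
        by have [/eqP] := S_disj Sz' Sz; rewrite (negPf jj').
      rewrite indicE memNset// => Sz'.
      by have [_ /eqP] := S_disj Sz' Sz; rewrite (negPf kk').
    by rewrite big1// => j _; rewrite big1// => k _; rewrite indicE memNset// => Sz; apply: nS; exists j, k.
  have N0 i : 0 <= 1 - \sum_j \sum_k \1_(S j k) (Z i w) :> R.
    by case: (S01 i) => [[-> _]|->]; lra.
  have sC0 : 0 <= \sum_(t | bad (W t)) \1_(C t) w :> R by apply: sumr_ge0 => t _; rewrite indicE.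
  have sN0 : 0 <= N w by apply: sumr_ge0.
  rewrite indicE; case: (boolP (w \in B)) => [|_]; last by rewrite addr_ge0.
  rewrite inE => Bw.
  have [[i Ni]|all] := pselect (exists i, ~ exists v, cell v (Z i w)).
    rewrite -[leLHS]addr0 lerD// /N (bigD1 i)//=.
    case: (S01 i) => [[_ /Ni]//|->]; rewrite subr0 lerDl sumr_ge0//.
  have /choice[t0 Ht0] i : exists v, cell v (Z i w).
    by apply: contrapT => H; apply: all; exists i.
  pose t := [tuple t0 i | i < n].
  have tE i : tnth t i = t0 i by rewrite tnth_mktuple.
  have Ct : C t w by move=> i _ /=; rewrite tE.
  have bt : bad (W t).
    apply: contrapT => /negP /not_op_ge Ws; apply: Bw.
    rewrite -[deviation w](subrK (eta *: W t)) addrC.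
    have wn0 : 0 <= n%:R * (4 * eta / K.+1%:R) by rewrite mulr_ge0// -[4 * eta]/(4 * eta) (_ : 4 * eta / K.+1%:R = 2 * (2 * eta / K.+1%:R)) ?mulr_ge0//; ring.
    have e1 : 0 <= (a * b)%:R * (n%:R * (4 * eta / K.+1%:R)) by rewrite mulr_ge0.
    apply: opbD; [exact: mulr_ge0|exact: le_trans He|exact: opbZ|].
    apply: opb_mono He _ => //; apply: opb_entries => // j k.
    have -> : (deviation w - eta *: W t) j k =
        \sum_(i < n) (f (Z i w) - eta * yv (t0 i)) * \1_(S j k) (Z i w)
        - n%:R * (mean_obs j k - eta * mean_step p jv kv yv j k).
      rewrite /deviation /W [LHS]mxE [X in X + _]mxE [X in _ + X]mxE [X in _ - X]mxE summxE.
      rewrite [X in _ - _ * X]mxE summxE [X in _ + X - _]mxE [X in _ + - X - _]mxE [X in _ - _ * (_ + X)]mxE [X in _ - _ * (_ - X)]mxE.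
      rewrite mulrBr mulr_sumr.
      have -> : \sum_(i < n) (f (Z i w) - eta * yv (t0 i)) * \1_(S j k) (Z i w) =
          \sum_(i < n) obs (Z i w) j k - \sum_(i < n) eta * (yv (tnth t i) *: atom (R := R) jv kv (tnth t i)) j k.
        rewrite -sumrB; apply: eq_bigr => i _.
        have -> : (yv (tnth t i) *: atom (R := R) jv kv (tnth t i)) j k = yv (t0 i) * \1_(S j k) (Z i w).
          by rewrite [LHS]mxE tE (atomE j k (Ht0 i)).
        by rewrite mxE; ring.
      ring.
    apply: le_trans (ler_normB _ _) _.
    have h1 : `|\sum_(i < n) (f (Z i w) - eta * yv (t0 i)) * \1_(S j k) (Z i w)| <= n%:R * (2 * eta / K.+1%:R).
      apply: le_trans (ler_norm_sum _ _ _) _.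
      apply: (@le_trans _ _ (\sum_(i < n) (2 * eta / K.+1%:R))); last by rewrite sumr_const card_ord [leRHS]mulr_natl.
      apply: ler_sum => i _; rewrite normrM -[leRHS]mulr1 ler_pM//; first exact: f_yv.
      by rewrite indicE; case: (_ \in _); rewrite ?normr1 ?normr0.
    have h2 : `|n%:R * (mean_obs j k - eta * mean_step p jv kv yv j k)| <= n%:R * (2 * eta / K.+1%:R).
      by rewrite normrM ger0_norm// ler_wpM2l.
    apply: le_trans (lerD h1 h2) _; rewrite le_eqVlt; apply/orP; left; apply/eqP; ring.
  rewrite -[leLHS]add0r lerD// (bigD1 t)//= indicE mem_set// lerDl.
  by apply: sumr_ge0 => ? _; rewrite indicE.
rewrite -mean_indic// lee_fin.
have bC : bmf (fun w => \sum_(t | bad (W t)) \1_(C t) w : R).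
  by apply: bmf_sum => t; exact: bmf_indic.
have bN' : bmf N by exact: bmf_sum.
apply: le_trans (mean_le P (bmf_indic mB) (bmfD bN' bC) le) _.
rewrite meanD// EN add0r mean_sum => [|t]; last exact: bmf_indic.
by rewrite le_eqVlt; apply/orP; left; apply/eqP; apply: eq_bigr => t _; rewrite E_prod.
Qed.

End Discretization.

(** The discretization slack is removed by exhausting the event from inside, with levels raised by
    1/(q + 1), and by continuity of the measure from below. *)
Theorem deviation_tail (s beta : R) : 0 <= eta -> 0 <= s ->
  (forall (V : finType) (p : V -> R) (jv : V -> 'I_a) (kv : V -> 'I_b) (yv : V -> R),
    (forall v, 0 <= p v) ->
    (forall j k, \sum_(v | (jv v == j) && (kv v == k)) p v = (a * b)%:R^-1) ->
    (forall v, `|yv v| <= 1) -> tail_prob p jv kv yv n s <= beta) ->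
  measurable [set w | ~ opb (deviation w) (eta * s)] /\
  (P [set w | ~ opb (deviation w) (eta * s)] <= beta%:E)%E.
Proof.
move=> eta0 s0 Hb; have es0 : 0 <= eta * s by rewrite mulr_ge0.
have mB c : 0 <= c -> measurable [set w | ~ opb (deviation w) c].
  move=> c0; apply: (measurable_of_locally_stable measurable_deviation) => w /= Bw.
  by have [e e0 He] := not_opb_stable a0 b0 c0 Bw; exists e => // w'; exact: He.
split; first exact: mB.
have q0 (q : nat) : 0 < q.+1%:R^-1 :> R by rewrite invr_gt0 ltr0n.
pose F (q : nat) := [set w | ~ opb (deviation w) (eta * s + q.+1%:R^-1)].
have mF q : measurable (F q) by apply: mB; rewrite addr_ge0// ltW.
have UF : \bigcup_q F q = [set w | ~ opb (deviation w) (eta * s)].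
  apply/seteqP; split=> [w [q _] nb|w /= nb].
    by move=> /= wb; apply: nb; apply: opb_mono wb => //; rewrite lerDl ltW.
  apply: contrapT => H; apply: nb; apply: opb_limit => // e e0.
  have wq : opb (deviation w) (eta * s + (Num.truncn e^-1).+1%:R^-1).
    by apply: contrapT => K; apply: H; exists (Num.truncn e^-1).
  apply: opb_mono wq; first by rewrite addr_ge0// ltW.
  by rewrite lerD2l invf_ple ?posrE ?ltr0n// ltW// truncnS_gt.
have Fb q : (P (F q) <= beta%:E)%E.
  pose K := Num.truncn ((a * b)%:R * (n%:R * (4 * eta)) * q.+1%:R).
  have KE : (a * b)%:R * (n%:R * (4 * eta / K.+1%:R)) <= q.+1%:R^-1.
    rewrite -[leRHS]mul1r ler_pdivlMr ?ltr0n//.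
    have -> : (a * b)%:R * (n%:R * (4 * eta / K.+1%:R)) * q.+1%:R =
      (a * b)%:R * (n%:R * (4 * eta)) * q.+1%:R / K.+1%:R by ring.
    by rewrite ler_pdivrMr ?ltr0n// mul1r ltW// truncnS_gt.
  have [V [p [jv [kv [yv [p0 mg y1 le]]]]]] := discretized_tail eta0 s0 KE (mF q).
  by apply: le_trans le _; rewrite lee_fin; exact: Hb.
have mU : measurable (\bigcup_q F q) by rewrite UF; exact: mB.
have ndF : {homo F : n m / (n <= m)%N >-> (n <= m)%O}.
  move=> q r qr; rewrite subsetEset => w /= nb wb; apply: nb.
  apply: opb_mono wb; first by rewrite addr_ge0// ltW.
  by rewrite lerD2l lef_pV2 ?posrE ?ltr0n// ler_nat.
have cv := nondecreasing_cvg_mu (mu := P) mF mU ndF; rewrite -UF.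
have := cvg_lim (@ereal_hausdorff R) cv => <-.
apply: lime_le; first by apply/cvg_ex; eexists; exact: cv.
by apply: nearW => q; exact: Fb.
Qed.

End Sampling_transfer.

Arguments deviation {d T R} P {d' D n} Z Z0 {a b} S f w.
Arguments mean_obs {d T R} P {d' D} Z0 {a b} S f.

Section Unordered_dimensions.
Context {d : measure_display} {T : measurableType d} {R : realType} {P : probability T R}
  {d' : measure_display} {D : measurableType d'} {n : nat}.
Variables (Z : 'I_n -> T -> D) (Z0 : T -> D).
Hypotheses (mZ : forall i, measurable_fun setT (Z i))
  (mZ0 : measurable_fun setT Z0) (iid : iid_replications P Z Z0).
Context {a b : nat}.
Variables (S : 'I_a -> 'I_b -> set D) (f : D -> R) (eta : R).
Hypotheses (a0 : (0 < a)%N) (b0 : (0 < b)%N) (mS : forall j k, measurable (S j k))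
  (S_disj : forall j k j' k' z, S j k z -> S j' k' z -> j = j' /\ k = k')
  (S_unif : forall j k, P (Z0 @^-1` S j k) = ((a * b)%:R^-1)%:E)
  (mf : measurable_fun setT f) (f_bd : forall z, `|f z| <= eta).

(** The tail bounds suppose a <= b; otherwise rows and columns are exchanged, which transposes the
    deviation and keeps its operator norm. *)
Theorem deviation_tail_unordered (s beta : R) : 0 <= eta -> 0 <= s ->
  (forall (a' b' : nat) (V : finType) (p : V -> R) (jv : V -> 'I_a') (kv : V -> 'I_b') (yv : V -> R),
    (a' <= b')%N -> a' = minn a b -> (a' + b')%N = (a + b)%N -> (0 < a')%N -> (0 < b')%N ->
    (forall v, 0 <= p v) ->
    (forall j k, \sum_(v | (jv v == j) && (kv v == k)) p v = (a' * b')%:R^-1) ->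
    (forall v, `|yv v| <= 1) -> tail_prob p jv kv yv n s <= beta) ->
  measurable [set w | ~ opb (deviation P Z Z0 S f w) (eta * s)] /\
  (P [set w | ~ opb (deviation P Z Z0 S f w) (eta * s)] <= beta%:E)%E.
Proof.
move=> eta0 s0 Hb; have es0 : 0 <= eta * s by rewrite mulr_ge0.
have [ab|/ltnW ba] := leqP a b.
  apply: (deviation_tail mZ mZ0 iid a0 b0 mS S_disj S_unif mf f_bd eta0 s0) => *.
  by apply: Hb => //; rewrite (minn_idPl ab).
pose S' k j := S j k.
have -> : [set w | ~ opb (deviation P Z Z0 S f w) (eta * s)] =
    [set w | ~ opb (deviation P Z Z0 S' f w) (eta * s)].
  have tr w : (deviation P Z Z0 S f w)^T = deviation P Z Z0 S' f w.
    by apply/matrixP => k j; rewrite !mxE !summxE; congr (_ - _); apply: eq_bigr => i _; rewrite !mxE.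
  apply/seteqP; split=> w /= nb H; apply: nb.
    by rewrite -[deviation P Z Z0 S f w]trmxK tr; exact: opb_tr.
  by rewrite -tr; exact: opb_tr.
apply: deviation_tail => //.
- by move=> k j; exact: mS.
- by move=> k j k' j' z h h'; have [-> ->] := S_disj h h'.
- by move=> k j; rewrite mulnC; exact: S_unif.
- by move=> *; apply: Hb => //; rewrite ?(minn_idPr ba)// addnC.
Qed.

(** Only the masses of the atoms are assumed; that almost nothing lies outside them follows because
    they add up to 1. *)
Lemma atoms_full (Y : T -> D) : measurable_fun setT Y -> same_law P Y Z0 ->
  P [set w | ~ exists j k, S j k (Y w)] = 0.
Proof.
move=> mY lY.
have mSY j k : measurable (Y @^-1` S j k) by rewrite -[X in measurable X]setTI; exact: mY.
set B := [set w | _].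
have BE : B = ~` \bigcup_(jk : 'I_a * 'I_b) (Y @^-1` S jk.1 jk.2).
  apply/seteqP; split=> [w /= nb [[j k] _ Sw]|w nb [j [k Sw]]]; first by apply: nb; exists j, k.
  by apply: nb; exists (j, k).
have mB : measurable B.
  by rewrite BE; apply: measurableC; apply: countable_bigcupT_measurable => [|jk]; [exact: countableP|exact: mSY].
have bS j k : bmf (\1_(Y @^-1` S j k) : T -> R) by exact: bmf_indic.
have bSS : bmf (fun w => \sum_j \sum_k \1_(Y @^-1` S j k) w : R).
  by apply: bmf_sum => j; exact: bmf_sum.
rewrite -mean_indic// (_ : \1_B = fun w => 1 - \sum_j \sum_k \1_(Y @^-1` S j k) w).
  rewrite meanB//; last exact: bmf_cst.
  rewrite mean_cst mean_sum => [|j]; last exact: bmf_sum.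
  rewrite (eq_bigr (fun=> \sum_(k < b) (a * b)%:R^-1)) => [|j _].
    under eq_bigr do rewrite sumr_const card_ord.
    rewrite sumr_const card_ord -mulrnA (mulnC b) -[X in 1 - X]mulr_natr mulVf ?subrr//.
    by rewrite pnatr_eq0 muln_eq0 negb_or -!lt0n a0.
  rewrite mean_sum//; apply: eq_bigr => k _; apply: EFin_inj.
  by rewrite -(S_unif j k) -(lY _ (mS j k)) -mean_indic.
apply/funext => w; rewrite indicE; have [[j [k Sw]]|nS] := pselect (exists j k, S j k (Y w)).
  rewrite memNset; last by move=> /= /(_ (ex_intro _ j (ex_intro _ k Sw))).
  rewrite (bigD1 j)//= (bigD1 k)//= indicE mem_set// !big1 ?addr0 ?subrr// => [j' jj'|k' kk'].
    rewrite big1// => k' _; rewrite indicE memNset// => Sz'.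
    by have [/eqP] := S_disj Sz' Sw; rewrite (negPf jj').
  rewrite indicE memNset// => Sz'.
  by have [_ /eqP] := S_disj Sz' Sw; rewrite (negPf kk').
rewrite mem_set// big1 ?subr0// => j _; rewrite big1// => k _.
by rewrite indicE memNset// => Sz; apply: nS; exists j, k.
Qed.

End Unordered_dimensions.

Lemma tail_prob_le3 {R : realType} {V : finType} {a b : nat} (p : V -> R) (jv : V -> 'I_a)
    (kv : V -> 'I_b) (yv : V -> R) (n : nat) (L : R) (de := n%:R / a%:R : R) :
  (0 < a)%N -> (0 < b)%N -> (forall v, 0 <= p v) ->
  (forall j k, \sum_(v | (jv v == j) && (kv v == k)) p v = (a * b)%:R^-1) ->
  (forall v, `|yv v| <= 1) -> (a <= b)%N -> (0 < n)%N -> expR L = (a + b)%:R -> 4 * L <= de ->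
  tail_prob p jv kv yv n (2 * Num.sqrt (de * L)) <= 3 / (a + b)%:R.
Proof.
move=> *; have [L7|/ltW L7] := leP L (15 / 2); first exact: small_dim_tail.
exact: second_order_tail.
Qed.

(** * Risk, estimator and the event of small error *)

Section Trace_regression.
Context {R : realType} {d : measure_display} {Omega : measurableType d}
  {P : probability Omega R} {m1 m2 n : nat}.
Hypotheses (m1_gt0 : (0 < m1)%N) (m2_gt0 : (0 < m2)%N) (n_gt0 : (0 < n)%N).
Variables (X : {RV P >-> borelMx R m1 m2}) (Y : {RV P >-> R})
  (Xs : 'I_n -> {RV P >-> borelMx R m1 m2}) (Ys : 'I_n -> {RV P >-> R}).
Hypotheses (iid : iid_replications P (fun i w => (Xs i w, Ys i w)) (fun w => (X w, Y w)))
  (X_unif : uniform_basis P X).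
Variable eta : R.
Hypothesis Y_bounded : {ae P, forall w, `|Y w| <= eta}.

Let D := (borelMx R m1 m2 * R)%type.
Let S (j : 'I_m1) (k : 'I_m2) : set D := [set z | z.1 = delta_mx j k].
(** Clamping makes the response bounded everywhere; it changes nothing off the null set [bad]. *)
Let f (z : D) : R := Num.max (- eta) (Num.min eta z.2).
Let Z (i : 'I_n) w : D := (Xs i w, Ys i w).
Let Z0 w : D := (X w, Y w).
Let c : R := (m1 * m2)%:R.
Let A0 : 'M[R]_(m1, m2) := c *: mean_obs P Z0 S f.

Let c0 : 0 < c. Proof. by rewrite ltr0n muln_gt0 m1_gt0. Qed.
Let n0 : 0 < n%:R :> R. Proof. by rewrite ltr0n. Qed.

(** A negative [eta] would make the whole space negligible. *)
Lemma response_bound_ge0 : 0 <= eta.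
Proof.
rewrite leNgt; apply/negP => e0.
have : P.-negligible [set: Omega].
  apply: negligibleS Y_bounded => w _ /= h; have := le_trans (normr_ge0 _) h.
  by rewrite leNgt e0.
move/negligibleP => /(_ measurableT) PT.
have P1 : P setT = 1%E := @probability_setT _ _ _ P.
by move: P1; rewrite PT => /eqP; rewrite eqe eq_sym oner_eq0.
Qed.
Let eta0 := response_bound_ge0.

Let mZ i : measurable_fun setT (Z i).
Proof. by apply: measurable_fun_pair. Qed.
Let mZ0 : measurable_fun setT Z0.
Proof. by apply: measurable_fun_pair. Qed.

Let m_open (U : set (borelMx R m1 m2)) : @open 'M[R]_(m1, m2) U -> measurable U.
Proof. by move=> oU; exact: sub_sigma_algebra. Qed.

Let m_entry j k : measurable_fun setT (fun M : borelMx R m1 m2 => (M : 'M[R]_(m1, m2)) j k).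
Proof.
apply: (measurability _ (RGenOpens.measurableE R)) => _ [_ [a [b ->] <-]].
rewrite setTI; apply: m_open.
have /continuousP := @coord_continuous R m1 m2 j k; apply; exact: interval_open.
Qed.

Let m_RV (W : {RV P >-> borelMx R m1 m2}) j k : measurable_fun setT (fun w => (W w : 'M[R]_(m1, m2)) j k).
Proof.
have mW : measurable_fun setT (W : Omega -> borelMx R m1 m2) by [].
exact: (measurableT_comp (m_entry j k) mW).
Qed.

Let mS j k : measurable (S j k).
Proof.
have -> : S j k = setT `&` fst @^-1` [set (delta_mx j k : borelMx R m1 m2)].
  by rewrite setTI.
apply: measurable_fst => //.
have -> : [set (delta_mx j k : borelMx R m1 m2)] = \bigcap_(ab : 'I_m1 * 'I_m2)
    ((fun M : borelMx R m1 m2 => (M : 'M[R]_(m1, m2)) ab.1 ab.2) @^-1` [set delta_mx j k ab.1 ab.2]).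
  apply/seteqP; split=> [M /= -> //|M H]; apply/matrixP => i l; exact: (H (i, l)).
apply: fin_bigcap_measurable => [|ab _]; first exact: finite_finset.
by rewrite -[X in measurable X]setTI; exact: m_entry.
Qed.

Let S_disj j k j' k' z : S j k z -> S j' k' z -> j = j' /\ k = k'.
Proof.
move=> h h'; have /matrixP /(_ j k) : delta_mx j k = delta_mx j' k' :> 'M[R]_(m1, m2) by exact: etrans (esym h) h'.
rewrite !mxE !eqxx /=.
by case: eqP => [->|] /=; [case: eqP => [->|] //= _ /eqP|move=> _ /eqP]; rewrite oner_eq0.
Qed.

Let S_unif j k : P (Z0 @^-1` S j k) = ((m1 * m2)%:R^-1)%:E.
Proof. exact: X_unif. Qed.

Let mf : measurable_fun setT f.
Proof.
apply: (measurable_maxr (f := fun=> - eta)) => //.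
apply: (measurable_minr (f := fun=> eta)) => //; exact: measurable_snd.
Qed.

Let f_bd z : `|f z| <= eta.
Proof.
rewrite ler_norml /f le_max lexx /= ge_max ge_min lexx /= andbT.
by have := eta0; lra.
Qed.

Let f_id z : `|z.2| <= eta -> f z = z.2.
Proof.
rewrite ler_norml => /andP[h1 h2]; rewrite /f min_r// max_r//.
Qed.

Let obs_id (z : D) : (exists j k, S j k z) -> `|z.2| <= eta -> obs S f z = z.2 *: z.1.
Proof.
move=> [j [k zE]] /f_id fz; apply/matrixP => j' k'; rewrite !mxE fz zE mxE indicE; congr (_ * (nat_of_bool _)%:R).
apply/idP/idP => [|/andP[/eqP -> /eqP ->]]; last by rewrite mem_set.
by rewrite inE => h; have [-> ->] := S_disj h zE; rewrite !eqxx.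
Qed.

Let bad : set D := [set z | ~ (exists j k, S j k z) \/ eta < `|z.2|].

Let bad_null (W : Omega -> D) : measurable_fun setT W -> same_law P W Z0 -> measurable (W @^-1` bad) /\ P (W @^-1` bad) = 0.
Proof.
move=> mW lW.
have mno : measurable [set z : D | ~ exists j k, S j k z].
  have -> : [set z | ~ exists j k, S j k z] = ~` \bigcup_(jk : 'I_m1 * 'I_m2) S jk.1 jk.2.
    apply/seteqP; split=> [z /= nb [[j k] _ Sz]|z nb [j [k Sz]]]; first by apply: nb; exists j, k.
    by apply: nb; exists (j, k).
  apply: measurableC; apply: countable_bigcupT_measurable => [|jk]; [exact: countableP|exact: mS].
have mbig : measurable [set z : D | eta < `|z.2|].
  rewrite -[X in measurable X]setTI.
  apply: measurable_fun_ltr => //; apply: measurableT_comp => //; exact: measurable_snd.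
have mbad : measurable bad by exact: measurableU.
have mWb : measurable (W @^-1` bad) by rewrite -[X in measurable X]setTI; exact: mW.
split=> //; rewrite (lW _ mbad); apply: measure_negligible.
  by rewrite -[X in measurable X]setTI; exact: mZ0.
have -> : Z0 @^-1` bad = [set w | ~ exists j k, S j k (Z0 w)] `|` [set w | eta < `|Y w|] by [].
apply: negligibleU.
  have mA : measurable [set w | ~ exists j k, S j k (Z0 w)].
    by rewrite -[X in measurable X]setTI; exact: (mZ0 measurableT mno).
  apply/negligibleP => //; exact: (atoms_full m1_gt0 m2_gt0 mS S_disj S_unif mZ0).
by apply: negligibleS Y_bounded => w /= h /= h'; move: h; rewrite ltNge h'.
Qed.

Let mean_obsE j k : mean_obs P Z0 S f j k = A0 j k / c.
Proof. by rewrite [A0 j k]mxE mulrC mulKf// gt_eqF. Qed.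

Theorem risk_decomposition : exists r0 : R, forall A,
  risk P X Y A = (r0 + fro2 (A - A0) / c)%:E.
Proof.
exists (Rintegral P setT (fun w => f (Z0 w) ^+ 2) - fro2 A0 / c) => A.
have bZ (g : D -> R) : bmf g -> bmf (fun w => g (Z0 w)) by exact: bmf_comp.
have bf : bmf f by split; last exists eta.
have bS j k : bmf (\1_(S j k) : D -> R) by exact: bmf_indic.
(* Off [bad] exactly one [S j k] holds, and <A, X> = A j k there, so [g] is the squared residual
   expanded into bounded terms. *)
pose g w := f (Z0 w) * f (Z0 w) + \sum_j \sum_k
  ((- (2 * A j k)) * (f (Z0 w) * \1_(S j k) (Z0 w)) + A j k ^+ 2 * \1_(S j k) (Z0 w)).
have bfS j k : bmf (fun w => f (Z0 w) * \1_(S j k) (Z0 w)) by apply: bmfM; exact: bZ.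
have bjk j k : bmf (fun w => (- (2 * A j k)) * (f (Z0 w) * \1_(S j k) (Z0 w)) + A j k ^+ 2 * \1_(S j k) (Z0 w)).
  by apply: bmfD; apply: bmfZ => //; exact: bZ.
have bff : bmf (fun w => f (Z0 w) * f (Z0 w)) by apply: bmfM; exact: bZ.
have bsum : bmf (fun w => \sum_j \sum_k ((- (2 * A j k)) * (f (Z0 w) * \1_(S j k) (Z0 w)) + A j k ^+ 2 * \1_(S j k) (Z0 w))).
  by apply: bmf_sum => j; exact: bmf_sum.
have bg : bmf g by exact: bmfD.
have -> : risk P X Y A = (Rintegral P setT g)%:E.
  rewrite /Rintegral fineK; last exact: (integrable_fin_num measurableT (bmf_integrable P bg)).
  rewrite /risk unlock; apply: ae_eq_integral => //.
  - apply/measurable_EFinP; apply: measurable_funX; apply: measurable_funB => //.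
    rewrite (_ : (fun _ => _) = fun w => \sum_(j < m1) \sum_(k < m2) A j k * (X w : 'M[R]_(m1, m2)) j k).
      apply: measurable_sum => j; apply: measurable_sum => k; apply: measurable_funM => //.
    by apply/funext => w; rewrite mx_innerE.
  - by apply/measurable_EFinP; case: bg.
  have [mN PN] := bad_null mZ0 (fun _ _ => erefl).
  exists (Z0 @^-1` bad); split=> // w /= nE; apply: contrapT => /not_orP[/contrapT [j [k Sz]] /negP]; rewrite -leNgt => Yb; apply: nE => _.
  congr (_%:E); rewrite /g (f_id Yb) /= (bigD1 j)//= (bigD1 k)//= !big1 ?addr0; first last.
  - by move=> k' kk'; rewrite indicE memNset ?mulr0 ?addr0// => h; have [_ /eqP] := S_disj h Sz; rewrite (negPf kk').
  - move=> j' jj'; rewrite big1// => k' _; rewrite indicE memNset ?mulr0 ?addr0// => h.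
    by have [/eqP] := S_disj h Sz; rewrite (negPf jj').
  have -> : mx_inner A (X w) = A j k.
    have -> : (X w : 'M[R]_(m1, m2)) = delta_mx j k by exact: Sz.
    rewrite mx_innerE (bigD1 j)//= (bigD1 k)//= !big1 ?addr0 => [|j' jj'|k' kk'].
    - by rewrite mxE !eqxx mulr1.
    - by rewrite big1// => k' _; rewrite mxE (negPf jj') mulr0.
    - by rewrite mxE (negPf kk') andbF mulr0.
  have -> : \1_(S j k) (Z0 w) = 1 :> R by rewrite indicE mem_set.
  by rewrite /Z0 /=; ring.
congr (_%:E); rewrite meanD// mean_sum => [|j]; last exact: bmf_sum.
have -> : \sum_j Rintegral P setT (fun w => \sum_k ((- (2 * A j k)) * (f (Z0 w) * \1_(S j k) (Z0 w)) + A j k ^+ 2 * \1_(S j k) (Z0 w))) =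
    \sum_j \sum_k (- (2 * (A j k * A0 j k)) + A j k ^+ 2) / c.
  apply: eq_bigr => j _; rewrite mean_sum => [|//]; apply: eq_bigr => k _.
  rewrite meanD ?meanZ//; try (by apply: bmfZ => //; exact: bZ); try exact: bZ.
  have -> : Rintegral P setT (fun w => f (Z0 w) * \1_(S j k) (Z0 w)) = A0 j k / c.
    by rewrite -mean_obsE mxE.
  have -> : Rintegral P setT (fun w => \1_(S j k) (Z0 w)) = c^-1.
    by apply: EFin_inj; rewrite -(S_unif j k) -mean_indic// -[X in measurable X]setTI; exact: mZ0.
  by ring.
rewrite fro2B -addrA; congr (_ + _).
transitivity ((fro2 A - 2 * mx_inner A A0) / c); last by ring.
rewrite fro2E mx_innerE mulr_sumr -sumrB mulr_suml; apply: eq_bigr => j _.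
rewrite mulr_sumr -sumrB mulr_suml; apply: eq_bigr => k _; ring.
Qed.

Let Zm w : 'M[R]_(m1, m2) := (c / n%:R) *: \sum_(i < n) Ys i w *: (Xs i w : 'M[R]_(m1, m2)).

Let deviationE w : (forall i, ~ bad (Z i w)) -> Zm w - A0 = (c / n%:R) *: deviation P Z Z0 S f w.
Proof.
move=> nb; rewrite /deviation scalerBr scalerA divfK ?gt_eqF//; congr (_ *: _ - _).
apply: eq_bigr => i _; rewrite obs_id//.
  by apply: contrapT => H; apply: (nb i); left.
by rewrite leNgt; apply/negP => H; apply: (nb i); right.
Qed.

Section Estimator.
Variables (lambda : R) (Ahat : Omega -> 'M[R]_(m1, m2)).
Hypotheses (lambda0 : 0 <= lambda) (est : is_nuclear_estimator lambda Xs Ys Ahat).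
Let tau := c * lambda / 2.

Let tau0 : 0 <= tau.
Proof. by rewrite divr_ge0 ?mulr_ge0 ?(ltW c0). Qed.

Let est_prox w B : prox_crit tau (Zm w) (Ahat w) <= prox_crit tau (Zm w) B.
Proof.
have E A : prox_crit tau (Zm w) A = c * penalized_criterion lambda (fun i => Xs i w) (fun i => Ys i w) A.
  rewrite /prox_crit /penalized_criterion frobenius_norm_sq /Zm /tau -/c !mx_innerZl.
  by move: (c) c0 (n%:R : R) n0 => c' c'0 n' n'0; field; rewrite !gt_eqF.
by rewrite !E ler_pM2l//; exact: (est w B).
Qed.

Lemma measurable_error_le kappa : measurable [set w | fro2 (Ahat w - A0) <= kappa].
Proof.
rewrite -[X in measurable X]setCK; apply: measurableC.
apply: (measurable_of_locally_stable (F := Zm)) => [i j|w /negP].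
  rewrite (_ : (fun _ => _) = fun w => c / n%:R * \sum_(l < n) Ys l w * (Xs l w : 'M[R]_(m1, m2)) i j).
    apply: measurable_funM => //; apply: measurable_sum => l; exact: measurable_funM.
  by apply/funext => w; rewrite !mxE summxE; congr (_ * _); apply: eq_bigr => l _; rewrite mxE.
rewrite -ltNge => kw.
have [k0|k0] := ltP kappa 0.
  by exists 1 => // w' _ /= H; have := le_lt_trans (le_trans (fro2_ge0 _) H) k0; rewrite ltxx.
pose g := fro2 (Ahat w - A0) - kappa; have g0 : 0 < g by rewrite subr_gt0.
(* [t] and [r] share the gap [g]: (1 + t) kappa stays below kappa + g/2 and (1 + 1/t) r equals g/2,
   whereas the error at [w] is kappa + g. *)
pose t := g / (2 * (kappa + 1)); have t0 : 0 < t by rewrite divr_gt0// mulr_gt0//; lra.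
have tk : t * kappa < g / 2.
  have -> : t * kappa = g / 2 * (kappa / (kappa + 1)) by rewrite /t; field; lra.
  by rewrite gtr_pMr ?divr_gt0// ltr_pdivrMr; lra.
have u0 : 0 < 1 + t^-1 by rewrite addr_gt0// invr_gt0.
pose r := g / 2 / (1 + t^-1); have r0 : 0 < r by rewrite !divr_gt0.
pose e := Num.min 1 (r / c).
have e0 : 0 < e by rewrite lt_min ltr01 divr_gt0.
exists e => // w' He /= H.
have d1 : fro2 (Ahat w - Ahat w') <= r.
  apply: le_trans (prox_lipschitz tau0 (est_prox w) (est_prox w')) _.
  rewrite fro2E; apply: (@le_trans _ _ (\sum_(i < m1) \sum_(j < m2) e)).
    apply: ler_sum => i _; apply: ler_sum => j _; rewrite -real_normK ?num_real// [(Zm w - Zm w') i j]mxE [(- Zm w') i j]mxE.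
    have h := ltW (He i j); apply: le_trans (_ : e ^+ 2 <= e); first by rewrite lerXn2r ?nnegrE// ltW.
    by rewrite expr2 ler_piMr ?(ltW e0)// ge_min lexx.
  under eq_bigr do rewrite sumr_const card_ord.
  rewrite sumr_const card_ord -mulrnA mulnC -[leLHS]mulr_natl -/c -(ler_pdivlMl _ _ c0) mulrC.
  by rewrite ge_min lexx orbT.
have := fro2D_le (Ahat w' - A0) (Ahat w - Ahat w') t0.
have -> : Ahat w' - A0 + (Ahat w - Ahat w') = Ahat w - A0 by rewrite addrC addrA subrK.
move=> h.
have h1 : (1 + t) * fro2 (Ahat w' - A0) <= (1 + t) * kappa by rewrite ler_wpM2l//; lra.
have h2 : (1 + t^-1) * fro2 (Ahat w - Ahat w') <= g / 2.
  by apply: le_trans (ler_wpM2l (ltW u0) d1) _; rewrite /r mulrC divfK// gt_eqF.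
by move: h h1 h2 tk; rewrite /g; lra.
Qed.

(** Both claims say that the error is at most a deterministic level [kappa]; the last hypothesis is
    the oracle inequality giving that level. The condition on [lambda] is (c/n) eta s <= tau, which
    carries the deviation bound over to Z - A0. *)
Theorem error_event_prob (s beta kappa : R) : 0 <= s -> eta * s <= n%:R * lambda / 2 ->
  (forall (a b : nat) (V : finType) (p : V -> R) (jv : V -> 'I_a) (kv : V -> 'I_b) (yv : V -> R),
    (a <= b)%N -> a = minn m1 m2 -> (a + b)%N = (m1 + m2)%N -> (0 < a)%N -> (0 < b)%N ->
    (forall v, 0 <= p v) ->
    (forall j k, \sum_(v | (jv v == j) && (kv v == k)) p v = (a * b)%:R^-1) ->
    (forall v, `|yv v| <= 1) -> tail_prob p jv kv yv n s <= beta) ->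
  (forall Zw Aw, opb (Zw - A0) tau -> (forall B, prox_crit tau Zw Aw <= prox_crit tau Zw B) -> fro2 (Aw - A0) <= kappa) ->
  with_prob_ge P [set w | fro2 (Ahat w - A0) <= kappa] (1 - beta).
Proof.
move=> s0 sl Hb Hk; have mG := measurable_error_le kappa; split=> //.
have [mB PB] := deviation_tail_unordered mZ mZ0 iid m1_gt0 m2_gt0 mS S_disj S_unif mf f_bd eta0 s0 Hb.
set B := [set w | _] in mB PB; set G := [set w | _] in mG *.
have sl' i : same_law P (Z i) Z0 by exact: iid.2.
have mN i := (bad_null (mZ i) (sl' i)).1.
have PN i := (bad_null (mZ i) (sl' i)).2.
have bN i : bmf (\1_(Z i @^-1` bad) : Omega -> R) by exact: bmf_indic.
have bB : bmf (\1_B : Omega -> R) by exact: bmf_indic.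
have bsN : bmf (fun w => \sum_(i < n) \1_(Z i @^-1` bad) w : R) by exact: bmf_sum.
have le w : 1 - (\1_B w + \sum_(i < n) \1_(Z i @^-1` bad) w) <= \1_G w :> R.
  have sN : 0 <= \sum_(i < n) \1_(Z i @^-1` bad) w :> R by apply: sumr_ge0 => i _; rewrite indicE.
  have G0 : 0 <= \1_G w :> R by rewrite indicE.
  have [Bw|nBw] := pselect (B w).
    have -> : \1_B w = 1 :> R by rewrite indicE mem_set.
    by move: sN G0; lra.
  have [[i Ni]|nN] := pselect (exists i, bad (Z i w)).
    have : 1 <= \sum_(i < n) \1_(Z i @^-1` bad) w :> R.
      rewrite (bigD1 i)//= indicE mem_set// lerDl.
      by apply: sumr_ge0 => l _; rewrite indicE.
    have : 0 <= \1_B w :> R by rewrite indicE.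
    by move: G0; lra.
  have nbad i : ~ bad (Z i w) by move=> H; apply: nN; exists i.
  have Gw : G w.
    apply: Hk (est_prox w); rewrite deviationE//.
    have cn0 : 0 <= c / n%:R by rewrite divr_ge0 ?(ltW c0).
    apply: opb_mono (opbZ (c / n%:R) (contrapT nBw)).
      by rewrite mulr_ge0// mulr_ge0.
    rewrite -[leRHS](_ : c / n%:R * (n%:R * lambda / 2) = _) ?ler_wpM2l//.
    by rewrite /tau; move: (c) (n%:R : R) n0 => c' n' n'0; field; rewrite gt_eqF.
  have -> : \1_G w = 1 :> R by rewrite indicE mem_set.
  by rewrite lerBlDr lerDl addr_ge0// indicE.
rewrite -mean_indic// lee_fin.
have := mean_le P (bmfB (bmf_cst 1) (bmfD bB bsN)) (bmf_indic mG) le.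
rewrite meanB; [|exact: bmf_cst|exact: bmfD]; rewrite mean_cst meanD// mean_sum//.
rewrite [X in _ - (_ + X)]big1 ?addr0 => [|i _]; last by apply: EFin_inj; rewrite mean_indic.
apply: le_trans; rewrite lerD2l lerN2 -lee_fin mean_indic//.
Qed.

End Estimator.

Theorem risk_and_error_prob : exists (A0 : 'M[R]_(m1, m2)) (r0 : R),
  (forall A, risk P X Y A = (r0 + fro2 (A - A0) / (m1 * m2)%:R)%:E) /\
  forall (lambda : R) (Ahat : Omega -> 'M[R]_(m1, m2)) (s beta kappa : R),
    let tau := (m1 * m2)%:R * lambda / 2 in
    0 <= lambda -> is_nuclear_estimator lambda Xs Ys Ahat ->
    0 <= s -> eta * s <= n%:R * lambda / 2 ->
    (forall (a b : nat) (V : finType) (p : V -> R) (jv : V -> 'I_a) (kv : V -> 'I_b) (yv : V -> R),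
      (a <= b)%N -> a = minn m1 m2 -> (a + b)%N = (m1 + m2)%N -> (0 < a)%N -> (0 < b)%N ->
      (forall v, 0 <= p v) ->
      (forall j k, \sum_(v | (jv v == j) && (kv v == k)) p v = (a * b)%:R^-1) ->
      (forall v, `|yv v| <= 1) -> tail_prob p jv kv yv n s <= beta) ->
    (forall Zw Aw, opb (Zw - A0) tau -> (forall B, prox_crit tau Zw Aw <= prox_crit tau Zw B) ->
      fro2 (Aw - A0) <= kappa) ->
    with_prob_ge P [set w | fro2 (Ahat w - A0) <= kappa] (1 - beta).
Proof.
have [r0 rE] := risk_decomposition; exists A0, r0; split=> // lambda Ahat s beta kappa /= l0 est.
exact: error_event_prob.
Qed.

End Trace_regression.

(** * Assembly of the two claims *)

Theorem theorem9 (R : realType) (d : measure_display) (Omega : measurableType d)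
    (P : probability Omega R) (m1 m2 n : nat)
    (m1_gt0 : (0 < m1)%N) (m2_gt0 : (0 < m2)%N) (n_gt0 : (0 < n)%N)
    (X : {RV P >-> borelMx R m1 m2}) (Y : {RV P >-> R})
    (Xs : 'I_n -> {RV P >-> borelMx R m1 m2}) (Ys : 'I_n -> {RV P >-> R})
    (iid : iid_replications P (fun i w => (Xs i w, Ys i w))
             (fun w => (X w, Y w)))
    (X_unif : uniform_basis P X)
    (eta : R) (Y_bounded : {ae P, forall w, `|Y w| <= eta}) :
  (forall (t lambda : R) (Ahat : Omega -> 'M[R]_(m1, m2)),
      0 < t -> 0 < lambda ->
      4 * eta * Num.max
          (Num.sqrt ((t + ln (m1 + m2)%:R) / ((minn m1 m2)%:R * n%:R)))
          (2 * (t + ln (m1 + m2)%:R) / n%:R) <= lambda ->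
      is_nuclear_estimator lambda Xs Ys Ahat ->
      with_prob_ge P
        [set w | forall A : 'M[R]_(m1, m2),
           (risk P X Y (Ahat w) <=
            risk P X Y A +
            (Num.min (2 * lambda * nuclear_norm A)
               (((1 + Num.sqrt 2) / 2) ^+ 2 * m1%:R * m2%:R * lambda ^+ 2
                * (\rank A)%:R))%:E)%E]
        (1 - expR (- t)))
  /\
  (forall (lambda : R) (Ahat : Omega -> 'M[R]_(m1, m2)),
      4 * (minn m1 m2)%:R * ln (m1 + m2)%:R < n%:R :> R ->
      lambda = 4 * eta *
        Num.sqrt (ln (m1 + m2)%:R / ((minn m1 m2)%:R * n%:R)) ->
      is_nuclear_estimator lambda Xs Ys Ahat ->
      let bound := fun A : 'M[R]_(m1, m2) =>
        (risk P X Y A +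
         (4 * (1 + Num.sqrt 2) ^+ 2 * eta ^+ 2 * ln (m1 + m2)%:R
          * ((maxn m1 m2)%:R * (\rank A)%:R / n%:R))%:E)%E in
      exists2 Amin : 'M[R]_(m1, m2), is_argmin bound Amin &
        with_prob_ge P [set w | (risk P X Y (Ahat w) <= bound Amin)%E]
          (1 - 3 / (m1 + m2)%:R)).
Proof.
have m0 : 2 <= (m1 + m2)%:R :> R.
  by rewrite (_ : 2 = (1 + 1)%:R :> R)// ler_nat leq_add.
set L := ln (m1 + m2)%:R; set a := minn m1 m2.
have mp : 0 < (m1 + m2)%:R :> R by lra.
have eL : expR L = (m1 + m2)%:R by rewrite lnK// posrE.
have L0 : 0 < L by rewrite ln_gt0//; lra.
have a0 : 0 < a%:R :> R by rewrite ltr0n leq_min m1_gt0.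
have n0 : 0 < n%:R :> R by rewrite ltr0n.
have c0 : 0 < (m1 * m2)%:R :> R by rewrite ltr0n muln_gt0 m1_gt0.
have eta0 := response_bound_ge0 Y_bounded.
have [A0 [r0 [rE prob]]] := risk_and_error_prob m1_gt0 m2_gt0 n_gt0 iid X_unif Y_bounded.
set c := (m1 * m2)%:R in c0 rE prob.
have sq T : 0 <= T -> n%:R * Num.sqrt (T / (a%:R * n%:R)) = Num.sqrt (n%:R / a%:R * T) :> R.
  move=> T0; have -> : n%:R / a%:R * T = n%:R ^+ 2 * (T / (a%:R * n%:R)).
    by field; rewrite !gt_eqF.
  by rewrite [RHS]sqrtrM ?sqr_ge0// sqrtr_sqr ger0_norm// ltW.
split.
- move=> t lambda Ahat t0 l0 hl est; set T := t + L in hl *.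
  have T0 : 0 < T by rewrite addr_gt0.
  (* [eta * s] is n/2 times the prescribed lower bound for [lambda]. *)
  pose s := Num.max (2 * Num.sqrt (n%:R / a%:R * T)) (4 * T).
  (* The event quantifies over uncountably many [A]. Since the error does not depend on [A], it is
     one sublevel set of the error, at the infimum of [h]. *)
  pose h A := fro2 (A - A0) + c * Num.min (2 * lambda * nuclear_norm A)
     (((1 + Num.sqrt 2) / 2) ^+ 2 * m1%:R * m2%:R * lambda ^+ 2 * (\rank A)%:R).
  have h0 A : 0 <= h A.
    rewrite addr_ge0 ?fro2_ge0// mulr_ge0 ?(ltW c0)// le_min.
    by rewrite !mulr_ge0 ?(ltW l0) ?nuclear_norm_ge0 ?sqr_ge0.
  have hlb : has_lbound (range h) by exists 0 => _ [A _ <-].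
  have -> : [set w | forall A, (risk P X Y (Ahat w) <= risk P X Y A + (Num.min (2 * lambda * nuclear_norm A)
      (((1 + Num.sqrt 2) / 2) ^+ 2 * m1%:R * m2%:R * lambda ^+ 2 * (\rank A)%:R))%:E)%E] =
    [set w | fro2 (Ahat w - A0) <= inf (range h)].
    have E w A : (risk P X Y (Ahat w) <= risk P X Y A + (Num.min (2 * lambda * nuclear_norm A)
      (((1 + Num.sqrt 2) / 2) ^+ 2 * m1%:R * m2%:R * lambda ^+ 2 * (\rank A)%:R))%:E)%E = (fro2 (Ahat w - A0) <= h A).
      rewrite !rE -EFinD lee_fin -addrA lerD2l ler_pdivrMr// mulrDl divfK ?gt_eqF//.
      by rewrite [_ * c]mulrC.
    apply/seteqP; split=> w /= H.
      apply: lb_le_inf; first by exists (h 0), 0.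
      by move=> _ [A _ <-]; rewrite -E.
    by move=> A; rewrite E; apply: le_trans H _; apply: ge_inf => //; exists A.
  apply: (prob lambda Ahat s); rewrite ?(ltW l0)//.
  + by rewrite le_max mulr_ge0 ?sqrtr_ge0.
  + have nM : n%:R * Num.max (Num.sqrt (T / (a%:R * n%:R))) (2 * T / n%:R) =
        Num.max (Num.sqrt (n%:R / a%:R * T)) (2 * T) :> R.
      rewrite maxr_pMr ?ler0n// sq ?(ltW T0)//; congr Num.max.
      by rewrite mulrC divfK// gt_eqF.
    have sE : s = 2 * Num.max (Num.sqrt (n%:R / a%:R * T)) (2 * T).
      by rewrite maxr_pMr// mulrA -[2 * 2]natrM.
    have := ler_wpM2l (ltW n0) hl; rewrite mulrCA nM sE; lra.
  + move=> a' b V p jv kv yv ab a'E abE a'0 b0 p0 mg y1.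
    have -> : expR (- t) = (a' + b)%:R * expR (- T).
      by rewrite abE -eL -expRD /T opprD addrCA subrr addr0.
    by apply: bennett_tail => //; rewrite ?a'E le_max lexx ?orbT.
  + move=> Zw Aw Ho Hm; apply: lb_le_inf; first by exists (h 0), 0.
    move=> _ [A _ <-]; rewrite /h.
    have tau0 : 0 <= c * lambda / 2 by rewrite divr_ge0 ?mulr_ge0// ltW.
    have [h1 h2] := prox_oracle A tau0 Ho Hm.
    have [|] := leP (2 * lambda * nuclear_norm A) _ => _; last apply: le_trans h2 _; [apply: le_trans h1 _|].
      rewrite lerD2l le_eqVlt; apply/orP; left; apply/eqP; by field.
    rewrite lerD2l le_eqVlt; apply/orP; left; apply/eqP; rewrite /c natrM; by field.
- move=> lambda Ahat nL lE est /=.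
  have l0 : 0 <= lambda by rewrite lE !mulr_ge0 ?sqrtr_ge0.
  (* The rank penalty of [prox_oracle] at tau = c lambda / 2; for the present [lambda], division by
     [c] turns it into the stated one. *)
  pose k := (1 + Num.sqrt 2) ^+ 2 * (c * lambda / 2) ^+ 2.
  have k0 : 0 <= k by rewrite mulr_ge0 ?sqr_ge0.
  have [Am HAm] := rank_penalty_minimizer A0 k0.
  have E A : (risk P X Y A + (4 * (1 + Num.sqrt 2) ^+ 2 * eta ^+ 2 * L
          * ((maxn m1 m2)%:R * (\rank A)%:R / n%:R))%:E)%E = (r0 + (fro2 (A - A0) + k * (\rank A)%:R) / c)%:E.
    rewrite rE -EFinD -addrA [in RHS]mulrDl; congr EFin; congr (_ + (_ + _)).
    have l2 : lambda ^+ 2 = 16 * eta ^+ 2 * (L / (a%:R * n%:R)).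
      rewrite lE exprMn sqr_sqrtr; last by rewrite divr_ge0 ?(ltW L0)// mulr_ge0 ltW.
      by ring.
    have cE : c = a%:R * (maxn m1 m2)%:R.
      rewrite /c -natrM /a; congr (_%:R).
      by case: (leqP m1 m2) => _ //; rewrite mulnC.
    have M0 : 0 < (maxn m1 m2)%:R :> R by rewrite ltr0n leq_max m1_gt0.
    rewrite /k exprMn [(c * lambda) ^+ 2]exprMn l2 cE; field; rewrite !gt_eqF//.
  exists Am.
    by move=> A; rewrite !E lee_fin lerD2l ler_pM2r ?invr_gt0.
  have -> : [set w | (risk P X Y (Ahat w) <= risk P X Y Am + (4 * (1 + Num.sqrt 2) ^+ 2 * eta ^+ 2 * L
          * ((maxn m1 m2)%:R * (\rank Am)%:R / n%:R))%:E)%E] =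
     [set w | fro2 (Ahat w - A0) <= fro2 (Am - A0) + k * (\rank Am)%:R].
    apply/seteqP; split=> w /=; rewrite E rE lee_fin lerD2l ler_pM2r ?invr_gt0//.
  apply: (prob lambda Ahat (2 * Num.sqrt (n%:R / a%:R * L))) => //.
  + rewrite -sq ?(ltW L0)// lE -/a le_eqVlt; apply/orP; left; apply/eqP; by field.
  + move=> a' b V p jv kv yv ab a'E abE a'0 b0 p0 mg y1.
    rewrite -abE -/a /a -a'E; apply: tail_prob_le3 => //; first by rewrite eL abE.
    by rewrite ler_pdivlMr ?ltr0n// a'E -/a; move: nL; rewrite -/a; lra.
  + move=> Zw Aw Ho Hm.
    have tau0 : 0 <= c * lambda / 2 by rewrite divr_ge0 ?mulr_ge0// ltW.
    by have [_] := prox_oracle Am tau0 Ho Hm.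
Qed.
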